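(* For every ordered $k$-graph $F$ and $1\leq d\leq k-1$, we have $$\delta_d(\mathsf{O\text{-}Til}_F)=\max\big\{\delta_d(\mathsf{O\text{-}Spa}_F),\ \delta_d(\mathsf{O\text{-}Div}_F),\ \delta_d(\mathsf{O\text{-}Cov}_F)\big\}.$$
   Context: A $k$-graph is a $k$-uniform hypergraph on a finite vertex set; the minimum $d$-degree $\delta_d(G)$ is the largest $\ell$ such that every $d$-subset of $V(G)$ is contained in at least $\ell$ edges. An ordered $k$-graph is a $k$-graph whose vertices are equipped with a linear order. For ordered $k$-graphs $F,G$, a homomorphism $\phi\colon V(F)\to V(G)$ (a map sending edges to edges) is order-preserving if $\phi(u)\leq\phi(v)$ whenever $u<v$. An order-preserving copy of $F$ in $G$ corresponds to an injective order-preserving homomorphism; a perfect order-preserving $F$-tiling of $G$ is a set of order-preserving copies of $F$ in $G$ covering every vertex exactly once. $\delta_d(\mathsf{O\text{-}Til}_F)$ is the infimum over all $\delta\in[0,1]$ such that for all $\mu>0$ and all large enough $n$ divisible by $v(F)$, every $n$-vertex ordered $k$-graph $G$ with $\delta_d(G)\geq(\delta+\mu)\binom{n-d}{k-d}$ has a perfect order-preserving $F$-tiling. An $m$-digraph $H$ consists of a finite vertex set $V(H)$ and an edge set $E(H)\subseteq V(H)^m$ (repeated entries allowed); $\mathrm{m}(v,e)=|\{i:e(i)=v\}|$. With $V(F)=\{1,\dots,m\}$ (natural order), $H^{\mathsf{Ord}}(F;G)$ is the $m$-digraph on $V(G)$ with an edge $(\phi(1),\dots,\phi(m))$ for every order-preserving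 homomorphism $\phi$ from $F$ to $G$. A fractional matching in an $m$-digraph $H$ on $n$ vertices is $w\colon E(H)\to[0,1]$ with $\sum_{e\in H}w(e)\,\mathrm{m}(v,e)\leq1$ for every $v$; it is $\rho$-perfect if $\sum_{e\in H} w(e)\geq(1-\rho)n/m$. $\mathsf{Spa}_\rho$ is the set of uniform digraphs with a $\rho$-perfect fractional matching; $\mathsf{Div}$ is the set of digraphs $H$ admitting $w\colon E(H)\to\mathbb{Z}$ with $\sum_{e\in H}w(e)\,\mathrm{m}(v,e)=1$ for all $v$; $\mathsf{Cov}$ is the set of digraphs in which every vertex $v$ has an edge $e$ with $\mathrm{m}(v,e)=1$. $\delta_d(\mathsf{O\text{-}Spa}_F)$, $\delta_d(\mathsf{O\text{-}Div}_F)$ and $\delta_d(\mathsf{O\text{-}Cov}_F)$ are the infima over all $\delta\in[0,1]$ such that for all $\mu>0$ and $n$ large enough (for $\mathsf{O\text{-}Div}_F$: $n$ large enough and divisible by $v(F)$), every $n$-vertex ordered $k$-graph $G$ with $\delta_d(G)\geq(\delta+\mu)\binom{n-d}{k-d}$ satisfies $H^{\mathsf{Ord}}(F;G)\in\mathsf{Spa}_\mu$, $H^{\mathsf{Ord}}(F;G)\in\mathsf{Div}$ and $H^{\mathsf{Ord}}(F;G)\in\mathsf{Cov}$, respectively. *)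

(* Defs.v *)
From mathcomp Require Import all_boot all_order all_algebra.
From mathcomp Require Import classical_sets reals.

Set Implicit Arguments.
Unset Strict Implicit.
Unset Printing Implicit Defensive.

Import Order.TTheory GRing.Theory Num.Theory.
Local Open Scope ring_scope.

(* An ordered k-graph is a kgraph k V over V : finOrderType. *)
Record kgraph (k : nat) (V : finType) := KGraph {
  edges : {set {set V}};
  edges_uniform : forall e : {set V}, e \in edges -> #|e| = k
}.

Section MinDegree.
Variables (k : nat) (V : finType).
Implicit Type G : kgraph k V.

Definition degree G (S : {set V}) : nat := #|[set e in edges G | S \subset e]|.

(* Restricting the maximum to l <= #|edges G| loses nothing as soon as V has a
   subset of size d; otherwise the condition on l is vacuous and some cap is
   needed. *)
Definition min_degree (d : nat) G : nat :=
  (\max_(l < #|edges G|.+1 |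
      [forall S : {set V}, (#|S| == d) ==> (l <= degree G S)]) l)%N.

End MinDegree.

Section Digraphs.
Variables (m : nat) (V : finType).

Definition mdigraph := {set m.-tuple V}.

Implicit Type H : mdigraph.

Definition mult (v : V) (e : m.-tuple V) : nat := #|[set i | tnth e i == v]|.

Definition fractional_matching (R : realType) H (w : m.-tuple V -> R) : Prop :=
  (forall e, e \in H -> 0 <= w e <= 1) /\
  (forall v, \sum_(e in H) w e * (mult v e)%:R <= 1).

Definition Spa (R : realType) (rho : R) H : Prop :=
  exists w : m.-tuple V -> R, fractional_matching H w /\
    (1 - rho) * #|V|%:R / m%:R <= \sum_(e in H) w e.

Definition Div H : Prop :=
  exists w : m.-tuple V -> int,
    forall v, \sum_(e in H) w e * (mult v e)%:Z = 1.

Definition Cov H : Prop :=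
  forall v, exists2 e, e \in H & mult v e = 1%N.

End Digraphs.

Section OrderedHomomorphisms.
Variables (k m : nat) (disp : Order.disp_t) (V : finOrderType disp).
Variables (F : kgraph k 'I_m) (G : kgraph k V).

Definition ord_hom (phi : {ffun 'I_m -> V}) : bool :=
  [forall e in edges F, phi @: e \in edges G] &&
  [forall u : 'I_m, forall v : 'I_m, (u < v)%N ==> (phi u <= phi v)%O].

Definition HOrd : mdigraph m V :=
  [set [tuple phi i | i < m] | phi : {ffun 'I_m -> V} & ord_hom phi].

(* A copy of F is recorded by its embedding, which is unique since an injective
   order-preserving map from 'I_m is determined by its image. *)
Definition perfect_tiling (T : {set {ffun 'I_m -> V}}) : Prop :=
  (forall phi, phi \in T -> injective phi /\ ord_hom phi) /\
  (forall v, #|[set phi in T | v \in codom phi]| = 1%N).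

Definition has_perfect_tiling : Prop := exists T, perfect_tiling T.

End OrderedHomomorphisms.

Section Thresholds.
Variables (R : realType) (k d : nat).

(* Only orders n divisible by q are considered (q = 1 for no restriction), and
   the property P may depend on mu. The set is bounded below by 0 and, if
   d <= k, contains 1: a d-set lies in at most 'C(n - d, k - d) edges. So
   the default value of inf on sets without infimum plays no role. *)
Definition threshold (q : nat)
    (P : R -> forall disp (V : finOrderType disp), kgraph k V -> Prop) : R :=
  inf [set delta : R | 0 <= delta <= 1 /\
    forall mu : R, 0 < mu ->
    exists n0 : nat, forall n : nat, (n0 <= n)%N -> (q %| n)%N ->
    forall disp (V : finOrderType disp) (G : kgraph k V), #|V| = n ->
      (delta + mu) * 'C(n - d, k - d)%:R <= (min_degree d G)%:R ->
      P mu disp V G]%classic.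

Variables (m : nat) (F : kgraph k 'I_m).

Definition delta_OTil : R :=
  threshold m (fun _ _ _ G => has_perfect_tiling F G).

Definition delta_OSpa : R :=
  threshold 1 (fun mu _ _ G => Spa mu (HOrd F G)).

Definition delta_ODiv : R :=
  threshold m (fun _ _ _ G => Div (HOrd F G)).

Definition delta_OCov : R :=
  threshold 1 (fun _ _ _ G => Cov (HOrd F G)).

End Thresholds.

(* Main.v *)
(* Lower bounds: a perfect tiling is an integral, 0/1-valued certificate for Div,
   and after deleting at most m - 1 vertices (other than a given one) also for
   Spa and Cov.

   Upper bound: let delta_d(G) exceed the maximum by a positive density. Almost
   all samples x of s vertices inherit the degree condition (a Chernoff bound and
   a union bound over d-sets), so their homomorphism digraphs lie in Spa, Div and
   Cov. What matters of a sample is only its type, the set of index maps that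
   become order-preserving homomorphisms: among the positive density of samples of
   one type, Erdős' box theorem yields complete blow-ups, and in a blow-up
   degenerate homomorphisms become genuine copies of F because the parts are
   automatically compatible with the order.
   - Spa gives almost perfect tilings. Call m sets of size b all of whose
     transversals are copies of F a block. Given blocks covering a fraction
     1 - lam of the vertices, cut the vertex set into parts of size b, group the
     parts into random s-tuples, and re-tile a fixed fraction eta of every part by
     smaller blocks, rounding fractional matchings of the samples found there.
     This turns lam into (1 - eta) lam + eta eps.
   - Div and Cov give absorbers. If all samples with one vertex deleted lie in Div,
     every integer vector with sum divisible by m is an integer combination of
     homomorphisms; Cov provides for each vertex of an m-set Q a copy of F through
     it in the blow-up, and the lattice property balances the remaining vertices.
     Each Q has a positive density of absorbers, so a small family of disjoint
     absorbers serves every Q linearly often and absorbs what an almost perfect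
     tiling of the other vertices leaves over. *)
Require Import Defs.
From mathcomp Require Import classical_sets.
From mathcomp Require Import all_boot all_order fingroup perm all_algebra.
From mathcomp Require Import reals.
From mathcomp Require Import zify ring lra.

Set Implicit Arguments.
Unset Strict Implicit.
Unset Printing Implicit Defensive.

Import Order.TTheory GRing.Theory Num.Theory.
Local Open Scope ring_scope.

(** * Counting functions between finite types *)

Section Estimates.
Variable R : realType.

(** Randomness appears only as counting: a random choice is a proportion in a finite function space
    such as [{ffun 'I_s -> V}], and maps with repeated values form a lower-order error. The obstacle
    is that the three hypotheses speak of whole ordered graphs of large order and yield
    homomorphisms that may identify vertices of F. Applied to samples of constant order they leave
    finitely many types, so by pigeonhole a single type keeps a positive proportion of the samples,
    and in a box it is shared by all transversals. This sharing settles the order as well. Let [psi]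
    belong to the common type and let u < v be vertices of F with [psi u] and [psi v] distinct.
    Since every transversal is order-preserving along [psi], each element of the part at [psi u] is
    at most each element of the part at [psi v]; the parts are therefore ordered as F requires,
    without cutting V into intervals beforehand. The only order left to arrange is the one inside a
    part, among vertices of F identified by [psi]. *)

Lemma natr_unbounded (x : R) : exists N : nat, x <= N%:R.
Proof.
exists (Num.truncn `|x|).+1.
by rewrite (le_trans (ler_norm x)) // ltW // truncnS_gt.
Qed.

(** A weakened Bernoulli inequality for 1/q, multiplied out so that q = 0 is allowed. *)
Lemma bernoulli_geom (q : R) (L : nat) :
  0 <= q <= 1 -> q ^+ L * (1 + L%:R * (1 - q)) <= 1.
Proof.
move=> /andP[q0 q1]; elim: L => [|L IH]; first by rewrite expr0; lra.
apply: le_trans IH; rewrite exprSr -mulrA ler_wpM2l ?exprn_ge0 //.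
rewrite -natr1; have L0 : 0 <= L%:R :> R by [].
have : 0 <= (L%:R + 1) * (1 - q) ^+ 2 by rewrite mulr_ge0 ?sqr_ge0 ?addr_ge0.
by rewrite expr2; lra.
Qed.

(** Split q = r t with r halfway between q and 1. The induction hypothesis handles r with p factors
    L + 1, and [bernoulli_geom] for t pays for one more. *)
Lemma poly_geom_small (q : R) (p : nat) (e : R) : 0 <= q < 1 -> 0 < e ->
  exists L0, forall L, (L0 <= L)%N -> L.+1%:R ^+ p * q ^+ L <= e.
Proof.
elim: p q e => [|p IH] q e /andP[q0 q1] e0.
  have [N hN] := natr_unbounded ((e * (1 - q))^-1).
  exists N => L NL; rewrite expr0 mul1r.
  have := @bernoulli_geom q L; rewrite q0 ltW // => /(_ isT).
  have {}hN : 1 <= e * (1 - q) * L%:R.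
    have t0 : 0 < e * (1 - q) by rewrite mulr_gt0 // subr_gt0.
    rewrite -ler_pdivrMl // mulr1 (le_trans hN) // ler_nat //.
  move=> h; have := exprn_ge0 L q0; nra.
set r := (1 + q) / 2; set t := q / r.
have r0 : 0 < r by rewrite /r; lra.
have r1 : r < 1 by rewrite /r; lra.
have t0 : 0 <= t by rewrite divr_ge0 // ltW.
have t1 : t < 1 by rewrite /t ltr_pdivrMr // mul1r /r; lra.
have [||L0 hL] := IH r (e * (1 - t)).
- by rewrite ltW.
- by rewrite mulr_gt0 // subr_gt0.
exists L0 => L /hL {}hL.
have -> : q = r * t by rewrite mulrC divfK // gt_eqF.
rewrite exprSr exprMn mulrACA.
have h1 : L.+1%:R * t ^+ L * (1 - t) <= 1.
  have := @bernoulli_geom t L; rewrite t0 ltW // => /(_ isT).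
  rewrite -natr1; have := exprn_ge0 L t0 => h2 h3.
  apply: le_trans h3; rewrite -mulrA mulrCA ler_wpM2l //; lra.
apply: (@le_trans _ _ (e * (1 - t) * (L.+1%:R * t ^+ L))).
  by rewrite ler_wpM2r // mulr_ge0 // exprn_ge0.
by rewrite -mulrA ler_piMr ?(ltW e0) // mulrC.
Qed.

End Estimates.

Section Counting.
Variable R : realType.

Lemma card_fiber (I J T : finType) (e : J -> I) (y : J -> T) : injective e ->
  (#|[set x : {ffun I -> T} | [forall j, x (e j) == y j]]| <=
     #|T| ^ (#|I| - #|J|))%N.
Proof.
move=> inje.
pose F i : pred T := if [pick j | e j == i] is Some j then pred1 (y j) else predT.
have sub : [set x : {ffun I -> T} | [forall j, x (e j) == y j]] \subset family F.
  apply/subsetP => x; rewrite inE => /forallP h; apply/familyP => i.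
  rewrite /F; case: pickP => [j /eqP <-|//]; exact: h.
apply: leq_trans (subset_leq_card sub) _.
rewrite card_family foldrE big_image /=.
rewrite (bigID (mem (codom e))) /= big1 ?mul1n; last first.
  move=> i /codomP[j ->]; rewrite /F; case: pickP => [j' _|/(_ j)]; last by rewrite eqxx.
  by rewrite card1.
rewrite (eq_bigr (fun _ => #|T|)); last first.
  move=> i ni; rewrite /F; case: pickP => [j /eqP ij|_]; last by apply: eq_card.
  by rewrite -ij codom_f in ni.
rewrite prod_nat_const leq_eqVlt; apply/orP; left; apply/eqP; congr (_ ^ _)%N.
by rewrite -(card_codom inje) -(cardC (mem (codom e))) addKn; apply: eq_card => i.
Qed.

Definition restr (I J T : finType) (e : J -> I) (x : {ffun I -> T}) :
  {ffun J -> T} := [ffun j => x (e j)].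

Lemma card_fibers (X Y : finType) (f : X -> Y) (A : {set X}) (B : {set Y}) c :
  (forall x, x \in A -> f x \in B) ->
  (forall y, y \in B -> #|[set x in A | f x == y]| <= c)%N ->
  (#|A| <= #|B| * c)%N.
Proof.
move=> fAB hc; rewrite -sum1_card (partition_big f (mem B)) //=.
rewrite -sum_nat_const leq_sum // => y yB.
apply: leq_trans (hc y yB); rewrite -sum1_card.
by apply: eq_leq; apply: eq_bigl => x; rewrite inE.
Qed.

Lemma card_restr (I J T : finType) (e : J -> I) (B : {set {ffun J -> T}}) :
  injective e ->
  (#|[set x | restr e x \in B]| <= #|B| * #|T| ^ (#|I| - #|J|))%N.
Proof.
move=> inje; apply: (card_fibers (f := restr e)) => [x|y yB]; first by rewrite inE.
apply: leq_trans (card_fiber y inje); apply: subset_leq_card.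
apply/subsetP => x; rewrite !inE => /andP[_ /eqP <-]; apply/forallP => j.
by rewrite ffunE.
Qed.

Lemma card_ffun_mem1 (I T : finType) (A : {set T}) (i : I) :
  (#|[set x : {ffun I -> T} | x i \in A]| <= #|A| * #|T| ^ #|I|.-1)%N.
Proof.
pose e (j : unit) := i; have inje : injective e by do 2 case.
have := @card_restr _ _ _ e [set y : {ffun unit -> T} | y tt \in A] inje.
rewrite card_unit subn1; set B := [set y : {ffun unit -> T} | _] => h.
apply: (@leq_trans #|[set x : {ffun I -> T} | restr e x \in B]|).
  by apply: subset_leq_card; apply/subsetP => x; rewrite !inE ffunE.
apply: leq_trans h _.
rewrite leq_mul2r; apply/orP; right.
rewrite -(card_in_imset (D := mem B) (f := fun y : {ffun unit -> T} => y tt)).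
  by apply: subset_leq_card; apply/subsetP => t /imsetP[y]; rewrite inE => h1 ->.
by move=> y y' _ _ h1; apply/ffunP; case.
Qed.

Lemma card_ffun_eq2 (I T : finType) (i j : I) : i != j ->
  (#|[set x : {ffun I -> T} | x i == x j]| <= #|T| ^ #|I|.-1)%N.
Proof.
move=> ij; pose e (b : bool) := if b then i else j.
have inje : injective e by case; case=> //= /eqP; rewrite ?(negPf ij) // eq_sym (negPf ij).
have := @card_restr _ _ _ e [set y : {ffun bool -> T} | y true == y false] inje.
rewrite card_bool; set B := [set y : {ffun bool -> T} | _] => h.
apply: (@leq_trans #|[set x : {ffun I -> T} | restr e x \in B]|).
  by apply: subset_leq_card; apply/subsetP => x; rewrite !inE !ffunE.
apply: leq_trans h _.
apply: (@leq_trans (#|T| * #|T| ^ (#|I| - 2))).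
  rewrite leq_mul2r; apply/orP; right.
  rewrite -(card_in_imset (D := mem B) (f := fun y : {ffun bool -> T} => y true)).
    by apply: max_card.
  move=> y y'; rewrite !inE => /eqP h1 /eqP h2 h3; apply/ffunP; case=> //.
  by rewrite -h1 -h2.
rewrite -expnS leq_eqVlt; apply/orP; left; apply/eqP; congr (_ ^ _)%N.
have : (1 < #|I|)%N.
  by have := max_card (mem [set i; j]); rewrite cards2 ij; apply: leq_trans.
by case: #|I| => [|[|N]] //= _; rewrite subn2.
Qed.

Lemma card_bigcup_le (J T : finType) (P : pred J) (Z : J -> {set T}) :
  (#|\bigcup_(j | P j) Z j| <= \sum_(j | P j) #|Z j|)%N.
Proof.
elim/big_rec2: _ => [|j n A _ IH]; first by rewrite cards0.
by rewrite (leq_trans (leq_card_setU _ _).1) // leq_add2l.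
Qed.

Lemma card_ffun_exists (I T : finType) (U : I -> {set T}) u :
  (forall i, #|U i| <= u)%N ->
  (#|[set c : {ffun I -> T} | [exists i, c i \in U i]]| <= #|I| * (u * #|T| ^ #|I|.-1))%N.
Proof.
move=> hU.
apply: (@leq_trans #|\bigcup_(i : I) [set x : {ffun I -> T} | x i \in U i]|).
  apply: subset_leq_card; apply/subsetP => x; rewrite !inE => /existsP[i xi].
  by apply/bigcupP; exists i; rewrite ?inE.
apply: leq_trans (card_bigcup_le _ _) _; rewrite -(sum_nat_const I) [leqRHS](eq_bigl predT) //.
apply: leq_sum => i _; apply: leq_trans (card_ffun_mem1 _ _) _.
by rewrite leq_mul2r hU orbT.
Qed.

Lemma card_noninj (I T : finType) :
  (#|[set x : {ffun I -> T} | ~~ injectiveb x]| <= #|I| ^ 2 * #|T| ^ #|I|.-1)%N.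
Proof.
have sub : [set x : {ffun I -> T} | ~~ injectiveb x] \subset
    \bigcup_(p : I * I | p.1 != p.2) [set x : {ffun I -> T} | x p.1 == x p.2].
  apply/subsetP => x; rewrite inE => /injectivePn[i [j ij xij]].
  by apply/bigcupP; exists (i, j); rewrite //= inE xij.
apply: leq_trans (subset_leq_card sub) _.
have -> : (#|I| ^ 2 = #|{: I * I}|)%N by rewrite card_prod.
rewrite -sum_nat_const; apply: leq_trans (card_bigcup_le _ _) _.
rewrite [leqRHS](bigID (fun p : I * I => p.1 != p.2)) /=.
by apply: leq_trans (leq_addr _ _); apply: leq_sum => p; apply: card_ffun_eq2.
Qed.

(** Reverse Markov inequality: points where f is below p M / 2 contribute at most half of the
    assumed total, and the others at most M each. *)
Lemma markov_count (X : finType) (f : X -> R) (M p : R) : 0 <= M ->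
  (forall x, f x <= M) -> 0 <= p -> p * M * #|X|%:R <= \sum_x f x ->
  0 < M -> p / 2 * #|X|%:R <= #|[set x | p / 2 * M <= f x]|%:R.
Proof.
move=> M0 fM p0 h Mp.
have : \sum_x f x <= M * #|[set x | p / 2 * M <= f x]|%:R + p / 2 * M * #|X|%:R.
  rewrite (bigID (mem [set x | p / 2 * M <= f x])) /=; apply: lerD.
    rewrite mulr_natr -sumr_const; apply: ler_sum => x _; exact: fM.
  apply: (@le_trans _ _ (\sum_(x in ~: [set x | p / 2 * M <= f x]) (p / 2 * M))).
    under [leLHS]eq_bigl do rewrite -in_setC.
    by apply: ler_sum => x; rewrite !inE -ltNge => /ltW.
  rewrite sumr_const -[leLHS]mulr_natr ler_wpM2l ?mulr_ge0 ?invr_ge0 //.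
  by rewrite ler_nat max_card.
move/(le_trans h) => {}h.
by rewrite -(ler_pM2l Mp); lra.
Qed.

End Counting.

(** * Boxes in dense sets of tuples *)

Section Boxes.
Variable R : realType.

Definition fcons (T : Type) s (t : T) (x : {ffun 'I_s -> T}) :
  {ffun 'I_s.+1 -> T} := [ffun i => oapp x t (unlift ord0 i)].

Lemma card_fcons (T : finType) s (B : {set {ffun 'I_s.+1 -> T}}) :
  #|B| = (\sum_t #|[set x | fcons t x \in B]|)%N.
Proof.
rewrite -sum1_card (partition_big (fun x : {ffun 'I_s.+1 -> T} => x ord0) predT) //=.
apply: eq_bigr => t _; rewrite -sum1_card.
pose tl (x : {ffun 'I_s.+1 -> T}) := [ffun j => x (lift ord0 j)].
rewrite (reindex_onto (fcons t) tl) /=; last first.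
  move=> x /andP[_ /eqP xt]; apply/ffunP => i; rewrite ffunE.
  by case: unliftP => [j|] -> /=; rewrite ?ffunE.
apply: eq_bigl => x; rewrite !inE ffunE unlift_none /= eqxx andbT.
suff -> : tl (fcons t x) == x by rewrite andbT.
by apply/eqP/ffunP => j; rewrite !ffunE liftK.
Qed.

(** Rows may repeat entries or share them. This keeps the count multiplicative; the degenerate boxes
    are few and are discarded where boxes are used. *)
Definition boxes (T : finType) s b (A : {set {ffun 'I_s -> T}}) :
    {set {ffun 'I_s -> {ffun 'I_b -> T}}} :=
  [set X : {ffun 'I_s -> {ffun 'I_b -> T}} | [forall c : {ffun 'I_s -> 'I_b}, [ffun i => X i (c i)] \in A]].

(* Erdős' box theorem in counting form; two Markov steps replace Jensen. *)
Lemma boxes_dense b s (p : R) : (0 < b)%N -> 0 < p ->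
  exists2 c : R, 0 < c & forall (T : finType) (A : {set {ffun 'I_s -> T}}),
    p * #|T|%:R ^+ s <= #|A|%:R -> c * #|T|%:R ^+ (s * b) <= #|boxes b A|%:R.
Proof.
move=> b0; elim: s p => [|s IH] p p0.
  exists 1 => // T A; rewrite mul0n !expr0 mulr1 mul1r => pA.
  have A0 : (0 < #|A|)%N by rewrite -(ltr0n R) (lt_le_trans p0).
  case/card_gt0P: A0 => x xA; rewrite (ler_nat R 1) card_gt0.
  apply/set0Pn; exists [ffun i => [ffun => x i]]; rewrite inE; apply/forallP => c.
  by rewrite (_ : [ffun i => _] = x) //; apply/ffunP => -[].
(* One factor p / 2 is the proportion of tails x with [deg x] at least p / 2 times #|T|; the other b
   factors bound from below the proportion of b-tuples of heads all compatible with such an x. *)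
pose p2 : R := (p / 2) ^+ b.+1.
have p20 : 0 < p2 by rewrite exprn_gt0 // divr_gt0.
have [|c c0 hc] := IH (p2 / 2); first by rewrite divr_gt0.
exists (p2 / 2 * c) => [|T A hA]; first by rewrite mulr_gt0 ?divr_gt0.
have [T0|T0] := posnP #|T|.
  by rewrite T0 expr0n mulSn addn_eq0 (gtn_eqF b0) /= mulr0 ler0n.
have nT0 : (0 : R) < #|T|%:R by rewrite ltr0n.
pose deg x := #|[set t | fcons t x \in A]|.
have sdeg : (\sum_x deg x = #|A|)%N.
  rewrite card_fcons /deg; under eq_bigr do rewrite -sum1_card big_mkcond /=.
  rewrite exchange_big /=; apply: eq_bigr => t _.
  by rewrite -sum1_card [RHS]big_mkcond /=; apply: eq_bigr => x _; rewrite !inE.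
have h1 : p / 2 * #|T|%:R ^+ s <=
    #|[set x | p / 2 * #|T|%:R <= (deg x)%:R]|%:R.
  have := @markov_count R _ (fun x => (deg x)%:R) #|T|%:R p.
  rewrite card_ffun card_ord natrX; apply => //.
  - by move=> x; rewrite ler_nat max_card.
  - exact: ltW.
  - by rewrite -natr_sum sdeg -mulrA -exprS.
pose At (t : {ffun 'I_b -> T}) := [set x | [forall j, fcons (t j) x \in A]].
have sAt : (\sum_t #|At t| = \sum_x deg x ^ b)%N.
  under eq_bigr do rewrite -sum1_card big_mkcond /=.
  rewrite exchange_big /=; apply: eq_bigr => x _.
  rewrite -big_mkcond /= sum1_card.
  rewrite -[b in RHS]card_ord -card_ffun_on; apply: eq_card => t.
  rewrite [LHS](_ : _ = (x \in At t)) // inE.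
  by apply/forallP/ffun_onP => h j; move/(_ j): h; rewrite ?inE.
have h2 : p2 * #|T|%:R ^+ s * #|T|%:R ^+ b <= \sum_t #|At t|%:R.
  rewrite -natr_sum sAt natr_sum.
  apply: (@le_trans _ _ (\sum_(x in [set x | p / 2 * #|T|%:R <= (deg x)%:R])
      (p / 2 * #|T|%:R) ^+ b)).
    rewrite sumr_const -[leRHS]mulr_natr.
    apply: (@le_trans _ _ ((p / 2 * #|T|%:R) ^+ b * (p / 2 * #|T|%:R ^+ s))).
      rewrite exprMn /p2 exprS le_eqVlt; apply/orP; left; apply/eqP.
      by move: (#|T|%:R ^+ s) (#|T|%:R ^+ b) ((p / 2) ^+ b) => u v w; ring.
    by rewrite ler_wpM2l // exprn_ge0 // mulr_ge0 // divr_ge0 // ltW.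
  rewrite big_mkcond /=; apply: ler_sum => x _; rewrite inE.
  case: ifP => [h|_]; last by rewrite ler0n.
  by rewrite natrX lerXn2r // nnegrE ?ler0n // mulr_ge0 // divr_ge0 // ltW.
have h3 : p2 / 2 * #|T|%:R ^+ b <=
    #|[set t | p2 / 2 * #|T|%:R ^+ s <= #|At t|%:R]|%:R.
  have := @markov_count R _ (fun t => #|At t|%:R) (#|T|%:R ^+ s) p2.
  rewrite card_ffun card_ord natrX; apply => //.
  - by rewrite exprn_ge0.
  - by move=> t; rewrite -natrX ler_nat (leq_trans (max_card _)) // card_ffun card_ord.
  - exact: ltW.
  - by rewrite exprn_gt0.
rewrite (@card_fcons _ s) natr_sum.
apply: (@le_trans _ _ (\sum_(t in [set t | p2 / 2 * #|T|%:R ^+ s <= #|At t|%:R])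
    (c * #|T|%:R ^+ (s * b)))).
  rewrite sumr_const -[leRHS]mulr_natr mulSn exprD.
  apply: (@le_trans _ _ (c * #|T|%:R ^+ (s * b) * (p2 / 2 * #|T|%:R ^+ b))).
    rewrite le_eqVlt; apply/orP; left; apply/eqP.
    by move: (#|T|%:R ^+ b) (#|T|%:R ^+ (s * b)) => u v; ring.
  by rewrite ler_wpM2l // mulr_ge0 ?exprn_ge0 // ltW.
rewrite big_mkcond /=; apply: ler_sum => t _; rewrite inE.
case: ifP => [h|_]; last by rewrite ler0n.
apply: (le_trans (hc _ _ h)); rewrite ler_nat; apply: subset_leq_card.
apply/subsetP => X; rewrite !inE => /forallP hX; apply/forallP => d.
have := hX [ffun j => d (lift ord0 j)]; rewrite inE => /forallP /(_ (d ord0)).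
rewrite (_ : fcons _ _ = [ffun i => fcons t X i (d i)]) //.
apply/ffunP => i; rewrite !ffunE.
by case: unliftP => [j|] -> /=; rewrite ?ffunE.
Qed.

End Boxes.

(** * Random samples inherit degrees *)

Section Chernoff.
Variable R : realType.

Lemma bernoulli_sub (h : R) n : 0 <= h <= 1 -> 1 - n%:R * h <= (1 - h) ^+ n.
Proof.
move=> /andP[h0 h1]; elim: n => [|n IH]; first by rewrite expr0; lra.
rewrite exprS; apply: (@le_trans _ _ ((1 - h) * (1 - n%:R * h))).
  by rewrite -natr1; have : 0 <= n%:R * h ^+ 2 :> R;
    [rewrite mulr_ge0 ?sqr_ge0 | rewrite expr2; lra].
by rewrite ler_wpM2l // subr_ge0.
Qed.

(* A rational A / B between a and p lets the moment generating function be
   written with natural exponents only. *)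
Lemma chernoff_base (a p : R) : 0 <= a < p -> p <= 1 ->
  exists A B : nat, exists2 h : R, 0 < h < 1 &
    [/\ a * B%:R <= A%:R, (0 < B)%N & 1 - p * (1 - (1 - h) ^+ B) < (1 - h) ^+ A].
Proof.
move=> /andP[a0 ap] p1.
have [B hB] := natr_unbounded ((p - a)^-1 + 1).
have pa0 : 0 < p - a by rewrite subr_gt0.
have B1 : 1 < (p - a) * B%:R.
  by rewrite mulrC -ltr_pdivrMr // mul1r (lt_le_trans _ hB) // ltrDl.
have B0 : (0 : R) < B%:R by rewrite (lt_le_trans _ hB) // addr_gt0 // invr_gt0.
pose A := (Num.truncn (a * B%:R)).+1.
have A1 : a * B%:R <= A%:R by rewrite ltW // truncnS_gt.
have A2 : A%:R <= a * B%:R + 1.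
  by rewrite -natr1 lerD2r truncn_le // mulr_ge0.
have A0 : (1 : R) <= A%:R by rewrite ler1n.
exists A, B; pose h : R := (p * B%:R - A%:R) / (2 * A%:R * B%:R).
have AB0 : 0 < 2 * A%:R * B%:R :> R by rewrite !mulr_gt0 // (lt_le_trans _ A0).
have hAB : h * (2 * A%:R * B%:R) = p * B%:R - A%:R by rewrite divfK // gt_eqF.
have h0 : 0 < h by rewrite divr_gt0 //; lra.
have h1 : h < 1.
  rewrite ltr_pdivrMr // mul1r.
  have : 0 <= (A%:R - 1) * B%:R :> R by rewrite mulr_ge0 ?subr_ge0 // ltW.
  have : p * B%:R <= B%:R by rewrite ler_piMl // ltW.
  nra.
exists h; first by rewrite h0.
split=> //; first by rewrite -(ltr0n R).
have hA : 1 - A%:R * h <= (1 - h) ^+ A by apply: bernoulli_sub; rewrite !ltW.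
have : (1 - h) ^+ B * (1 + B%:R * (1 - (1 - h))) <= 1 by apply: bernoulli_geom; lra.
rewrite opprB [1 + (h - 1)]addrC subrK; set w := (1 - h) ^+ B => hw.
apply: lt_le_trans hA.
rewrite ltrD2l ltrN2.
have Bh : 0 < 1 + B%:R * h by rewrite addr_gt0 // mulr_gt0.
rewrite -(ltr_pM2r Bh).
have p0 : 0 < p by apply: le_lt_trans ap.
have : p * (B%:R * h) <= p * (1 - w) * (1 + B%:R * h).
  by rewrite -mulrA ler_wpM2l ?(ltW p0) //; lra.
apply: lt_le_trans.
have -> : A%:R * h * (1 + B%:R * h) = h * (A%:R + h * (2 * A%:R * B%:R) / 2) by field.
have -> : p * (B%:R * h) = h * (p * B%:R) by ring.
by rewrite hAB ltr_pM2l //; lra.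
Qed.

(** Exponential Markov inequality: weight each hit of [A] by [w] = (1 - h)^B. The sum over all y
    factors into an L-th power, while a y with few hits weighs at least (1 - h)^(A0 L), where [A0] /
    [B] is at least a. *)
Lemma chernoff (a p : R) : 0 <= a < p ->
  exists2 q : R, 0 <= q < 1 & forall L (T : finType) (A : {set T}),
    p * #|T|%:R <= #|A|%:R ->
    #|[set y : {ffun 'I_L -> T} | #|[set j | y j \in A]|%:R <= a * L%:R]|%:R
      <= q ^+ L * #|T|%:R ^+ L.
Proof.
move=> ap; have [p1|p1] := leP p 1; last first.
  exists 0 => [|L T A hA]; first by rewrite lexx ltr01.
  have T0 : #|T|%:R = 0 :> R.
    apply/eqP; rewrite eq_le ler0n andbT.
    have := max_card (mem A); rewrite -(ler_nat R); have : (0 : R) <= #|T|%:R by [].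
    nra.
  rewrite T0 -exprMn mul0r expr0n.
  have : (#|T| ^ L)%:R = (L == 0)%:R :> R by rewrite natrX T0 expr0n.
  by move=> <-; rewrite ler_nat (leq_trans (max_card _)) // card_ffun card_ord.
have [A0 [B [h /andP[h0 h1] [aB B0 hq]]]] := chernoff_base ap p1.
have g0 : 0 < 1 - h by rewrite subr_gt0.
have g1 : 1 - h <= 1 by rewrite lerBlDr ler_wpDr // ltW.
have p0 : 0 <= p by case/andP: ap => ? /ltW; apply: le_trans.
set w := (1 - h) ^+ B in hq.
have w0 : 0 <= w by rewrite exprn_ge0 // ltW.
have w1 : w <= 1 by rewrite exprn_ile1 // ltW.
pose num := 1 - p * (1 - w).
have num0 : 0 <= num.
  by rewrite subr_ge0 mulr_ile1 // ?subr_ge0 // lerBlDr ler_wpDr.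
exists (num / (1 - h) ^+ A0).
  by rewrite divr_ge0 ?exprn_ge0 ?(ltW g0) //= ltr_pdivrMr ?exprn_gt0 // mul1r.
move=> L T A hA.
set low := [set y | _].
pose g t : R := if t \in A then w else 1.
have tot : \sum_(y : {ffun 'I_L -> T}) \prod_j g (y j) <= (num * #|T|%:R) ^+ L.
  rewrite -(bigA_distr_bigA (fun (_ : 'I_L) t => g t)) /= prodr_const card_ord.
  have sg : \sum_t g t = #|T|%:R - (1 - w) * #|A|%:R.
    have -> : #|T|%:R = \sum_(t : T) (1 : R) by rewrite sumr_const cardT.
    rewrite mulr_natr -sumr_const [X in _ - X]big_mkcond /= -sumrB.
    by apply: eq_bigr => t _; rewrite /g; case: ifP => _; lra.
  rewrite lerXn2r ?nnegrE ?mulr_ge0 //.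
    by apply: sumr_ge0 => t _; rewrite /g; case: ifP.
  rewrite sg /num; have : 0 <= 1 - w by rewrite subr_ge0.
  nra.
have lowg (y : {ffun 'I_L -> T}) : y \in low -> ((1 - h) ^+ A0) ^+ L <= \prod_j g (y j).
  rewrite inE => hy.
  have -> : \prod_j g (y j) = w ^+ #|[set j | y j \in A]|.
    rewrite /g -big_mkcond /= -prodr_const; apply: eq_bigl => j; by rewrite inE.
  rewrite /w -!exprM; apply: ler_wiXn2l => //; first exact: ltW.
  rewrite -(ler_nat R) !natrM.
  apply: (@le_trans _ _ (B%:R * (a * L%:R))); first by rewrite ler_wpM2l.
  by rewrite mulrA [B%:R * a]mulrC ler_wpM2r.
rewrite expr_div_n -mulrA mulrCA -exprMn mulrC ler_pdivlMr ?exprn_gt0 //.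
apply: le_trans tot.
rewrite mulrC mulr_natr -sumr_const [leLHS]big_mkcond /=; apply: ler_sum => y _.
case: ifP => [/lowg //|_]; apply: prodr_ge0 => j _; rewrite /g; case: ifP => //.
Qed.

End Chernoff.

Section Sampling.
Variable R : realType.

Lemma double_count (X Y : finType) (rl : X -> Y -> bool) (A : {set X}) (c1 c2 : R) :
  (forall x, x \in A -> c1 <= #|[set y | rl x y]|%:R) ->
  (forall y, #|[set x | rl x y]|%:R <= c2) ->
  #|A|%:R * c1 <= #|Y|%:R * c2.
Proof.
move=> h1 h2; rewrite ![_%:R * _]mulrC !mulr_natr -!sumr_const.
apply: (@le_trans _ _ (\sum_(x in A) #|[set y | rl x y]|%:R)); first exact: ler_sum.
apply: (@le_trans _ _ (\sum_(y in Y) #|[set x | rl x y]|%:R)); last first.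
  by apply: ler_sum => y _.
rewrite -!natr_sum ler_nat.
under eq_bigr do rewrite -sum1_card big_mkcond /=.
rewrite exchange_big /=; apply: leq_sum => y _.
rewrite -big_mkcondr /= sum1_card; apply: subset_leq_card.
by apply/subsetP => x; rewrite !inE => /andP[_]; rewrite inE.
Qed.

Lemma card_fibersR (X Y : finType) (f : X -> Y) (A : {set X}) (c : R) :
  (forall y, #|[set x in A | f x == y]|%:R <= c) -> #|A|%:R <= #|Y|%:R * c.
Proof.
move=> h; rewrite -[#|A|%:R]mulr1.
have := @double_count X Y (fun x y => (x \in A) && (f x == y)) A 1 c; apply => //.
move=> x xA; rewrite (ler_nat R 1) card_gt0; apply/set0Pn; exists (f x).
by rewrite inE xA eqxx.
Qed.

Lemma card_meets (K T : finType) (D : {set T}) :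
  (#|[set z : {ffun K -> T} | ~~ (injectiveb z && [forall k, z k \notin D])]|
    <= #|K| * (#|K| + #|D|) * #|T| ^ #|K|.-1)%N.
Proof.
have sub : [set z : {ffun K -> T} | ~~ (injectiveb z && [forall k, z k \notin D])]
    \subset [set z : {ffun K -> T} | ~~ injectiveb z] :|:
            [set z : {ffun K -> T} | [exists k, z k \in D]].
  apply/subsetP => z; rewrite !inE negb_and => /orP[->//|/forallPn[k]].
  by rewrite negbK => zk; apply/orP; right; apply/existsP; exists k.
apply: leq_trans (subset_leq_card sub) _.
rewrite (leq_trans (leq_card_setU _ _).1) // mulnDr mulnDl mulnn.
apply: leq_add; first exact: card_noninj.
by rewrite -mulnA; apply: (card_ffun_exists (U := fun=> D)).
Qed.

Definition blk (T : Type) L r (z : {ffun 'I_L * 'I_r -> T}) (j : 'I_L) :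
  {ffun 'I_r -> T} := [ffun i => z (j, i)].

Definition hits (T : finType) L r (A : {set {ffun 'I_r -> T}})
  (z : {ffun 'I_L * 'I_r -> T}) := #|[set j | blk z j \in A]|.

(** Markov's inequality: the mean number of hits is at most (c + g/2) L, so the proportion of z with
    more than (c + 3g/4) L hits is at most (c + g/2) / (c + 3g/4), which leaves at least (g/4) / (c
    + g). *)
Lemma card_low_blocks (T : finType) L r (A : {set {ffun 'I_r -> T}}) (c g : R) :
  (0 < L)%N -> (0 < #|T|)%N -> 0 <= c -> 0 < g -> #|A|%:R <= (c + g / 2) * #|T|%:R ^+ r ->
  g / 4 / (c + g) * #|T|%:R ^+ (L * r) <=
  #|[set z : {ffun 'I_L * 'I_r -> T} | (hits A z)%:R <= (c + 3 * g / 4) * L%:R]|%:R.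
Proof.
move=> L0 T0 c0 g0 hA; set low := [set z | _].
have nL : (0 : R) < L%:R by rewrite ltr0n.
have cardZ : #|{: {ffun 'I_L * 'I_r -> T}}|%:R = #|T|%:R ^+ (L * r) :> R.
  by rewrite card_ffun card_prod !card_ord natrX.
have : #|~: low|%:R * ((c + 3 * g / 4) * L%:R) <=
    #|'I_L|%:R * ((c + g / 2) * #|T|%:R ^+ (L * r)).
  apply: (double_count (rl := fun z j => blk z j \in A)) => [z|j].
    by rewrite !inE -ltNge => /ltW.
  pose e (i : 'I_r) := (j, i).
  have inje : injective e by move=> i i' [].
  have := @card_restr _ _ _ e A inje.
  rewrite card_prod !card_ord -(ler_nat R) natrM natrX => h.
  apply: (@le_trans _ _ #|[set x | restr e x \in A]|%:R).
    by rewrite ler_nat; apply: subset_leq_card; apply/subsetP => x; rewrite !inE.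
  apply: le_trans h _; have -> : (L * r = r + (L * r - r))%N.
    by rewrite subnKC // leq_pmull.
  by rewrite exprD [(r + _ - r)%N]addKn mulrA ler_wpM2r // exprn_ge0.
rewrite card_ord.
have : #|low|%:R + #|~: low|%:R = #|T|%:R ^+ (L * r) :> R.
  by rewrite -natrD cardsC cardZ.
have : 0 <= #|T|%:R ^+ (L * r) :> R by rewrite exprn_ge0.
have : 0 <= #|low|%:R :> R by [].
move: (#|low|%:R) (#|~: low|%:R) (#|T|%:R ^+ (L * r)) (L%:R : R) nL => l l' N x x0.
move=> l0 N0 <- h.
have {}h : l' * (c + 3 * g / 4) <= (c + g / 2) * (l + l').
  by rewrite -(ler_pM2l x0); lra.
have cg : 0 < c + g by apply: ltr_wpDl.
rewrite mulrAC ler_pdivrMr //.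
have : 0 <= l * c by rewrite mulr_ge0.
have : 0 <= l * g by rewrite mulr_ge0 // ltW.
lra.
Qed.

(** Once the first d coordinates are fixed, the target set [P] is fixed too and the L blocks vary
    independently, so the bound holds fibre by fibre. *)
Lemma card_valid_low (V : finType) L r d (valid : pred {ffun 'I_d -> V})
    (P : {ffun 'I_d -> V} -> {set {ffun 'I_r -> V}}) (a : R) (B : R) :
  (forall y, valid y -> #|[set w : {ffun 'I_L -> {ffun 'I_r -> V}} |
      #|[set j | w j \in P y]|%:R <= a * L%:R]|%:R <= B) -> 0 <= B ->
  #|[set y : {ffun 'I_d + 'I_L * 'I_r -> V} |
      valid (restr inl y) && ((hits (P (restr inl y)) (restr inr y))%:R <= a * L%:R)]|%:R
    <= #|V|%:R ^+ d * B.
Proof.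
move=> h B0.
have -> : #|V|%:R ^+ d = #|{: {ffun 'I_d -> V}}|%:R :> R.
  by rewrite card_ffun card_ord natrX.
apply: (card_fibersR (f := restr inl)) => y1.
have [vy|nvy] := boolP (valid y1); last first.
  rewrite (_ : [set _ in _ | _] = set0) ?cards0 //.
  apply/setP => y; rewrite !inE; apply/negP => /andP[/andP[h1 _] /eqP h2].
  by rewrite -h2 h1 in nvy.
apply: le_trans (h _ vy); rewrite ler_nat.
pose F (y : {ffun 'I_d + 'I_L * 'I_r -> V}) := [ffun j => blk (restr inr y) j].
rewrite -(card_in_imset (f := F)).
  apply: subset_leq_card; apply/subsetP => w /imsetP[y]; rewrite !inE.
  move=> /andP[/andP[_ h1] /eqP h2] ->; rewrite -h2; congr (_ <= _): h1.
  by congr (_%:R); apply: eq_card => j; rewrite !inE ffunE.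
move=> y y'; rewrite !inE => /andP[_ /eqP h1] /andP[_ /eqP h2] h3.
apply/ffunP => -[i|[j i]].
  have /ffunP/(_ i) : restr inl y = restr inl y' by rewrite h1 h2.
  by rewrite !ffunE.
by move/ffunP/(_ j): h3; rewrite !ffunE => /ffunP/(_ i); rewrite !ffunE.
Qed.

Lemma fourth_root s : exists2 L, (L ^ 4 <= s)%N & (s < L.+1 ^ 4)%N.
Proof.
have ex : exists L, (L ^ 4 <= s)%N by exists 0%N.
have ub L : (L ^ 4 <= s)%N -> (L <= s)%N.
  apply: leq_trans; case: L => // L.
  by rewrite !expnS expn0 leq_pmulr // !muln_gt0.
case: (ex_maxnP ex ub) => L h1 h2; exists L => //.
by rewrite ltnNge; apply/negP => /h2; rewrite ltnn.
Qed.

(** [valid] and [P] stay abstract because two instances occur: extensions of d-sets of V, and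
    extensions of (d - 1)-sets completed by a prescribed vertex. *)
Definition sample_bad (V : finType) s d r (valid : pred {ffun 'I_d -> V})
    (P : {ffun 'I_d -> V} -> {set {ffun 'I_r -> V}}) (c : R) :
    {set {ffun 'I_s -> V}} :=
  [set x : {ffun 'I_s -> V} | [exists u : {ffun 'I_d -> 'I_s},
     [&& injectiveb u, valid (restr u x) &
       #|[set z : {ffun 'I_r -> 'I_s} | restr z x \in P (restr u x)]|%:R < c * s%:R ^+ r]]].

(* Each bad tuple x is detected by a constant proportion of the families of L
   disjoint r-blocks of indices, while for a fixed family the blocks of a random
   x are independent. Taking L of order s^(1/4) keeps a random family disjoint
   and still beats the union bound over the s^d choices of u. *)
Lemma sampling (c g f : R) d r : 0 <= c -> 0 < g -> 0 < f ->
  exists s0, forall s, (s0 <= s)%N ->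
  forall (V : finType) (valid : pred {ffun 'I_d -> V})
    (P : {ffun 'I_d -> V} -> {set {ffun 'I_r -> V}}),
  (forall y, valid y -> (c + g) * #|V|%:R ^+ r <= #|P y|%:R) ->
  #|sample_bad s valid P (c + g / 2)|%:R <= f * #|V|%:R ^+ s.
Proof.
move=> c0 g0 f0.
have cg : 0 < c + g by apply: ltr_wpDl.
have [|q q01 hq] := @chernoff R (c + 3 * g / 4) (c + g); first by lra.
(* The proportion of block families that see too few hits in a bad sample, by [card_low_blocks].
   Half of it is given up for families that repeat an index or meet [u]. *)
pose k : R := g / 4 / (c + g).
have k0 : 0 < k by rewrite !divr_gt0.
have [L1 hL1] := @poly_geom_small R q (4 * d) (f * (k / 2)) q01
   (mulr_gt0 f0 (divr_gt0 k0 (ltr0Sn _ _))).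
have [L2 hL2] := natr_unbounded ((d + r)%:R ^+ 2 / (k / 2)).
pose L0 := maxn 1 (maxn L1 L2); exists (L0 ^ 4)%N => s hs V valid P hP.
have [L Ls sL] := fourth_root s.
have L0L : (L0 <= L)%N by rewrite -ltnS -(ltn_exp2r _ _ (isT : 0 < 4)%N) (leq_ltn_trans hs).
have [L1L L2L Lpos] : [/\ (L1 <= L)%N, (L2 <= L)%N & (0 < L)%N].
  by move: L0L; rewrite /L0 !geq_max => /and3P[].
have spos : (0 < s)%N by rewrite (leq_trans _ Ls) // expn_gt0 Lpos.
have s0 : (0 : R) < s%:R by rewrite ltr0n.
have q0 : 0 <= q by case/andP: q01.
have n0 : 0 <= #|V|%:R :> R by [].
set bad := sample_bad _ _ _ _.
pose e (u : {ffun 'I_d -> 'I_s}) (z : {ffun 'I_L * 'I_r -> 'I_s}) (j : 'I_d + 'I_L * 'I_r) :=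
  match j with inl i => u i | inr i => z i end.
pose rl (x : {ffun 'I_s -> V}) (p : {ffun 'I_d -> 'I_s} * {ffun 'I_L * 'I_r -> 'I_s}) :=
  [&& injectiveb [ffun j => e p.1 p.2 j], valid (restr p.1 x) &
     (hits (P (restr p.1 x)) (restr p.2 x))%:R <= (c + 3 * g / 4) * L%:R].
have lower x : x \in bad -> k / 2 * s%:R ^+ (L * r) <= #|[set p | rl x p]|%:R.
  rewrite inE => /existsP[u /and3P[/injectiveP uinj uval hu]].
  pose A := [set z : {ffun 'I_r -> 'I_s} | restr z x \in P (restr u x)].
  have := @card_low_blocks 'I_s L r A c g Lpos.
  rewrite card_ord => /(_ spos c0 g0 (ltW hu)).
  set low := [set z : {ffun 'I_L * 'I_r -> 'I_s} | _] => h1.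
  pose D := [set u i | i in 'I_d].
  have := @card_meets ('I_L * 'I_r)%type 'I_s D.
  set meets := [set z : {ffun 'I_L * 'I_r -> 'I_s} | ~~ _]; rewrite card_prod !card_ord => h2.
  have h3 : #|meets|%:R <= k / 2 * s%:R ^+ (L * r) :> R.
    have [Lr0|Lr0] := posnP (L * r)%N.
      move: h2; rewrite Lr0 !mul0n leqn0 => /eqP ->.
      by rewrite mulr_ge0 ?exprn_ge0 // divr_ge0 // ltW.
    apply: (@le_trans _ _ (((d + r) ^ 2 * L ^ 2)%N%:R * s%:R ^+ (L * r).-1)).
      rewrite -natrX -natrM ler_nat (leq_trans h2) // leq_mul2r; apply/orP; right.
      have Dd : (#|D| <= d)%N by rewrite (leq_trans (leq_imset_card _ _)) // card_ord.
      rewrite -expnMn -mulnn; apply: leq_mul; first by rewrite mulnC leq_mul2r leq_addl orbT.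
      rewrite mulnDl [(d * L + _)%N]addnC leq_add // ?[(r * L)%N]mulnC //.
      by rewrite (leq_trans Dd) // leq_pmulr.
    rewrite -[(L * r)%N in leRHS](prednK Lr0) exprS mulrA ler_wpM2r ?exprn_ge0 //.
    have k20 : 0 < k / 2 by rewrite divr_gt0.
    apply: (@le_trans _ _ (k / 2 * (L ^ 4)%:R)); last by rewrite ler_wpM2l ?ler_nat // ltW.
    have : (d + r)%:R ^+ 2 <= k / 2 * (L ^ 2)%:R.
      rewrite mulrC -ler_pdivrMr // (le_trans hL2) // ler_nat (leq_trans L2L) //.
      by rewrite -mulnn leq_pmulr.
    rewrite (_ : (L ^ 4 = L ^ 2 * L ^ 2)%N); last by rewrite -expnD.
    move=> h; rewrite [((d + r) ^ 2 * _)%:R]natrM [(L ^ 2 * _)%:R]natrM.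
    by rewrite [((d + r) ^ 2)%:R]natrX mulrA ler_wpM2r.
  have h4 : #|low :\: meets|%:R <= #|[set p | rl x p]|%:R :> R.
    have <- : #|[set (u, z) | z in low :\: meets]| = #|low :\: meets|.
      by apply: card_imset => z z' [].
    rewrite ler_nat; apply: subset_leq_card; apply/subsetP => p /imsetP[z]; rewrite !inE.
    move=> /andP[] /negPn /andP[/injectiveP zinj /forallP zD] hz ->.
    rewrite /rl /= uval; apply/andP; split.
      apply/injectiveP => -[i|i] [j|j]; rewrite !ffunE /= => h.
      - by rewrite (uinj _ _ h).
      - by have := zD j; rewrite -h imset_f.
      - by have := zD i; rewrite h imset_f.
      - by rewrite (zinj _ _ h).
    suff -> : hits (P (restr u x)) (restr z x) = hits A z by [].
    apply: eq_card => j; rewrite !inE.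
    rewrite (_ : blk (restr z x) j = restr (blk z j) x) //.
    by apply/ffunP => i; rewrite !ffunE.
  apply: le_trans h4.
  have : #|low|%:R <= #|low :\: meets|%:R + #|meets|%:R :> R.
    rewrite -natrD ler_nat -(cardsID meets low) addnC leq_add2l.
    by apply: subset_leq_card; apply: subsetIr.
  by move: h1 h3; rewrite -/k => h1 h3 h5; lra.
have upper p : #|[set x | rl x p]|%:R <= q ^+ L * #|V|%:R ^+ s.
  case: p => u z; rewrite /rl /=.
  have [einj|_] := boolP (injectiveb [ffun j => e u z j]); last first.
    apply: (@le_trans _ _ #|@set0 {ffun 'I_s -> V}|%:R).
      by rewrite ler_nat; apply: subset_leq_card; apply/subsetP => x; rewrite inE.
    by rewrite cards0 mulr_ge0 // exprn_ge0.
  have {}einj : injective (e u z).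
    by move=> i j h; apply: (injectiveP _ einj); rewrite !ffunE.
  have := @card_valid_low V L r d valid P (c + 3 * g / 4) (q ^+ L * #|V|%:R ^+ (L * r)).
  have B0 : 0 <= q ^+ L * #|V|%:R ^+ (L * r) by rewrite mulr_ge0 ?exprn_ge0.
  have hB1 y : valid y -> #|[set w : {ffun 'I_L -> {ffun 'I_r -> V}} |
      #|[set j | w j \in P y]|%:R <= (c + 3 * g / 4) * L%:R]|%:R
        <= q ^+ L * #|V|%:R ^+ (L * r).
    move=> vy; have := hq L _ (P y); rewrite card_ffun card_ord natrX -exprM mulnC.
    by apply; apply: hP.
  move=> /(_ hB1 B0).
  set B := [set y : {ffun 'I_d + 'I_L * 'I_r -> V} | _] => hB.
  have := @card_restr _ _ V _ B einj.
  rewrite card_sum card_prod !card_ord -(ler_nat R) natrM natrX => h.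
  apply: (@le_trans _ _ #|[set x | restr (e u z) x \in B]|%:R).
    rewrite ler_nat; apply: subset_leq_card; apply/subsetP => x; rewrite !inE.
    move=> /and3P[_ h1 h2]; apply/andP; split.
      by rewrite (_ : restr inl _ = restr u x) //; apply/ffunP => i; rewrite !ffunE.
    rewrite (_ : restr inl _ = restr u x); last by apply/ffunP => i; rewrite !ffunE.
    by rewrite (_ : restr inr _ = restr z x) //; apply/ffunP => i; rewrite !ffunE.
  apply: (le_trans h); apply: (le_trans (ler_wpM2r _ hB)); first by rewrite exprn_ge0.
  have ds : (d + L * r <= s)%N.
    by have := leq_card _ einj; rewrite card_sum card_prod !card_ord.
  rewrite -[s in leRHS](subnKC ds) !exprD.
  by rewrite le_eqVlt; apply/orP; left; apply/eqP; ring.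
have := double_count lower upper.
rewrite card_prod !card_ffun card_prod !card_ord natrM !natrX => h.
have sLr : 0 < s%:R ^+ (L * r) :> R by rewrite exprn_gt0.
have {}h : #|bad|%:R * (k / 2) <= (s%:R ^+ d * q ^+ L) * #|V|%:R ^+ s.
  rewrite -(ler_pM2r sLr); apply: le_trans (le_trans h _); rewrite ?mulrA //.
  by rewrite le_eqVlt; apply/orP; left; apply/eqP; ring.
have k20 : 0 < k / 2 by rewrite divr_gt0.
rewrite -(ler_pM2r k20); apply: (le_trans h).
rewrite [leRHS]mulrAC ler_wpM2r ?exprn_ge0 //.
apply: le_trans (hL1 L L1L); rewrite ler_wpM2r ?exprn_ge0 // exprM.
by rewrite lerXn2r ?nnegrE ?exprn_ge0 // -natrX ler_nat ltnW.
Qed.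

End Sampling.

(** * Minimum degrees and samples of ordered k-graphs *)

Section Extensions.
Variables (k : nat) (V : finType).
Implicit Type G : kgraph k V.

Definition ext r G (D : {set V}) : {set {ffun 'I_r -> V}} :=
  [set z : {ffun 'I_r -> V} | D :|: [set z i | i in 'I_r] \in edges G].

(** By uniformity the k - d values of z must fill the rest of the edge injectively, so each edge
    through D arises from exactly (k - d)! tuples. *)
Lemma card_ext G d (D : {set V}) : (d <= k)%N -> #|D| = d ->
  #|ext (k - d) G D| = ((k - d)`! * degree G D)%N.
Proof.
move=> dk Dd; set r := (k - d)%N.
rewrite -sum1_card (partition_big (fun z : {ffun 'I_r -> V} => D :|: [set z i | i in 'I_r])
  [pred e | (e \in edges G) && (D \subset e)]) /=; last first.
  by move=> z; rewrite inE => ->; rewrite subsetUl.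
rewrite (eq_bigr (fun=> r`!)) => [|e /andP[eG De]].
  rewrite sum_nat_const mulnC; congr (_ * _)%N.
  by apply: eq_card => e; rewrite !inE.
have ek : #|e :\: D| = r by rewrite cardsD (setIidPr De) (edges_uniform eG) Dd.
rewrite -[RHS]ffactnn -[X in _ = (X ^_ _)%N]ek -[X in _ = (_ ^_ X)%N]card_ord.
rewrite -card_inj_ffuns_on sum1_card; apply: eq_card => z; rewrite !inE.
apply/andP/andP => [[_ /eqP ze]|[/ffun_onP zon /injectiveP zinj]].
  have sub : e :\: D \subset [set z i | i in 'I_r].
    by rewrite subDset ze.
  have imz : e :\: D = [set z i | i in 'I_r].
    apply/eqP; rewrite eqEcard sub ek.
    by rewrite (leq_trans (leq_imset_card _ _)) // card_ord.
  split; first by apply/ffun_onP => i; rewrite imz imset_f.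
  apply/injectiveP => i j; apply: (imset_injP _ : {in 'I_r &, injective z}) => //.
  by rewrite -imz ek card_ord.
have imz : [set z i | i in 'I_r] = e :\: D.
  apply/eqP; rewrite eqEcard ek card_imset // card_ord leqnn andbT.
  by apply/subsetP => v /imsetP[i _ ->]; apply: zon.
have De' : D :|: [set z i | i in 'I_r] = e.
  by rewrite imz setDE setUIr setUCr setIT; apply/setUidPr.
by rewrite inE De'.
Qed.

End Extensions.

Lemma ffact_le_exp n r : (n ^_ r <= n ^ r)%N.
Proof.
elim: r => // r IH; rewrite ffactnSr expnSr leq_mul //; exact: leq_subr.
Qed.

Lemma exp_le_ffact n r : ((n - r) ^ r <= n ^_ r)%N.
Proof.
suff h j : (j <= r)%N -> ((n - r) ^ j <= n ^_ j)%N by apply: h.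
elim: j => // j IH jr; rewrite ffactnSr expnSr leq_mul ?IH //; first exact: ltnW.
by apply: leq_sub2l; apply: ltnW.
Qed.

Section Density.
Variables (R : realType) (k : nat).

Definition dense (V : finType) (G : kgraph k V) d (c : R) :=
  forall D : {set V}, #|D| = d -> c * 'C(#|V| - d, k - d)%:R <= (degree G D)%:R.

(** The version of [dense] that sampling preserves: ordered extensions, normalised by a power of the
    order. Returning to [dense] costs nothing; coming from it costs an arbitrarily small density. *)
Definition tdense (V : finType) (G : kgraph k V) d (c : R) :=
  forall D : {set V}, #|D| = d -> c * #|V|%:R ^+ (k - d) <= #|ext (k - d) G D|%:R.

Lemma tdense_dense (V : finType) (G : kgraph k V) d (c : R) : (d <= k)%N -> 0 <= c ->
  tdense G d c -> dense G d c.
Proof.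
move=> dk c0 h D Dd; have := h D Dd; rewrite (card_ext G dk Dd) natrM => {}h.
have f0 : 0 < (k - d)`!%:R :> R by rewrite ltr0n fact_gt0.
rewrite -(ler_pM2l f0); apply: le_trans h.
rewrite mulrCA ler_wpM2l // -natrM mulnC bin_ffact -natrX ler_nat.
rewrite (leq_trans (ffact_le_exp _ _)) //.
by case: (k - d)%N => // r; rewrite leq_exp2r ?leq_subr.
Qed.

Lemma dense_tdense d (c g : R) : (d <= k)%N -> 0 <= c -> 0 < g ->
  exists n0, forall (V : finType) (G : kgraph k V), (n0 <= #|V|)%N ->
    dense G d (c + g) -> tdense G d (c + g / 2).
Proof.
move=> dk c0 g0; set r := (k - d)%N.
have [N hN] := natr_unbounded ((c + g) * (r%:R * k%:R) / (g / 2)).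
exists (maxn k N.+1) => V G; rewrite geq_max => /andP[kn Nn] h D Dd.
rewrite (card_ext G dk Dd) natrM -/r.
have cg0 : 0 <= c + g by rewrite addr_ge0 // ltW.
have f0 : 0 < r`!%:R :> R by rewrite ltr0n fact_gt0.
apply: le_trans (ler_wpM2l (ltW f0) (h D Dd)).
rewrite mulrCA -natrM mulnC -/r bin_ffact.
apply: (@le_trans _ _ ((c + g) * (#|V| - k)%:R ^+ r)); last first.
  rewrite ler_wpM2l // -natrX ler_nat (leq_trans _ (exp_le_ffact _ _)) //.
  by rewrite (_ : #|V| - d - r = #|V| - k)%N // /r; lia.
have n0 : (0 : R) < #|V|%:R by rewrite ltr0n (leq_trans _ Nn).
have -> : (#|V| - k)%:R = #|V|%:R * (1 - k%:R / #|V|%:R) :> R.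
  by rewrite natrB // mulrBr mulr1 mulrCA divff ?mulr1 // gt_eqF.
rewrite exprMn mulrCA [leLHS]mulrC ler_wpM2l ?exprn_ge0 //.
apply: (@le_trans _ _ ((c + g) * (1 - r%:R * (k%:R / #|V|%:R)))).
  suff : (c + g) * (r%:R * (k%:R / #|V|%:R)) <= g / 2 by lra.
  rewrite !mulrA ler_pdivrMr // -ler_pdivrMl ?divr_gt0 // mulrC -!mulrA.
  by move: hN; rewrite -!mulrA => /le_trans -> //; rewrite ler_nat ltnW.
rewrite ler_wpM2l // bernoulli_sub // divr_ge0 //= ler_pdivrMr // mul1r ler_nat //.
Qed.

End Density.

(** * Types of samples, and the three properties expressed through types *)

Section Types.
Variables (k m : nat) (F : kgraph k 'I_m).

(* The type of a sample x : I -> V records which index maps 'I_m -> I compose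
   with x to an order-preserving homomorphism. *)
Definition tau (disp : Order.disp_t) (V : finOrderType disp) (G : kgraph k V)
    (I : finType) (x : I -> V) : {set {ffun 'I_m -> I}} :=
  [set psi : {ffun 'I_m -> I} | ord_hom F G [ffun i => x (psi i)]].

Definition hmult (I : finType) (v : I) (psi : {ffun 'I_m -> I}) : nat :=
  #|[set i | psi i == v]|.

Definition tmap (W I : finType) (g : W -> I) (e : m.-tuple W) : {ffun 'I_m -> I} :=
  [ffun i => g (tnth e i)].

Lemma hmult_tmap (W I : finType) (g : W -> I) w e : injective g ->
  hmult (g w) (tmap g e) = mult w e.
Proof.
by move=> ginj; apply: eq_card => i; rewrite !inE ffunE (inj_eq ginj).
Qed.

Lemma hmult_tmap0 (W I : finType) (g : W -> I) v e : (forall w, g w != v) ->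
  hmult v (tmap g e) = 0%N.
Proof.
by move=> h; apply: eq_card0 => i; rewrite !inE ffunE (negPf (h _)).
Qed.

Lemma sum_hmult (I : finType) (psi : {ffun 'I_m -> I}) :
  (\sum_v hmult v psi = m)%N.
Proof.
rewrite -[RHS]card_ord -sum1_card (partition_big psi predT) //=.
by apply: eq_bigr => v _; rewrite /hmult -sum1_card; apply: eq_bigl => i; rewrite inE.
Qed.

(** The subgraph induced on x(S) is rebuilt on ordinals through the increasing enumeration of x(S),
    so it inherits the order of V, and [g] leads back to indices. The index type I is arbitrary
    because three occur: ['I_s], [option 'I_s] for a sample with one added vertex, and V itself for
    deletions. *)
Lemma induced_sample (R : realType) (disp : Order.disp_t) (V : finOrderType disp)
    (G : kgraph k V) (I : finType) (x : I -> V) (S : {set I}) d (c : R) :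
  injective x ->
  (forall D : {set I}, D \subset S -> #|D| = d ->
    c * #|S|%:R ^+ (k - d) <= #|[set z : {ffun 'I_(k - d) -> I} |
      [forall i, z i \in S] && (restr z [ffun i => x i] \in ext (k - d) G (x @: D))]|%:R) ->
  exists disp' (W : finOrderType disp') (GW : kgraph k W) (g : W -> I),
    [/\ injective g, #|W| = #|S|, g @: setT = S, tdense GW d c &
        forall e, e \in HOrd F GW -> tmap g e \in tau G x].
Proof.
move=> xinj hS; pose T := x @: S.
pose io : 'I_#|T| -> V := @Order.enum_val _ V (mem T).
have ioinj : injective io by apply: Order.enum_val_inj.
have [g hg] : exists g : 'I_#|T| -> I, forall w, g w \in S /\ x (g w) = io w.
  apply: (@fin_all_exists _ (fun=> I) (fun w i => i \in S /\ x i = io w)) => w.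
  by have /imsetP[i iS h] := Order.enum_valP w; exists i.
have ginj : injective g.
  by move=> w w' h; apply: ioinj; rewrite -!(hg _).2 h.
have gS : g @: setT = S.
  apply/eqP; rewrite eqEcard; apply/andP; split.
    by apply/subsetP => i /imsetP[w _ ->]; case: (hg w).
  by rewrite (card_imset _ ginj) cardsT card_ord (card_imset _ xinj).
have unif (e : {set 'I_#|T|}) : e \in [set e : {set 'I_#|T|} | io @: e \in edges G] -> #|e| = k.
  by rewrite inE => /edges_uniform; rewrite card_imset.
pose GW := KGraph unif.
exists _, 'I_#|T|, GW, g; split => //; first by rewrite card_ord card_imset.
  move=> D Dd.
  have -> : #|{: 'I_#|T| }| = #|S| by rewrite card_ord (card_imset _ xinj).
  apply: le_trans (hS (g @: D) _ _) _; last 1 first.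
  - rewrite ler_nat.
    rewrite -(card_imset (f := fun z : {ffun 'I_(k - d) -> 'I_#|T|} => [ffun i => g (z i)])).
      apply: subset_leq_card; apply/subsetP => z; rewrite !inE => /andP[/forallP zS zE].
      have [z' hz'] : exists z' : 'I_(k - d) -> 'I_#|T|, forall i, z i = g (z' i).
        apply: (@fin_all_exists _ (fun=> 'I_#|T|) (fun i w => z i = g w)) => i.
        by have := zS i; rewrite -gS => /imsetP[w _ ->]; exists w.
      apply/imsetP; exists [ffun i => z' i]; last by apply/ffunP => i; rewrite !ffunE.
      have e1 : io @: D = x @: (g @: D).
        by rewrite -imset_comp; apply: eq_imset => w /=; rewrite (hg _).2.
      have e2 : io @: [set [ffun i => z' i] i | i in 'I_(k - d)] =
          [set restr z [ffun i => x i] i | i in 'I_(k - d)].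
        rewrite -imset_comp; apply: eq_imset => i /=.
        by rewrite !ffunE hz' (hg _).2.
      by rewrite !inE imsetU e1 e2.
    move=> z z' /ffunP h; apply/ffunP => i; apply: ginj.
    by have := h i; rewrite !ffunE.
  - by apply/subsetP => i /imsetP[w _ ->]; case: (hg w).
  - by rewrite card_imset.
move=> e /imsetP[phi]; rewrite !inE => /andP[/forall_inP h1 /'forall_forallP h2] ->.
have E i : [ffun i => x (tmap g [tuple phi i | i < m] i)] i = io (phi i).
  by rewrite !ffunE tnth_mktuple (hg _).2.
apply/andP; split.
  apply/forall_inP => f fF; have := h1 f fF; rewrite inE.
  rewrite (_ : io @: _ = [set [ffun i => x (tmap g [tuple phi i | i < m] i)] i | i in f]) //.
  by rewrite -imset_comp; apply: eq_imset => i /=; rewrite E.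
apply/'forall_forallP => u v; apply/implyP => uv; rewrite !E.
rewrite Order.le_enum_val; last exact: le_total.
by have /implyP := h2 u v; apply.
Qed.

Definition spaT (R : realType) (rho : R) (I : finType) (H : {set {ffun 'I_m -> I}}) :=
  exists w : {ffun 'I_m -> I} -> R,
    [/\ forall psi, psi \in H -> 0 <= w psi,
        forall v, \sum_(psi in H) w psi * (hmult v psi)%:R <= 1 &
        (1 - rho) * #|I|%:R / m%:R <= \sum_(psi in H) w psi].

Definition latT (I : finType) (H : {set {ffun 'I_m -> I}}) (t : I -> int) :=
  exists w : {ffun 'I_m -> I} -> int,
    forall v, \sum_(psi in H) w psi * (hmult v psi)%:Z = t v.

Definition covT (I : finType) (v : I) (H : {set {ffun 'I_m -> I}}) :=
  exists2 psi, psi \in H & hmult v psi = 1%N.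

Lemma push_forward (K : pzRingType) (W I : finType) (g : W -> I)
    (E : {set m.-tuple W}) (H : {set {ffun 'I_m -> I}}) (w : m.-tuple W -> K)
    (c : {ffun 'I_m -> I} -> K) :
  (forall e, e \in E -> tmap g e \in H) ->
  \sum_(psi in H) (\sum_(e in E | tmap g e == psi) w e) * c psi =
  \sum_(e in E) w e * c (tmap g e).
Proof.
move=> h; rewrite [RHS](partition_big (tmap g) (mem H)) //=.
by apply: eq_bigr => psi _; rewrite big_distrl /=; apply: eq_bigr => e /andP[_ /eqP ->].
Qed.

Lemma Spa_spaT (R : realType) (rho : R) (W I : finType) (g : W -> I)
    (E : {set m.-tuple W}) (H : {set {ffun 'I_m -> I}}) :
  injective g -> #|W| = #|I| -> (forall e, e \in E -> tmap g e \in H) ->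
  Spa rho E -> spaT rho H.
Proof.
move=> ginj WI EH [w [[w01 w1] wS]].
exists (fun psi => \sum_(e in E | tmap g e == psi) w e); split.
- by move=> psi _; apply: sumr_ge0 => e /andP[/w01/andP[]].
- move=> v; rewrite (push_forward w (fun psi => (hmult v psi)%:R) EH).
  have [/existsP[u /eqP <-]|nv] := boolP [exists u, g u == v].
    by under eq_bigr do rewrite hmult_tmap //.
  rewrite big1 // => e _; rewrite hmult_tmap0 ?mulr0 // => u.
  by apply: contra nv => h; apply/existsP; exists u.
- rewrite -WI; apply: le_trans wS _.
  have := push_forward w (fun=> 1) EH; under eq_bigr do rewrite mulr1.
  by under [RHS]eq_bigr do rewrite mulr1; move=> ->.
Qed.

Lemma Div_latT (W I : finType) (g : W -> I)
    (E : {set m.-tuple W}) (H : {set {ffun 'I_m -> I}}) :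
  injective g -> (forall e, e \in E -> tmap g e \in H) ->
  Div E -> latT H (fun v => (v \in g @: setT)%:Z).
Proof.
move=> ginj EH [w hw].
exists (fun psi => \sum_(e in E | tmap g e == psi) w e) => v.
rewrite (push_forward w (fun psi => (hmult v psi)%:Z) EH).
have [/imsetP[u _ ->]|nv] := boolP (v \in g @: setT).
  by under eq_bigr do rewrite hmult_tmap //.
rewrite big1 // => e _; rewrite hmult_tmap0 ?mulr0 // => u.
by apply: contra nv => /eqP <-; rewrite imset_f.
Qed.

Lemma Cov_covT (W I : finType) (g : W -> I)
    (E : {set m.-tuple W}) (H : {set {ffun 'I_m -> I}}) (v : I) :
  injective g -> (forall e, e \in E -> tmap g e \in H) -> v \in g @: setT ->
  Cov E -> covT v H.
Proof.
move=> ginj EH /imsetP[w _ ->] /(_ w)[e eE he].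
by exists (tmap g e); [apply: EH | rewrite hmult_tmap].
Qed.

Section Lattice.
Variables (I : finType) (H : {set {ffun 'I_m -> I}}).

Lemma latT_ext (t t' : I -> int) : t =1 t' -> latT H t -> latT H t'.
Proof. by move=> tt [w h]; exists w => v; rewrite h. Qed.

Lemma latT_lin (a b : int) t t' : latT H t -> latT H t' ->
  latT H (fun v => a * t v + b * t' v).
Proof.
move=> [w h] [w' h']; exists (fun psi => a * w psi + b * w' psi) => v.
rewrite -h -h' !mulr_sumr -big_split /=; apply: eq_bigr => psi _.
by rewrite mulrDl !mulrA.
Qed.

Lemma latT_sum (J : finType) (a : J -> int) (t : J -> I -> int) :
  (forall j, latT H (t j)) -> latT H (fun v => \sum_j a j * t j v).
Proof.
move=> h; suff [w hw] : exists w : {ffun 'I_m -> I} -> int, forall v,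
    \sum_(psi in H) w psi * (hmult v psi)%:Z = \sum_j a j * t j v by exists w.
elim: (index_enum J) => [|j l [w hw]].
  by exists (fun=> 0) => v; rewrite big_nil big1 // => psi _; rewrite mul0r.
have [w' hw'] := h j.
exists (fun psi => a j * w' psi + w psi) => v; rewrite big_cons -hw -hw' mulr_sumr.
by rewrite -big_split /=; apply: eq_bigr => psi _; rewrite mulrDl mulrA.
Qed.

(* Omitting one vertex at a time gives all differences of unit vectors. *)
Lemma latT_full : (1 < #|I|)%N ->
  (forall v0, latT H (fun v => (v != v0)%:Z)) ->
  forall t : I -> int, (m%:Z %| \sum_v t v)%Z -> latT H t.
Proof.
move=> I1 h t /dvdzP[q hq].
have [v0 [v1 v01]] : exists v0 v1 : I, v0 != v1.
  case/card_gt1P: I1 => v0 [v1 [_ _ v01]]; by exists v0, v1.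
have diff v : latT H (fun u => (u == v)%:Z - (u == v0)%:Z).
  apply: latT_ext (latT_lin 1 (-1) (h v0) (h v)) => u.
  by case: (u == v); case: (u == v0).
have [psi psiH] : exists psi, psi \in H.
  apply/set0Pn/negP => /eqP H0; have [w /(_ v1)] := h v0.
  by rewrite H0 big_set0 eq_sym v01.
(* The multiplicities of a single homomorphism sum to m; moving all of them to [v0] along the
   differences yields m times a unit vector. *)
have mv0 : latT H (fun u => m%:Z * (u == v0)%:Z).
  have : latT H (fun u => (hmult u psi)%:Z).
    exists (fun p => (p == psi)%:Z) => v.
    rewrite (bigD1 psi) //= eqxx mul1r big1 ?addr0 // => p /andP[_ /negPf ->].
    by rewrite mul0r.
  have := latT_sum (fun v => (hmult v psi)%:Z) diff => h1 h2.
  apply: latT_ext (latT_lin 1 (-1) h2 h1) => u.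
  under eq_bigr do rewrite mulrBr.
  have sm : \sum_v (hmult v psi)%:Z = m%:Z.
    by rewrite -[in RHS](sum_hmult psi) (big_morph Posz PoszD (erefl _)).
  rewrite sumrB -mulr_suml sm.
  rewrite (bigD1 u) //= eqxx mulr1 big1 ?addr0; first by lia.
  by move=> v /negPf vu; rewrite eq_sym vu mulr0.
have h1 := latT_sum t diff.
apply: latT_ext (latT_lin 1 q h1 mv0) => u.
under eq_bigr do rewrite mulrBr.
rewrite sumrB -mulr_suml hq (bigD1 u) //= eqxx mulr1 big1 ?addr0; first by lia.
by move=> v /negPf vu; rewrite eq_sym vu mulr0.
Qed.

End Lattice.

End Types.

(** * Almost all samples have good types *)

Section Samples.
Variables (R : realType) (k m d : nat) (F : kgraph k 'I_m).

Definition SpaAt (c : R) := forall rho : R, 0 < rho -> exists n0 : nat,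
  forall disp (V : finOrderType disp) (G : kgraph k V), (n0 <= #|V|)%N ->
    dense G d c -> Spa rho (HOrd F G).

Definition DivAt (c : R) := exists n0 : nat,
  forall disp (V : finOrderType disp) (G : kgraph k V), (n0 <= #|V|)%N -> (m %| #|V|)%N ->
    dense G d c -> Div (HOrd F G).

Definition CovAt (c : R) := exists n0 : nat,
  forall disp (V : finOrderType disp) (G : kgraph k V), (n0 <= #|V|)%N ->
    dense G d c -> Cov (HOrd F G).

Lemma enum_ffun (I : finType) (D : {set I}) e : #|D| = e ->
  exists2 u : {ffun 'I_e -> I}, injective u & [set u i | i in 'I_e] = D.
Proof.
move=> De; pose u := [ffun i : 'I_e => enum_val (cast_ord (esym De) i)].
have uinj : injective u.
  by move=> i j; rewrite !ffunE => /enum_val_inj/cast_ord_inj.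
exists u => //; apply/eqP; rewrite eqEcard (card_imset _ uinj) card_ord De leqnn andbT.
by apply/subsetP => i /imsetP[j _ ->]; rewrite ffunE enum_valP.
Qed.

Lemma not_bad (V : finType) s e r (valid : pred {ffun 'I_e -> V})
    (P : {set V} -> {set {ffun 'I_r -> V}}) (a : R) (x : {ffun 'I_s -> V}) (D : {set 'I_s}) :
  x \notin sample_bad s valid (fun y => P [set y i | i in 'I_e]) a -> #|D| = e ->
  (forall u : {ffun 'I_e -> 'I_s}, injective u -> [set u i | i in 'I_e] = D ->
    valid (restr u x)) ->
  a * s%:R ^+ r <= #|[set z : {ffun 'I_r -> 'I_s} | restr z x \in P (x @: D)]|%:R.
Proof.
rewrite inE => /existsPn h De hv; have [u uinj uD] := enum_ffun De.
have := h u; rewrite (hv u uinj uD) (introT (injectiveP u) uinj) /= -leNgt.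
suff -> : [set restr u x i | i in 'I_e] = x @: D by [].
by rewrite -uD -imset_comp; apply: eq_imset => i; rewrite !ffunE.
Qed.

Lemma card_avoid (I : finType) r (A : {set {ffun 'I_r -> I}}) (v : I) :
  (#|A| <= #|[set z in A | [forall i, z i != v]]| + r * #|I| ^ r.-1)%N.
Proof.
rewrite -(cardsID [set z : {ffun 'I_r -> I} | [forall i, z i != v]] A).
have -> : A :&: [set z : {ffun 'I_r -> I} | [forall i, z i != v]] =
    [set z in A | [forall i, z i != v]] by apply/setP => z; rewrite !inE.
rewrite leq_add2l.
have := @card_ffun_exists 'I_r I (fun=> [set v]) 1 (fun=> eq_leq (cards1 v)).
rewrite card_ord mul1n; apply: leq_trans; apply: subset_leq_card.
apply/subsetP => z; rewrite !inE => /andP[/forallPn[i zi] _].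
by apply/existsP; exists i; rewrite inE; rewrite negbK in zi.
Qed.

Lemma card_noninj_small (V : finType) s (f : R) :
  (0 < s)%N -> (s ^ 2)%:R <= f * #|V|%:R ->
  #|[set x : {ffun 'I_s -> V} | ~~ injectiveb x]|%:R <= f * #|V|%:R ^+ s.
Proof.
move=> s0 h; apply: (@le_trans _ _ ((s ^ 2)%:R * #|V|%:R ^+ s.-1)).
  by have := @card_noninj 'I_s V; rewrite card_ord -natrX -natrM ler_nat.
by rewrite -[in leRHS](prednK s0) exprS mulrA ler_wpM2r // exprn_ge0.
Qed.

Definition base_bad (V : finType) (G : kgraph k V) s (a : R) : {set {ffun 'I_s -> V}} :=
  [set x : {ffun 'I_s -> V} | ~~ injectiveb x] :|:
  sample_bad s (fun y : {ffun 'I_d -> V} => injectiveb y)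
    (fun y => ext (k - d) G [set y i | i in 'I_d]) a.

Lemma base_good (V : finType) (G : kgraph k V) s (a : R) (x : {ffun 'I_s -> V}) :
  x \notin base_bad G s a -> injective x /\
  forall D : {set 'I_s}, #|D| = d -> a * s%:R ^+ (k - d) <=
    #|[set z : {ffun 'I_(k - d) -> 'I_s} | restr z x \in ext (k - d) G (x @: D)]|%:R.
Proof.
rewrite inE negb_or inE negbK => /andP[/injectiveP xinj xb]; split=> // D Dd.
apply: (not_bad (P := ext (k - d) G) xb Dd) => u uinj _.
by apply/injectiveP => i j; rewrite !ffunE => /xinj/uinj.
Qed.

Hypothesis hd : (1 <= d <= k - 1)%N.
Variables (c g : R).
Hypotheses (c0 : 0 <= c) (g0 : 0 < g).

Let dk : (d <= k)%N. Proof. by case/andP: hd; lia. Qed.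

Lemma base_sampling (f : R) : 0 < f -> exists s0, forall s, (s0 <= s)%N -> exists n0,
  forall (V : finType) (G : kgraph k V), (n0 <= #|V|)%N -> tdense G d (c + g) ->
    #|base_bad G s (c + g / 2)|%:R <= f * #|V|%:R ^+ s.
Proof.
move=> f0; have f20 : 0 < f / 2 by rewrite divr_gt0.
have [s0 hs0] := @sampling R c g (f / 2) d (k - d) c0 g0 f20.
exists (maxn 1 s0) => s; rewrite geq_max => /andP[s1 /hs0 {}hs0].
have [n0 hn0] := natr_unbounded ((s ^ 2)%:R / (f / 2)).
exists n0 => V G nV tG.
apply: (@le_trans _ _ (f / 2 * #|V|%:R ^+ s + f / 2 * #|V|%:R ^+ s)); last first.
  by rewrite -mulrDl -splitr.
apply: (@le_trans _ _ (#|[set x : {ffun 'I_s -> V} | ~~ injectiveb x]|%:R +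
  #|sample_bad s (fun y : {ffun 'I_d -> V} => injectiveb y)
    (fun y => ext (k - d) G [set y i | i in 'I_d]) (c + g / 2)|%:R)).
  by rewrite -natrD ler_nat; apply: (leq_card_setU _ _).1.
apply: lerD.
  apply: card_noninj_small => //.
  by rewrite mulrC -ler_pdivrMr // (le_trans hn0) // ler_nat.
apply: hs0 => y /injectiveP yinj; apply: tG.
by rewrite card_imset // card_ord.
Qed.

Lemma sample_spa (rho f : R) : SpaAt c -> 0 < rho -> 0 < f ->
  exists s n0, (0 < s)%N /\ forall disp (V : finOrderType disp) (G : kgraph k V),
    (n0 <= #|V|)%N -> tdense G d (c + g) ->
    exists2 Good : {set {ffun 'I_s -> V}},
      (forall x, x \in Good -> injective x /\ spaT rho (tau F G x)) &
      #|~: Good|%:R <= f * #|V|%:R ^+ s.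
Proof.
move=> Hspa rho0 f0; have [s0 hs0] := base_sampling f0; have [s1 hs1] := Hspa rho rho0.
pose s := (maxn 1 (maxn s0 s1)).
have [n0 hn0] := hs0 s (leq_trans (leq_maxl _ _) (leq_maxr _ _)).
have s1s : (s1 <= s)%N by rewrite !leq_max leqnn !orbT.
exists s, n0; split=> [|disp V G nV tG]; first by rewrite leq_maxl.
exists (~: base_bad G s (c + g / 2)); last by rewrite setCK; apply: hn0.
move=> x; rewrite inE => /base_good[xinj hx]; split=> //.
have [D _ Dd|disp' [W [GW [g' [ginj cW gS /(tdense_dense dk c0) GWd hE]]]]] :=
    @induced_sample _ _ F R disp V G 'I_s x setT d c xinj.
  rewrite cardsT card_ord; apply: (le_trans (le_trans _ (hx D Dd))).
    by rewrite ler_wpM2r ?exprn_ge0 // lerDl ltW // divr_gt0.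
  rewrite ler_nat; apply: subset_leq_card; apply/subsetP => z; rewrite !inE => h.
  apply/andP; split; first by apply/forallP.
  by rewrite (_ : [ffun i => x i] = x) //; apply/ffunP => i; rewrite ffunE.
apply: (Spa_spaT ginj _ hE); first by rewrite cW cardsT.
by apply: hs1 => //; rewrite cW cardsT card_ord.
Qed.

(** For Cov the sample is enlarged by [Q j], which is prescribed rather than random. The d-sets
    through [Q j] therefore need a sampling of their own, over the (d - 1)-sets that complete them;
    its failures form [qbad], and [hit] collects the samples that already contain the vertex. *)
Lemma sample_abs : (0 < m)%N -> DivAt c -> CovAt c ->
  exists s n0, (0 < s)%N /\ forall disp (V : finOrderType disp) (G : kgraph k V),
    (n0 <= #|V|)%N -> tdense G d (c + g) -> forall Q : 'I_m -> V,
    exists2 Good : {set {ffun 'I_s -> V}},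
      (forall x, x \in Good -> [/\ injective x,
         (forall t : 'I_s -> int, (m%:Z %| \sum_v t v)%Z -> latT (tau F G x) t) &
         forall j, (forall i, x i != Q j) /\
           covT None (tau F G (fun o => oapp x (Q j) o))]) &
      1 / 2 * #|V|%:R ^+ s <= #|Good|%:R :> R.
Proof.
move=> m0 [nd hDiv] [nc hCov].
set r := (k - d)%N; have r0 : (0 < r)%N by rewrite /r subn_gt0; case/andP: hd; lia.
(* Error budget: 1/8 for [base_bad] and twice 1/(8m) for each of the m vertices of Q, in total
   3/8. *)
have f8 : 0 < 1 / 8 :> R by rewrite divr_gt0.
have f8m : 0 < 1 / (8 * m%:R) :> R by rewrite divr_gt0 // mulr_gt0 // ltr0n.
have [s0 hs0] := base_sampling f8.
have [s1 hs1] := @sampling R c g _ d.-1 r c0 g0 f8m.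
have g20 : 0 < g / 2 by rewrite divr_gt0.
have [s2 hs2] := natr_unbounded ((c + g / 2) * r%:R / (g / 2)).
have [s3 hs3] := natr_unbounded (r%:R / (g / 2)).
pose b := (s0 + s1 + s2 + s3 + nd + nc + 1)%N.
have [[b0 b1 b2] [b3 bd bc]] : [/\ s0 <= b, s1 <= b & s2 <= b]%N /\
    [/\ s3 <= b, nd <= b & nc <= b]%N by rewrite /b; split; split; lia.
(* With s = 1 mod m, removing any one index leaves a sample to which Div applies. *)
pose s := (m * b).+1; have bs : (b <= s)%N by rewrite /s leqW // leq_pmull.
have [n0 hn0] := hs0 s (leq_trans b0 bs).
have {}hs1 := hs1 s (leq_trans b1 bs).
have {}hs2 : (c + g / 2) * r%:R <= g / 2 * s%:R.
  rewrite mulrC [leRHS]mulrC -ler_pdivrMr // mulrC (le_trans hs2) // ler_nat.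
  exact: leq_trans b2 bs.
have {}hs3 : r%:R <= g / 2 * s%:R.
  rewrite [leRHS]mulrC -ler_pdivrMr // (le_trans hs3) // ler_nat.
  exact: leq_trans b3 bs.
have c20 : 0 <= c + g / 2 by rewrite addr_ge0 // ltW.
exists s, (maxn n0 (8 * (m * s)))%N; split=> // disp V G; rewrite geq_max => /andP[nV nV2] tG Q.
pose Pq q (y : {set V}) := ext r G (q |: y).
pose qbad q := sample_bad s
  (fun y : {ffun 'I_d.-1 -> V} => injectiveb y && [forall i, y i != q])
  (fun y => Pq q [set y i | i in 'I_d.-1]) (c + g / 2).
pose hit q := [set x : {ffun 'I_s -> V} | [exists i, x i == q]].
pose Bad := base_bad G s (c + g / 2) :|: \bigcup_j (qbad (Q j) :|: hit (Q j)).
have V0 : 0 <= #|V|%:R ^+ s :> R by rewrite exprn_ge0.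
have cq q : #|qbad q|%:R <= 1 / (8 * m%:R) * #|V|%:R ^+ s :> R.
  have := hs1 _ (fun y : {ffun 'I_d.-1 -> V} => injectiveb y && [forall i, y i != q])
    (fun y => Pq q [set y i | i in 'I_d.-1]).
  rewrite /qbad; apply => y /andP[/injectiveP yinj /forallP yq]; apply: tG.
  rewrite cardsU1 card_imset // card_ord.
  rewrite (_ : q \notin _) ?add1n ?prednK //; first by case/andP: hd.
  by apply/negP => /imsetP[i _ /esym/eqP]; rewrite (negPf (yq i)).
have ch q : #|hit q|%:R <= 1 / (8 * m%:R) * #|V|%:R ^+ s :> R.
  have h : (#|hit q| <= s * #|V| ^ s.-1)%N.
    have := @card_ffun_exists 'I_s V (fun=> [set q]) 1 (fun=> eq_leq (cards1 q)).
    rewrite card_ord mul1n; apply: leq_trans; apply: subset_leq_card.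
    apply/subsetP => x; rewrite !inE => /existsP[i xi].
    by apply/existsP; exists i; rewrite inE.
  apply: (@le_trans _ _ (s%:R * #|V|%:R ^+ s.-1)); first by rewrite -natrX -natrM ler_nat.
  rewrite [in leRHS](_ : s = s.-1.+1) // exprS mulrA ler_wpM2r ?exprn_ge0 //.
  rewrite mulrAC mul1r ler_pdivlMr ?mulr_gt0 ?ltr0n //.
  by rewrite -!natrM ler_nat mulnCA [(s * m)%N]mulnC.
exists (~: Bad); last first.
  have cB : #|Bad|%:R <= 1 / 2 * #|V|%:R ^+ s :> R.
    apply: (@le_trans _ _ (1 / 8 * #|V|%:R ^+ s +
        \sum_(j : 'I_m) (1 / (8 * m%:R) * #|V|%:R ^+ s + 1 / (8 * m%:R) * #|V|%:R ^+ s))).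
      apply: (@le_trans _ _ (#|base_bad G s (c + g / 2)|%:R +
         #|\bigcup_j (qbad (Q j) :|: hit (Q j))|%:R)).
        by rewrite -natrD ler_nat; apply: (leq_card_setU _ _).1.
      apply: lerD; first exact: hn0.
      elim/big_rec2: _ => [|j B n _ IH]; first by rewrite cards0.
      apply: (@le_trans _ _ (#|qbad (Q j) :|: hit (Q j)|%:R + #|n|%:R)).
        by rewrite -natrD ler_nat; apply: (leq_card_setU _ _).1.
      apply: lerD => //; apply: le_trans (lerD (cq _) (ch _)).
      by rewrite -natrD ler_nat; apply: (leq_card_setU _ _).1.
    rewrite sumr_const card_ord; move: (#|V|%:R ^+ s) V0 => v v0.
    have m0' : m%:R != 0 :> R by rewrite pnatr_eq0 -lt0n.
    have -> : (1 / (8 * m%:R) * v + 1 / (8 * m%:R) * v) *+ m = 1 / 4 * v.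
      by rewrite -mulr_natr; field.
    lra.
  have : #|Bad|%:R + #|~: Bad|%:R = #|V|%:R ^+ s :> R.
    by rewrite -natrD cardsC card_ffun card_ord natrX.
  lra.
move=> x; rewrite inE in_setU negb_or => /andP[/base_good[xinj hx] xq].
have {}xq j : (forall i, x i != Q j) /\ x \notin qbad (Q j).
  have : x \notin qbad (Q j) :|: hit (Q j).
    by apply: contra xq => h; apply/bigcupP; exists j.
  rewrite in_setU negb_or => /andP[-> ]; rewrite inE => /existsPn h; split=> // i.
have xE : [ffun i => x i] = x by apply/ffunP => i; rewrite ffunE.
split=> //.
  apply: latT_full => [|v0]; first by rewrite card_ord ltnS muln_gt0 m0 /b addn1.
  have cv : #|[set~ v0]| = s.-1 by rewrite cardsC1 card_ord.
  have [D DS Dd|disp' [W [GW [g' [ginj cW gS /(tdense_dense dk c0) GWd hE]]]]] :=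
    @induced_sample _ _ F R disp V G 'I_s x [set~ v0] d c xinj.
    have := card_avoid [set z : {ffun 'I_r -> 'I_s} | restr z x \in ext r G (x @: D)] v0.
    rewrite card_ord -(ler_nat R) natrD natrM natrX => /(le_trans (hx D Dd)) h.
    apply: (@le_trans _ _ #|[set z in [set z : {ffun 'I_r -> 'I_s} |
        restr z x \in ext r G (x @: D)] | [forall i, z i != v0]]|%:R); last first.
      rewrite ler_nat; apply: subset_leq_card; apply/subsetP => z; rewrite !inE xE.
      move=> /andP[h1 /forallP h2]; apply/andP; split=> //.
      by apply/forallP => i; rewrite !inE.
    (* Removing [v0] destroys at most r s^(r-1) extensions, which [s3] fits into the surplus g/2. *)
    suff h2 : c * s.-1%:R ^+ r + r%:R * s%:R ^+ r.-1 <= (c + g / 2) * s%:R ^+ r.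
      by rewrite cv; move: h h2; rewrite -/r; lra.
    rewrite mulrDl; apply: lerD.
      rewrite ler_wpM2l // -!natrX ler_nat; case: (r) => // r'.
      by rewrite leq_exp2r // leq_pred.
    by rewrite -[in leRHS](prednK r0) exprS mulrA ler_wpM2r ?exprn_ge0.
  have hD : Div (HOrd F GW).
    apply: hDiv => //; first by rewrite cW cv /= (leq_trans bd) // leq_pmull.
    by rewrite cW cv /= dvdn_mulr.
  have := Div_latT ginj hE hD; apply: latT_ext => v.
  by rewrite gS !inE.
move=> j; have [xj xb] := xq j; split=> //.
pose x' (o : option 'I_s) := oapp x (Q j) o.
have x'inj : injective x'.
  move=> [i|] [i'|] //=; rewrite /x' /=.
  - by move=> /xinj ->.
  - by move=> h; have := xj i; rewrite h eqxx.
  - by move=> h; have := xj i'; rewrite h eqxx.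
(* The enlarged sample has order s + 1, but extensions are counted only among its s random vertices;
   the choice of [s2] lets the surplus g/2 pay for the different normalisation. *)
have hcs : c * s.+1%:R ^+ r <= (c + g / 2) * s%:R ^+ r.
  have -> : s%:R = s.+1%:R * (1 - s.+1%:R^-1) :> R.
    by rewrite mulrBr mulr1 mulfV ?pnatr_eq0 // -natr1 addrK.
  rewrite exprMn mulrCA [leLHS]mulrC ler_wpM2l ?exprn_ge0 //.
  have h : 1 - r%:R * s.+1%:R^-1 <= (1 - s.+1%:R^-1) ^+ r :> R.
    by rewrite bernoulli_sub // invr_ge0 ler0n /= invf_le1 ?ltr0n // ler1n.
  apply: (le_trans _ (ler_wpM2l c20 h)).
  have : (c + g / 2) * (r%:R / s.+1%:R) <= g / 2.
    rewrite mulrA ler_pdivrMr ?ltr0n // (le_trans hs2) // ler_wpM2l ?(ltW g20) //.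
    by rewrite ler_nat.
  by move: (s.+1%:R^-1) (r%:R : R) => iv rr; lra.
have [D _ Dd|disp' [W [GW [g' [ginj cW gS /(tdense_dense dk c0) GWd hE]]]]] :=
    @induced_sample _ _ F R disp V G (option 'I_s) x' setT d c x'inj.
  rewrite cardsT card_option card_ord; apply: (le_trans hcs).
  pose D' := [set i | Some i \in D].
  have hD' : D :\ None = Some @: D'.
    apply/setP => -[i|]; rewrite !inE /=.
      by rewrite mem_imset ?inE //; apply: Some_inj.
    by apply/esym/negP => /imsetP[].
  have cS : #|Some @: D'| = #|D'| by rewrite card_imset //; apply: Some_inj.
  have x'D' : x' @: (Some @: D') = x @: D' by rewrite -imset_comp.
  pose y (z : {ffun 'I_r -> 'I_s}) : {ffun 'I_r -> option 'I_s} := [ffun i => Some (z i)].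
  have yinj : injective y.
    by move=> z z' /ffunP h; apply/ffunP => i; have := h i; rewrite !ffunE => -[].
  have yE z : restr (y z) [ffun i => x' i] = restr z x.
    by apply/ffunP => i; rewrite !ffunE.
  have fin : (c + g / 2) * s%:R ^+ r <=
      #|[set z : {ffun 'I_r -> 'I_s} | restr z x \in ext r G (x' @: D)]|%:R ->
    (c + g / 2) * s%:R ^+ r <= #|[set z : {ffun 'I_r -> option 'I_s} |
      [forall i, z i \in setT] && (restr z [ffun i => x' i] \in ext r G (x' @: D))]|%:R.
    move=> /le_trans -> //; rewrite ler_nat -(card_imset _ yinj).
    apply: subset_leq_card; apply/subsetP => z' /imsetP[z]; rewrite !inE => h ->.
    apply/andP; split; first by apply/forallP => i; rewrite inE.
    by rewrite yE.
  apply: fin; have [ND|ND] := boolP (None \in D).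
    have DE : D = None |: Some @: D' by rewrite -hD' setD1K.
    have D'd : #|D'| = d.-1 by rewrite -cS -hD' -Dd (cardsD1 None D) ND.
    rewrite DE imsetU1 x'D'.
    apply: (not_bad (P := Pq (Q j)) xb D'd) => u uinj _.
    apply/andP; split; last by apply/forallP => i; rewrite ffunE.
    by apply/injectiveP => i i'; rewrite !ffunE => /xinj/uinj.
  have DE : D = Some @: D'.
    by rewrite -hD'; apply/esym/setDidPl; rewrite disjoint_sym disjoints1.
  by rewrite DE x'D'; apply: hx; rewrite -cS -DE.
apply: (Cov_covT ginj hE); first by rewrite gS inE.
apply: hCov => //; rewrite cW cardsT card_option card_ord.
by rewrite ltnW // ltnS (leq_trans bc).
Qed.

End Samples.

(** * Tilings, blocks and boxes *)

Section Subsets.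
Variables (disp : Order.disp_t) (V : finOrderType disp).

Lemma subset_card (T : finType) (A : {set T}) n : (n <= #|A|)%N ->
  exists2 B : {set T}, B \subset A & #|B| = n.
Proof.
elim: n => [|n IH] hn; first by exists set0; rewrite ?sub0set ?cards0.
have [B BA Bn] := IH (ltnW hn).
have [x] : exists x, x \in A :\: B.
  by apply/set0Pn; rewrite -card_gt0 cardsD (setIidPr BA) Bn subn_gt0.
rewrite inE => /andP[xB xA]; exists (x |: B); last by rewrite cardsU1 xB Bn.
by rewrite subUset sub1set xA.
Qed.

Lemma card_bigcup_disjoint (J T : finType) (P : pred J) (Z : J -> {set T}) :
  (forall i j, P i -> P j -> i != j -> [disjoint Z i & Z j]) ->
  #|\bigcup_(j | P j) Z j| = (\sum_(j | P j) #|Z j|)%N.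
Proof.
move=> Zd; pose F j := if P j then Z j else set0.
rewrite big_mkcond [RHS]big_mkcond /= -/F -sum1_card partition_disjoint_bigcup.
  by apply: eq_bigr => j _; rewrite sum1_card /F; case: ifP => // _; rewrite cards0.
move=> i j ij; rewrite /F; case: ifP => Pi; last by rewrite disjoints_subset sub0set.
by case: ifP => Pj; [apply: Zd | rewrite disjoint_sym disjoints_subset sub0set].
Qed.

Definition rank (Y : {set V}) (y : V) := #|[set z in Y | (z < y)%O]|.

Lemma rank_lt (Y : {set V}) y z : (rank Y y < rank Y z)%N -> (y < z)%O.
Proof.
apply: contraTT; rewrite -leNgt -leqNgt => zy; apply: subset_leq_card.
by apply/subsetP => t; rewrite !inE => /andP[-> /lt_le_trans ->].
Qed.

Lemma card_ord_interval n a b : (a + b <= n)%N ->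
  #|[set j : 'I_n | (a <= j < a + b)%N]| = b.
Proof.
move=> abn; rewrite -[RHS]card_ord.
have lt (i : 'I_b) : (a + i < n)%N by apply: leq_trans abn; rewrite ltn_add2l.
rewrite -(card_imset (f := fun i : 'I_b => Ordinal (lt i)) 'I_b); last first.
  by move=> i j /(congr1 val) /= /addnI/val_inj.
apply: eq_card => j; rewrite inE; apply/andP/imsetP => [[aj jb]|[i _ ->]] /=.
  have ib : (j - a < b)%N by rewrite ltn_subLR.
  by exists (Ordinal ib) => //; apply: val_inj; rewrite /= subnKC.
by rewrite leq_addr ltn_add2l.
Qed.

Lemma card_rank (Y : {set V}) a b : (a + b <= #|Y|)%N ->
  #|[set y in Y | (a <= rank Y y < a + b)%N]| = b.
Proof.
move=> abY; pose f : 'I_#|Y| -> V := @Order.enum_val _ V (mem Y).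
have finj : injective f by apply: Order.enum_val_inj.
have fmono : {mono f : i j / (i < j)%O}.
  by apply: leW_mono; apply: Order.le_enum_val; apply: le_total.
have rk (j : 'I_#|Y|) : rank Y (f j) = j.
  have jY : (0 + j <= #|Y|)%N by rewrite add0n ltnW.
  rewrite -[RHS](card_ord_interval jY) -(card_imset _ finj); apply: eq_card => y.
  rewrite inE; apply/andP/imsetP => [[yY yj]|[i]].
    exists (Order.enum_rank_in yY y); last by rewrite /f Order.enum_rankK_in.
    have yj' : (Order.enum_rank_in yY y < j)%O.
      by rewrite -fmono /f Order.enum_rankK_in.
    by rewrite inE /= add0n; apply: yj'.
  rewrite inE /= add0n => ij ->; split; first exact: Order.enum_valP.
  by rewrite fmono; apply: ij.
rewrite -[RHS](card_ord_interval abY) -[RHS](card_imset _ finj).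
apply: eq_card => y; rewrite inE; apply/andP/imsetP => [[yY]|[i]].
  exists (Order.enum_rank_in yY y); last by rewrite /f Order.enum_rankK_in.
  by rewrite inE -rk /f Order.enum_rankK_in.
by rewrite inE -rk => h ->; split => //; apply: Order.enum_valP.
Qed.

End Subsets.

Section Blocks.
Variables (k m : nat) (disp : Order.disp_t) (V : finOrderType disp).
Variables (F : kgraph k 'I_m) (G : kgraph k V).

Definition tile (phi : {ffun 'I_m -> V}) := injectiveb phi && ord_hom F G phi.

(** Inductive generation makes disjoint unions immediate, which is how all tilings below are
    assembled; a set of embeddings is extracted only once, in [tileable_tiling]. *)
Inductive tileable : {set V} -> Prop :=
| tileable0 : tileable set0
| tileableU (phi : {ffun 'I_m -> V}) (A : {set V}) : tile phi ->
    [disjoint [set phi i | i in 'I_m] & A] -> tileable A ->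
    tileable ([set phi i | i in 'I_m] :|: A).

Lemma tileable_union (A B : {set V}) : tileable A -> tileable B -> [disjoint A & B] ->
  tileable (A :|: B).
Proof.
move=> tA tB; elim: {A} tA => [|phi A tphi dA tA IH]; first by rewrite set0U.
rewrite disjoints_subset subUset -!disjoints_subset => /andP[d1 d2].
rewrite -setUA; apply: tileableU => //; last exact: IH.
by rewrite disjoint_sym disjoints_subset subUset -!disjoints_subset ![[disjoint _ & [set _ | _ in _]]]disjoint_sym dA.
Qed.

Lemma tileable_tiling : (0 < m)%N -> tileable setT -> has_perfect_tiling F G.
Proof.
move=> m0; suff h A : tileable A -> exists T : {set {ffun 'I_m -> V}},
    (forall phi, phi \in T -> tile phi) /\
    forall v, #|[set phi in T | v \in codom phi]| = (v \in A) :> nat.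
  move=> /h[T [h1 h2]]; exists T; split.
    by move=> phi /h1 /andP[/injectiveP].
  by move=> v; rewrite h2 inE.
elim=> [|phi B tphi dB _ [T [h1 h2]]].
  exists set0; split=> [phi|v]; first by rewrite inE.
  by rewrite inE; apply: eq_card0 => phi; rewrite !inE.
have phiT : phi \notin T.
  apply/negP => pT; pose i0 := Ordinal m0.
  have : phi i0 \notin B.
    by rewrite (disjointFr dB) // imset_f.
  have := h2 (phi i0); case: (_ \in B) => // /eqP; rewrite cards_eq0 => /eqP h _.
  by have := in_set0 phi; rewrite -h inE pT codom_f.
exists (phi |: T); split.
  by move=> psi /setU1P[->|/h1].
move=> v; have [vphi|vphi] := boolP (v \in codom phi).
  have vi : v \in [set phi i | i in 'I_m].
    by case/codomP: vphi => i ->; rewrite imset_f.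
  rewrite inE vi /= -[RHS](cards1 phi); apply: eq_card => psi; rewrite !inE.
  have [->|npsi] := eqVneq psi phi; first by rewrite vphi.
  apply/negP => /= /andP[pT vp]; have /eqP := h2 v.
  rewrite (disjointFr dB vi) cards_eq0 => /eqP h.
  by have := in_set0 psi; rewrite -h inE pT vp.
have vi : v \notin [set phi i | i in 'I_m].
  by apply: contra vphi => /imsetP[i _ ->]; rewrite codom_f.
rewrite inE (negPf vi) -h2; apply: eq_card => psi; rewrite !inE.
by have [->|] := eqVneq psi phi; rewrite ?(negPf vphi) ?andbF.
Qed.

Definition block b (Z : 'I_m -> {set V}) :=
  [/\ forall i, #|Z i| = b,
      forall i j, i != j -> [disjoint Z i & Z j] &
      forall phi : {ffun 'I_m -> V}, (forall i, phi i \in Z i) -> tile phi].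

Inductive blocked b : {set V} -> Prop :=
| blocked0 : blocked b set0
| blockedU Z (A : {set V}) : block b Z -> [disjoint \bigcup_i Z i & A] -> blocked b A ->
    blocked b (\bigcup_i Z i :|: A).

Lemma blocked_union b (A B : {set V}) : blocked b A -> blocked b B -> [disjoint A & B] ->
  blocked b (A :|: B).
Proof.
move=> tA tB; elim: {A} tA => [|Z A tZ dA tA IH]; first by rewrite set0U.
rewrite disjoints_subset subUset -!disjoints_subset => /andP[d1 d2].
rewrite -setUA; apply: blockedU => //; last exact: IH.
by rewrite disjoint_sym disjoints_subset subUset -!disjoints_subset ![[disjoint _ & \bigcup_i _]]disjoint_sym dA.
Qed.

Lemma blocked1_tileable A : blocked 1 A -> tileable A.
Proof.
elim=> [|Z B [Z1 Zd Zt] dB _ IH]; first exact: tileable0.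
have [phi hphi] : exists phi : 'I_m -> V, forall i, Z i = [set phi i].
  apply: (@fin_all_exists _ (fun=> V) (fun i v => Z i = [set v])) => i.
  by apply/cards1P; rewrite Z1.
have E : \bigcup_i Z i = [set [ffun i => phi i] i | i in 'I_m].
  apply/setP => v; apply/bigcupP/imsetP => [[i _]|[i _]].
    by rewrite hphi inE => /eqP ->; exists i; rewrite ?ffunE.
  by rewrite ffunE => ->; exists i; rewrite // hphi inE.
rewrite E; apply: tileableU => //; last by rewrite -E.
by apply: Zt => i; rewrite hphi ffunE inE.
Qed.

Lemma block_split b b1 g Z (Y : 'I_m -> {set V}) : block b Z ->
  (forall i, Y i \subset Z i) -> (forall i, #|Y i| = (b1 * g)%N) ->
  blocked b1 (\bigcup_i Y i).
Proof.
move=> [_ Zd Zt]; elim: g Y => [|g IH] Y YZ Yc.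
  rewrite big1 => [|i _]; first exact: blocked0.
  by apply/eqP; rewrite -cards_eq0 Yc muln0.
have [W hW] : exists W : 'I_m -> {set V}, forall i, W i \subset Y i /\ #|W i| = b1.
  apply: (@fin_all_exists _ (fun=> {set V}) (fun i W => W \subset Y i /\ #|W| = b1)) => i.
  by have [|W] := @subset_card _ (Y i) b1; [rewrite Yc mulnS leq_addr | exists W].
have YE : \bigcup_i Y i = \bigcup_i W i :|: \bigcup_i (Y i :\: W i).
  rewrite -big_split /=; apply: eq_bigr => i _.
  by rewrite setDE setUIr setUCr setIT; apply/esym/setUidPr; case: (hW i).
have WZ i : W i \subset Z i by rewrite (subset_trans _ (YZ i)) //; case: (hW i).
rewrite YE; apply: blockedU.
- split=> [i|i j ij|phi hphi]; first by case: (hW i).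
    by apply: disjointWl (WZ i) (disjointWr (WZ j) (Zd _ _ ij)).
  by apply: Zt => i; apply: (subsetP (WZ i)).
- apply/bigcup_disjointP => i _; rewrite disjoint_sym; apply/bigcup_disjointP => j _.
  have [->|ij] := eqVneq i j.
    by rewrite disjoints_subset; apply/subsetP => v; rewrite !inE => /andP[].
  apply: disjointWr (WZ j) (disjointWl _ (Zd _ _ ij)).
  by rewrite (subset_trans (subsetDl _ _)).
- apply: IH => i; first by rewrite (subset_trans (subsetDl _ _)).
  by case: (hW i) => h1 h2; rewrite cardsD (setIidPr h1) Yc h2 mulnS addKn.
Qed.

(** Forgets which parts form a block and keeps one consequence: if all parts retain the same number
    of vertices, a multiple of [b1], then the retained vertices are again blocked, at size [b1].
    Each part may thus be trimmed without regard to the others. *)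
Lemma blocked_parts b A : (0 < b)%N -> blocked b A ->
  exists P : {set {set V}},
    [/\ forall X, X \in P -> #|X| = b, trivIset P, cover P = A &
        forall b1 g (f : {set V} -> {set V}),
          (forall X, X \in P -> f X \subset X) ->
          (forall X, X \in P -> #|f X| = (b1 * g)%N) ->
          blocked b1 (\bigcup_(X in P) f X)].
Proof.
move=> b0; elim=> [|Z B bZ dB _ [P [Pb Pt Pc Pf]]].
  exists set0; split=> [X|||b1 g f _ _]; rewrite ?inE //.
  - by apply/trivIsetP => X Y; rewrite inE.
  - by rewrite /cover big_set0.
  - by rewrite big_set0; apply: blocked0.
have [Zb Zd Zt] := bZ.
have PB X : X \in P -> X \subset B by move=> XP; rewrite -Pc; apply: bigcup_sup.
have ZP i X : X \in P -> [disjoint Z i & X].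
  move=> /PB XB; apply: disjointWr XB (disjointWl _ dB).
  exact: (bigcup_sup i).
exists ([set Z i | i in 'I_m] :|: P); split.
- by move=> X /setUP[/imsetP[i _ ->]|/Pb].
- apply/trivIsetP => X Y /setUP[/imsetP[i _ ->]|XP] /setUP[/imsetP[j _ ->]|YP] XY.
  + by apply: Zd; apply: contra XY => /eqP ->.
  + exact: ZP.
  + by rewrite disjoint_sym ZP.
  + exact: (trivIsetP Pt).
- rewrite /cover bigcup_setU -/(cover P) Pc; congr (_ :|: _).
  apply/setP => v; apply/bigcupP/bigcupP => [[X /imsetP[i _ ->] vi]|[i _ vi]].
    by exists i.
  by exists (Z i) => //; apply: imset_f.
move=> b1 g f fX fc.
have inZ i : Z i \in [set Z i | i in 'I_m] :|: P by rewrite inE imset_f.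
have inP X : X \in P -> X \in [set Z i | i in 'I_m] :|: P by rewrite inE => ->; rewrite orbT.
have -> : \bigcup_(X in [set Z i | i in 'I_m] :|: P) f X =
    \bigcup_i f (Z i) :|: \bigcup_(X in P) f X.
  rewrite bigcup_setU; congr (_ :|: _).
  apply/setP => v; apply/bigcupP/bigcupP => [[X /imsetP[i _ ->] vi]|[i _ vi]].
    by exists i.
  by exists (Z i) => //; apply: imset_f.
apply: blocked_union.
- by apply: (block_split bZ) => i; [apply: fX | apply: fc].
- by apply: Pf => X /inP; [apply: fX | apply: fc].
- apply/bigcup_disjointP => X XP; rewrite disjoint_sym; apply/bigcup_disjointP => i _.
  rewrite disjoint_sym; apply: disjointWl (fX _ (inZ i)) _.
  by apply: disjointWr (fX _ (inP _ XP)) (ZP _ _ XP).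
Qed.

Definition box (I : finType) (X : I -> {set V}) (H : {set {ffun 'I_m -> I}}) :=
  [/\ forall i, X i != set0,
      forall i j, i != j -> [disjoint X i & X j] &
      forall x : I -> V, (forall i, x i \in X i) -> H \subset tau F G x].

(* Within one part of the box the pieces are cut off in increasing order, so
   that a homomorphism identifying vertices of F lifts to a genuine copy. *)
Lemma box_block (I : finType) (X Y : I -> {set V}) H psi b :
  box X H -> psi \in H -> (forall i, Y i \subset X i) ->
  (forall i, b * hmult i psi <= #|Y i|)%N ->
  exists2 Z : 'I_m -> {set V}, block b Z & forall i, Z i \subset Y (psi i).
Proof.
move=> [X0 Xd XH] psiH YX Yc.
(* The position of i among the vertices of F sent to the same part; its piece [Z i] is the
   corresponding interval of ranks. *)
pose c (i : 'I_m) := #|[set j : 'I_m | (j < i)%N && (psi j == psi i)]|.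
have cS (i j : 'I_m) : (i < j)%N -> psi i = psi j -> (c i < c j)%N.
  move=> ij pij; apply: proper_card; apply/properP; split.
    apply/subsetP => l; rewrite !inE pij => /andP[li ->]; rewrite andbT.
    exact: ltn_trans ij.
  by exists i; rewrite !inE ?ij ?pij ?eqxx // ltnn.
have cm i : (c i < hmult (psi i) psi)%N.
  apply: proper_card; apply/properP; split.
    by apply/subsetP => l; rewrite !inE => /andP[].
  by exists i; rewrite !inE ?eqxx // ltnn.
pose Z i := [set y in Y (psi i) | (b * c i <= rank (Y (psi i)) y < b * c i + b)%N].
have ZY i : Z i \subset Y (psi i) by apply/subsetP => y; rewrite inE => /andP[].
have ZX i : Z i \subset X (psi i) by apply: subset_trans (ZY i) (YX _).
have Zlt (i j : 'I_m) y z : (i < j)%N -> psi i = psi j -> y \in Z i -> z \in Z j -> (y < z)%O.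
  move=> ij pij; rewrite !inE => /and3P[_ _ h1] /and3P[_ h2 _].
  apply: (@rank_lt _ _ (Y (psi j))); rewrite -{1}pij (leq_trans h1) // (leq_trans _ h2) //.
  by rewrite -mulnSr leq_mul2l cS ?orbT.
exists Z => //; split=> [i|i j ij|phi hphi].
- apply: card_rank; rewrite -mulnSr; apply: leq_trans (Yc _).
  by rewrite leq_mul2l cm orbT.
- have [pij|pij] := eqVneq (psi i) (psi j); last first.
    by apply: disjointWl (ZX i) (disjointWr (ZX j) (Xd _ _ pij)).
  rewrite disjoints_subset; apply/subsetP => y yi; rewrite inE; apply/negP => yj.
  move: ij; rewrite neq_ltn => /orP[] ij.
    by have := Zlt _ _ _ _ ij pij yi yj; rewrite ltxx.
  by have := Zlt _ _ _ _ ij (esym pij) yj yi; rewrite ltxx.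
have phiX i : phi i \in X (psi i) by apply: (subsetP (ZX i)).
have phi_lt (i j : 'I_m) : (i < j)%N -> psi i = psi j -> (phi i < phi j)%O.
  by move=> ij pij; apply: (Zlt i j).
have [x0 hx0] : exists x0 : I -> V, forall i, x0 i \in X i.
  apply: (@fin_all_exists _ (fun=> V) (fun i v => v \in X i)) => i.
  exact/set0Pn.
have homH x : (forall i, x i \in X i) -> ord_hom F G [ffun i => x (psi i)].
  by move=> /XH/subsetP/(_ _ psiH); rewrite inE.
apply/andP; split.
  apply/injectiveP => i j pij; have [//|ij] := eqVneq i j.
  have [eij|eij] := eqVneq (psi i) (psi j).
    move: ij; rewrite neq_ltn => /orP[] ij.
      by have := phi_lt _ _ ij eij; rewrite pij ltxx.
    by have := phi_lt _ _ ij (esym eij); rewrite pij ltxx.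
  by have := phiX j; rewrite -pij (disjointFr (Xd _ _ eij)).
apply/andP; split.
  apply/forall_inP => e eF.
  (* The image of an edge under a homomorphism has k elements, so [psi] is injective on e. Hence
     some transversal agrees with [phi] on e, although different edges may need different
     transversals. *)
  have injpsi : {in e &, injective psi}.
    have /andP[/forall_inP/(_ e eF) h _] := homH _ hx0.
    have E : [set [ffun i => x0 (psi i)] i | i in e] = x0 @: (psi @: e).
      by rewrite -imset_comp; apply: eq_imset => i /=; rewrite ffunE.
    apply/imset_injP; rewrite eqn_leq leq_imset_card (edges_uniform eF).
    by have := edges_uniform h; rewrite E => {1}<-; apply: leq_imset_card.
  pose x v := if [pick i in e | psi i == v] is Some i then phi i else x0 v.
  have hx v : x v \in X v.
    by rewrite /x; case: pickP => [i /andP[_ /eqP <-]|_].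
  have /andP[/forall_inP/(_ e eF) h _] := homH _ hx.
  suff -> : phi @: e = [set [ffun i => x (psi i)] i | i in e] by [].
  apply: eq_in_imset => i ie; rewrite ffunE /x.
  case: pickP => [j /andP[je /eqP /injpsi ->] //|/(_ i)].
  by rewrite ie eqxx.
apply/'forall_forallP => u v; apply/implyP => uv.
have [puv|puv] := eqVneq (psi u) (psi v); first exact/ltW/phi_lt.
(* A transversal through both [phi u] and [phi v], for which the order-preserving property is known
   from the type. *)
pose x w := if w == psi u then phi u else if w == psi v then phi v else x0 w.
have hx w : x w \in X w.
  by rewrite /x; case: eqVneq => [->|_] //; case: eqVneq => [->|_].
have /andP[_ /'forall_forallP/(_ u v)] := homH _ hx.
by rewrite uv /= !ffunE /x eqxx eq_sym (negPf puv) eqxx.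
Qed.

(** Induction on the total weight: one unit of [a psi] is spent on a block from [box_block], which
    takes exactly b times [hmult i psi] vertices from part i and leaves the balance equation
    intact. *)
Lemma box_blocked (I : finType) (X Y : I -> {set V}) H b (a : {ffun 'I_m -> I} -> nat) :
  (0 < b)%N -> box X H -> (forall i, Y i \subset X i) ->
  (forall i, #|Y i| = b * \sum_(psi in H) a psi * hmult i psi)%N ->
  blocked b (\bigcup_i Y i).
Proof.
move=> b0 bX; have [X0 Xd XH] := bX.
move: {2}(\sum_(psi in H) a psi)%N (leqnn (\sum_(psi in H) a psi)) => N.
elim: N a Y => [|N IH] a Y hN YX Yc.
  rewrite big1 => [|i _]; first exact: blocked0.
  apply/eqP; rewrite -cards_eq0 Yc big1 ?muln0 // => psi psiH.
  move: hN; rewrite leqn0 sum_nat_eq0 => /forall_inP/(_ _ psiH)/eqP ->.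
  by rewrite mul0n.
have [/forall_inP h0|] := boolP [forall psi in H, a psi == 0%N].
  apply: (IH a) => //; rewrite big1 // => psi /h0 /eqP //.
rewrite negb_forall_in => /exists_inP[psi psiH a0].
pose a' p := if p == psi then (a p).-1 else a p.
have sa (c : {ffun 'I_m -> I} -> nat) : (\sum_(p in H) a p * c p =
    \sum_(p in H) a' p * c p + c psi)%N.
  rewrite (bigD1 psi) //= [in RHS](bigD1 psi) //= {1}/a' eqxx.
  rewrite [in RHS](eq_bigr (fun p => a p * c p)%N) => [|p /andP[_ /negPf np]]; last first.
    by rewrite /a' np.
  rewrite addnAC; congr (_ + _)%N.
  by rewrite addnC -mulSn prednK // lt0n.
have [|Z bZ ZY] := @box_block I X Y H psi b bX psiH YX.
  by move=> i; rewrite Yc sa mulnDr leq_addl.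
have [Zb Zd Zt] := bZ.
pose Y' i := Y i :\: \bigcup_j Z j.
have YE : \bigcup_i Y i = \bigcup_j Z j :|: \bigcup_i Y' i.
  apply/setP => v; rewrite inE; apply/bigcupP/orP => [[i _ vi]|[]/bigcupP[i _ vi]].
  - have [vZ|vZ] := boolP (v \in \bigcup_j Z j); [by left|right].
    by apply/bigcupP; exists i; rewrite // inE vZ vi.
  - by exists (psi i); rewrite // (subsetP (ZY i)).
  - by exists i => //; move: vi; rewrite inE => /andP[].
rewrite YE; apply: blockedU => //.
  apply/bigcup_disjointP => i _.
  by rewrite disjoint_sym disjoints_subset /Y' setDE subsetIr.
apply: (IH a') => [|i|i].
- by move: hN; have := sa (fun=> 1%N); rewrite -!big_distrl /= !muln1 addn1 => ->.
- exact: subset_trans (subsetDl _ _) (YX i).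
have cZ : #|Y i :&: \bigcup_j Z j| = (b * hmult i psi)%N.
  have -> : Y i :&: \bigcup_j Z j = \bigcup_(j | psi j == i) Z j.
    apply/setP => v; rewrite inE; apply/andP/bigcupP => [[vi /bigcupP[j _ vj]]|[j /eqP pj vj]].
      exists j => //; apply/eqP; case: (eqVneq (psi j) i) => // pji.
      have := subsetP (YX _) _ vi; rewrite (disjointFr (Xd _ _ pji)) //.
      by rewrite (subsetP (YX _)) // (subsetP (ZY j)).
    split; first by rewrite -pj (subsetP (ZY j)).
    by apply/bigcupP; exists j.
  rewrite card_bigcup_disjoint => [|? ? _ _]; last exact: Zd.
  rewrite (eq_bigr (fun=> b)) => [|j _]; last by rewrite Zb.
  rewrite sum_nat_const mulnC; congr (_ * _)%N.
  by apply: eq_card => j; rewrite !inE.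
by rewrite cardsD cZ Yc sa mulnDr addnK.
Qed.

End Blocks.

(** * Almost perfect tilings *)

Section Packing.
Variable R : realType.

(** Multiply the fractional matching by D and round down. There are at most s^m maps, so at most s^m
    units are lost, and D is chosen so that m s^m is at most rho D s. It does not depend on H, so
    boxes of every type cost the same number of vertices per part. *)
Lemma spaT_round m s (rho : R) : (0 < m)%N -> (0 < s)%N -> 0 < rho ->
  exists2 D : nat, (0 < D)%N & forall H : {set {ffun 'I_m -> 'I_s}}, spaT rho H ->
    exists2 a : {ffun 'I_m -> 'I_s} -> nat,
      (forall v, \sum_(psi in H) a psi * hmult v psi <= D)%N &
      (1 - 2 * rho) * D%:R * s%:R <= m%:R * (\sum_(psi in H) a psi)%:R.
Proof.
move=> m0 s0 rho0; have [N hN] := natr_unbounded (m%:R * (s ^ m)%:R / rho : R).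
exists N.+1 => // H [w [w0 w1 wS]].
pose a psi := Num.truncn (N.+1%:R * w psi); exists a => [v|].
  rewrite -(ler_nat R) natr_sum -[leRHS]mulr1.
  apply: le_trans (ler_wpM2l _ (w1 v)) => //.
  rewrite mulr_sumr; apply: ler_sum => psi psiH; rewrite natrM mulrA ler_wpM2r //.
  by rewrite truncn_le // mulr_ge0 // w0.
have m0' : 0 < m%:R :> R by rewrite ltr0n.
have s0' : 0 < s%:R :> R by rewrite ltr0n.
have aw : N.+1%:R * \sum_(psi in H) w psi - (s ^ m)%:R <= (\sum_(psi in H) a psi)%:R :> R.
  rewrite natr_sum lerBlDr.
  apply: (@le_trans _ _ (\sum_(psi in H) ((a psi)%:R + 1))).
    rewrite mulr_sumr; apply: ler_sum => psi psiH.
    by rewrite natr1 ltW // truncnS_gt.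
  rewrite big_split /= lerD2l sumr_const ler_nat.
  by apply: leq_trans (max_card _) _; rewrite card_ffun !card_ord.
apply: le_trans (ler_wpM2l (ltW m0') aw).
have h1 : (1 - rho) * s%:R <= m%:R * \sum_(psi in H) w psi.
  by move: wS; rewrite card_ord ler_pdivrMr // [leRHS]mulrC.
have h2 : m%:R * (s ^ m)%:R <= rho * (N.+1%:R * s%:R).
  have : m%:R * (s ^ m)%:R <= N.+1%:R * rho :> R.
    by rewrite -ler_pdivrMr // (le_trans hN) // ler_nat leqnSn.
  move=> /le_trans -> //; rewrite [leLHS]mulrC ler_wpM2l ?(ltW rho0) //.
  by rewrite ler_peMr // ler1n.
have N0 : 0 <= N.+1%:R :> R by [].
have := ler_wpM2l N0 h1; move: h2.
move: (\sum_(psi in H) w psi) ((s ^ m)%:R : R) (N.+1%:R : R) (s%:R : R) (m%:R : R).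
by move=> W E D s' m'; lra.
Qed.

(** [boxes_dense] provides a positive proportion of all #|T|^(s t) candidates, whereas those with a
    repeated entry in some row number at most s t^2 #|T|^(s t - 1). *)
Lemma kst_rows s t (p : R) : (0 < s)%N -> (0 < t)%N -> 0 < p ->
  exists b0, forall (T : finType) (A : {set {ffun 'I_s -> T}}), (b0 <= #|T|)%N ->
    p * #|T|%:R ^+ s <= #|A|%:R ->
    exists2 C : 'I_s -> {set T}, (forall i, #|C i| = t) &
      forall c : {ffun 'I_s -> T}, (forall i, c i \in C i) -> c \in A.
Proof.
move=> s0 t0 p0; have [c c0 hc] := @boxes_dense R t s p t0 p0.
have [N hN] := natr_unbounded ((s * t ^ 2)%:R / c).
exists N.+1 => T A NT /hc hA.
have nT : 0 < #|T|%:R :> R by rewrite ltr0n (leq_trans _ NT).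
pose U : finType := {ffun 'I_t -> T}.
pose NI := [set X : {ffun 'I_s -> U} | [exists i, X i \in [set x : U | ~~ injectiveb x]]].
have cNI : (#|NI| <= s * (t ^ 2 * #|T| ^ t.-1 * (#|T| ^ t) ^ s.-1))%N.
  have := @card_ffun_exists 'I_s U (fun=> [set x : U | ~~ injectiveb x]) (t ^ 2 * #|T| ^ t.-1).
  rewrite card_ord card_ffun card_ord; apply => _.
  by have := @card_noninj 'I_t T; rewrite card_ord.
have {}cNI : #|NI|%:R < #|boxes t A|%:R :> R.
  apply: lt_le_trans hA.
  apply: (@le_lt_trans _ _ ((s * t ^ 2)%:R * #|T|%:R ^+ (s * t).-1)).
    rewrite -natrX -natrM ler_nat (leq_trans cNI) // -!mulnA !leq_mul2l.
    rewrite -expnM -expnD; do 2 (apply/orP; right).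
    by rewrite leq_eqVlt (_ : t.-1 + t * s.-1 = (s * t).-1)%N ?eqxx //; nia.
  have st0 : (0 < s * t)%N by rewrite muln_gt0 s0.
  rewrite -[in ltRHS](prednK st0) exprS mulrA ltr_pM2r ?exprn_gt0 //.
  by rewrite mulrC -ltr_pdivrMr // (le_lt_trans hN) // ltr_nat.
have [X] : exists X, X \in boxes t A :\: NI.
  apply/set0Pn; rewrite -card_gt0 cardsD subn_gt0.
  rewrite ltr_nat in cNI; apply: leq_ltn_trans cNI.
  by apply: subset_leq_card; apply: subsetIr.
rewrite inE => /andP[XNI XA].
have Xinj i : injective (X i).
  apply/injectiveP; apply: contraR XNI => h; rewrite inE; apply/existsP; exists i.
  by rewrite inE.
exists (fun i => [set X i j | j in 'I_t]) => [i|d hd].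
  by rewrite card_imset // card_ord.
have [e he] : exists e : 'I_s -> 'I_t, forall i, d i = X i (e i).
  apply: (@fin_all_exists _ (fun=> 'I_t) (fun i j => d i = X i j)) => i.
  by have /imsetP[j _ ->] := hd i; exists j.
move: XA; rewrite inE => /forallP/(_ [ffun i => e i]).
by rewrite (_ : [ffun i => X i _] = d) //; apply/ffunP => i; rewrite !ffunE he.
Qed.

Lemma pigeonhole (X K : finType) (f : X -> K) (A : {set X}) (k0 : K) :
  exists h, (#|A| <= #|K| * #|[set x in A | f x == h]|)%N.
Proof.
case: (@arg_maxnP K k0 predT (fun h => #|[set x in A | f x == h]|) isT) => h _ hmax.
exists h; rewrite -sum1_card (partition_big f predT) //= -(sum_nat_const K).
rewrite [leqRHS](eq_bigl predT) //; apply: leq_sum => y _.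
by apply: leq_trans (hmax y isT); rewrite -sum1_card; apply: eq_leq; apply: eq_bigl => x; rewrite inE.
Qed.

Section OneGroup.
Variables (k m : nat) (F : kgraph k 'I_m).

(* Boxes are found greedily: as long as each part has lost at most b / (4 s)
   vertices, a quarter of all transversals is still good and unused. *)
Lemma pack_group s (rho : R) : (0 < m)%N -> (0 < s)%N -> 0 < rho ->
  exists2 D : nat, (0 < D)%N & forall b1, (0 < b1)%N -> exists b0, forall b l,
    (b0 <= b)%N -> (4 * s * (l * (D * b1)) <= b)%N ->
  forall (disp : Order.disp_t) (V : finOrderType disp) (G : kgraph k V)
    (e : 'I_s -> 'I_b -> V) (Bad : {set {ffun 'I_s -> 'I_b}}),
  (forall i j i' j', e i j = e i' j' -> i = i' /\ j = j') ->
  (forall c, c \notin Bad -> spaT rho (tau F G (fun i => e i (c i)))) ->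
  (2 * #|Bad| <= b ^ s)%N ->
  exists (U : 'I_s -> {set 'I_b}) (B : {set V}),
    [/\ forall i, #|U i| = (l * (D * b1))%N,
        B \subset \bigcup_i (e i @: U i), blocked F G b1 B &
        (1 - 2 * rho) * s%:R * (l * (D * b1))%:R <= #|B|%:R].
Proof.
move=> m0 s0 rho0; have [D D0 hD] := spaT_round m0 s0 rho0.
exists D => // b1 b10; pose K : finType := {set {ffun 'I_m -> 'I_s}}.
have K0 : 0 < (#|K|)%:R :> R by rewrite ltr0n; apply/card_gt0P; exists set0.
(* A quarter of the transversals is available, shared among at most #|K| types. *)
have p0 : 0 < (4 * #|K|%:R)^-1 :> R by rewrite invr_gt0 mulr_gt0.
pose t := (D * b1)%N; have t0 : (0 < t)%N by rewrite muln_gt0 D0.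
have [b0 hb0] := kst_rows s0 t0 p0.
exists (maxn b0 1) => b l; rewrite geq_max => /andP[bb0 b_gt0].
move=> hl disp V G e Bad einj hBad cBad.
have {hl} : (4 * s * (l * t) <= b)%N by [].
elim: l => [|l IH] hl.
  exists (fun=> set0), set0; split.
  - by move=> i; rewrite cards0.
  - by rewrite sub0set.
  - exact: blocked0.
  - by rewrite mul0n mulr0 cards0.
have hl' : (4 * s * (l * t) <= b)%N.
  by apply: leq_trans hl; rewrite leq_mul2l leq_mul2r leqnSn !orbT.
have [U [B [Uc BU bB cB]]] := IH hl'.
pose hit := [set c : {ffun 'I_s -> 'I_b} | [exists i, c i \in U i]].
pose A := ~: (Bad :|: hit).
have chit : (4 * #|hit| <= b ^ s)%N.
  have := @card_ffun_exists 'I_s 'I_b U (l * t) (fun i => eq_leq (Uc i)).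
  rewrite !card_ord -/hit => h; rewrite -[s in leqRHS](prednK s0) expnS.
  apply: (@leq_trans (4 * (s * (l * t * b ^ s.-1)))); first by rewrite leq_mul2l h orbT.
  by rewrite !mulnA leq_mul2r -!mulnA [(4 * _)%N]mulnA hl' orbT.
have cA : (b ^ s <= 4 * #|A|)%N.
  have := cardsC (Bad :|: hit); rewrite card_ffun !card_ord -/A.
  have := (leq_card_setU Bad hit).1.
  by move: cBad chit; move: (#|Bad|) (#|hit|) (#|A|) (#|_ :|: _|) (b ^ s)%N; lia.
pose col (c : {ffun 'I_s -> 'I_b}) : K := tau F G (fun i => e i (c i)).
have [H hH] := pigeonhole col A set0.
have [||C Cc hC] := hb0 'I_b [set c in A | col c == H].
    by rewrite card_ord.
  rewrite card_ord ler_pdivrMl ?mulr_gt0 // -natrX -!natrM ler_nat.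
  by apply: leq_trans cA _; rewrite -mulnA leq_mul2l hH orbT.
have [c0 hc0] : exists c0 : 'I_s -> 'I_b, forall i, c0 i \in C i.
  apply: (@fin_all_exists _ (fun=> 'I_b) (fun i j => j \in C i)) => i.
  by apply/set0Pn; rewrite -card_gt0 Cc.
have CU i : [disjoint C i & U i].
  rewrite disjoints_subset; apply/subsetP => j jC; rewrite inE; apply/negP => jU.
  have /hC : forall i', [ffun i' => if i' == i then j else c0 i'] i' \in C i'.
    by move=> i'; rewrite ffunE; case: eqP => [->|].
  rewrite !inE negb_or => /andP[/andP[_ /existsPn/(_ i)]].
  by rewrite ffunE eqxx jU.
have eI i : injective (e i) by move=> j j' /einj[].
have ed i i' (X Y : {set 'I_b}) : i != i' -> [disjoint e i @: X & e i' @: Y].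
  move=> ii'; rewrite disjoints_subset; apply/subsetP => v /imsetP[j _ ->].
  rewrite inE; apply/negP => /imsetP[j' _ /einj[h _]]; by rewrite h eqxx in ii'.
have spaH : spaT rho H.
  have /hC : forall i, [ffun i => c0 i] i \in C i by move=> i; rewrite ffunE.
  rewrite !inE negb_or => /andP[/andP[/hBad h _] /eqP <-] //.
have [a ha1 ha2] := hD H spaH.
pose X i := e i @: C i.
have bX : box F G X H.
  split=> [i|i j|x hx]; first by apply/set0Pn; exists (e i (c0 i)); rewrite imset_f.
    exact: ed.
  have [c hc] : exists c : 'I_s -> 'I_b, forall i, c i \in C i /\ x i = e i (c i).
    apply: (@fin_all_exists _ (fun=> 'I_b) (fun i j => j \in C i /\ x i = e i j)) => i.
    by have /imsetP[j jC ->] := hx i; exists j.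
  have /hC : forall i, [ffun i => c i] i \in C i by move=> i; rewrite ffunE; case: (hc i).
  rewrite !inE => /andP[_ /eqP <-]; apply/subsetP => psi; rewrite !inE.
  congr (ord_hom F G _); apply/ffunP => i; rewrite !ffunE.
  by case: (hc (psi i)).
pose n i := (b1 * \sum_(psi in H) a psi * hmult i psi)%N.
have [Y hY] : exists Y : 'I_s -> {set V}, forall i, Y i \subset X i /\ #|Y i| = n i.
  apply: (@fin_all_exists _ (fun=> {set V}) (fun i Y => Y \subset X i /\ #|Y| = n i)) => i.
  have [|Y YX Yn] := @subset_card _ (X i) (n i); last by exists Y.
  by rewrite card_imset // Cc /n /t mulnC leq_mul2r ha1 orbT.
have bY : blocked F G b1 (\bigcup_i Y i).
  by apply: (box_blocked (a := a) b10 bX) => i; case: (hY i).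
have cY : #|\bigcup_i Y i| = (b1 * m * \sum_(psi in H) a psi)%N.
  rewrite card_bigcup_disjoint => [|i j _ _ ij]; last first.
    apply: disjointWl (proj1 (hY i)) (disjointWr (proj1 (hY j)) _); exact: ed.
  rewrite (eq_bigr n) => [|i _]; last by case: (hY i).
  rewrite -big_distrr /= -mulnA; congr (_ * _)%N.
  rewrite exchange_big /= big_distrr /=; apply: eq_bigr => psi _.
  by rewrite -big_distrr /= sum_hmult mulnC.
exists (fun i => U i :|: C i), (B :|: \bigcup_i Y i).
have dBY : [disjoint B & \bigcup_i Y i].
  apply: disjointWl BU _; apply/bigcup_disjointP => i _; rewrite disjoint_sym.
  apply/bigcup_disjointP => j _; apply: disjointWl (proj1 (hY i)) _.
  have [<-|ij] := eqVneq i j; last exact: ed.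
  rewrite -setI_eq0 -imsetI; last by move=> ? ? _ _; apply: eI.
  by rewrite (disjoint_setI0 (CU i)) imset0.
split.
- move=> i; rewrite cardsU (disjoint_setI0 _) ?cards0 ?subn0 ?Uc ?Cc -?mulSnr //.
  by rewrite disjoint_sym.
- rewrite subUset; apply/andP; split.
    apply: subset_trans BU _; apply/bigcupsP => i _.
    by apply: (bigcup_max i) => //; apply: imsetS; apply: subsetUl.
  apply/bigcupsP => i _; apply: (bigcup_max i) => //.
  by apply: subset_trans (proj1 (hY i)) _; apply: imsetS; apply: subsetUr.
- exact: blocked_union.
- rewrite cardsU (disjoint_setI0 dBY) cards0 subn0 natrD mulSn natrD mulrDr addrC.
  apply: lerD => //; rewrite cY -mulnA !natrM.
  have b1r : 0 <= b1%:R :> R by [].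
  have := ler_wpM2l b1r ha2; move: (\sum_(psi in H) a psi)%:R.
  move: (s%:R : R) (D%:R : R) (b1%:R : R) (m%:R : R) => s' D' b' m' S; lra.
Qed.

End OneGroup.

End Packing.

(** * Grouping the parts, and cutting the uncovered vertices into parts *)

Lemma card_dep_pairs (X Y : finType) (A : {set X}) (B : X -> {set Y}) :
  #|[set p : X * Y | (p.1 \in A) && (p.2 \in B p.1)]| = (\sum_(x in A) #|B x|)%N.
Proof.
under eq_bigr do rewrite -sum1_card; rewrite -sum1_card pair_big_dep /=.
by apply: eq_bigl => p; rewrite inE.
Qed.

Lemma card_perm_fiber N s (e : 'I_s -> 'I_N) (z : {ffun 'I_s -> 'I_N}) :
  injective e -> injective z ->
  (#|[set p : {perm 'I_N} | [forall i, p (e i) == z i]]| <= (N - s)`!)%N.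
Proof.
move=> einj zinj; pose ime := [set e i | i in 'I_s]; pose imz := [set z i | i in 'I_s].
have cR : #|[pred b | b \notin imz]| = (N - s)%N.
  rewrite (eq_card (B := mem (~: imz))); last by move=> b; rewrite !inE.
  by rewrite -[N in (N - s)%N]card_ord -(cardsC imz) card_imset // card_ord addKn.
pose D : finType := {a : 'I_N | a \notin ime}.
have cD : #|D| = (N - s)%N.
  rewrite card_sig (eq_card (B := mem (~: ime))); last by move=> b; rewrite !inE.
  by rewrite -[N in (N - s)%N]card_ord -(cardsC ime) card_imset // card_ord addKn.
have := card_inj_ffuns_on D [pred b | b \notin imz].
rewrite cR cD ffactnn => <-.
pose f (p : {perm 'I_N}) : {ffun D -> 'I_N} := [ffun a => p (val a)].
rewrite -(card_in_imset (f := f)).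
  apply: subset_leq_card; apply/subsetP => g /imsetP[p]; rewrite inE => /forallP hp ->.
  rewrite inE; apply/andP; split.
    apply/ffun_onP => a; rewrite ffunE inE; apply/negP => /imsetP[i _].
    rewrite -(eqP (hp i)) => /perm_inj h; have := valP a.
    by rewrite h imset_f.
  by apply/injectiveP => a b; rewrite !ffunE => /perm_inj/val_inj.
move=> p p'; rewrite !inE => /forallP hp /forallP hp' /ffunP h.
apply/permP => a; have [/imsetP[i _ ->]|na] := boolP (a \in ime).
  by rewrite (eqP (hp i)) (eqP (hp' i)).
by have := h (exist _ a na); rewrite !ffunE.
Qed.

(* By averaging over all permutations of 'I_N. *)
Lemma disjoint_groups N s L (Bd : {set {ffun 'I_s -> 'I_N}}) : (L * s <= N)%N ->
  (forall z, z \in Bd -> injective z) ->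
  exists2 q : 'I_L -> {ffun 'I_s -> 'I_N},
    forall j i j' i', q j i = q j' i' -> j = j' /\ i = i' &
    (#|[set j | q j \in Bd]| * N ^_ s <= L * #|Bd|)%N.
Proof.
move=> LsN Bdinj.
have lt (j : 'I_L) (i : 'I_s) : (j * s + i < N)%N.
  apply: leq_trans LsN; apply: (@leq_trans (j.+1 * s)); last by rewrite leq_mul2r ltn_ord orbT.
  by rewrite mulSn addnC ltn_add2r.
pose idx j i := Ordinal (lt j i).
have idxinj j i j' i' : idx j i = idx j' i' -> j = j' /\ i = i'.
  move=> /(congr1 val) /= h; have s0 : (0 < s)%N by apply: leq_trans (ltn_ord i).
  split; apply: val_inj.
    by have := congr1 (divn^~ s) h; rewrite !divnMDl // !divn_small // !addn0.
  by have := congr1 (modn^~ s) h; rewrite !modnMDl !modn_small.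
pose q (p : {perm 'I_N}) j : {ffun 'I_s -> 'I_N} := [ffun i => p (idx j i)].
have [L0|L0] := posnP L.
  exists (q 1%g) => [j|]; first by have := ltn_ord j; rewrite {2}L0.
  by rewrite (_ : [set _ | _] = set0) ?cards0 // -setP => j; have := ltn_ord j; rewrite {2}L0.
have sN : (s <= N)%N by apply: leq_trans LsN; rewrite leq_pmull.
have [/existsP[p hp]|/existsPn h] :=
    boolP [exists p : {perm 'I_N}, (#|[set j | q p j \in Bd]| * N ^_ s <= L * #|Bd|)%N].
  exists (q p) => // j i j' i'; rewrite !ffunE => /perm_inj; exact: idxinj.
have h1 : (\sum_(p : {perm 'I_N}) #|[set j | q p j \in Bd]| <= L * (#|Bd| * (N - s)`!))%N.
  under eq_bigr do rewrite -sum1_card big_mkcond /=.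
  rewrite exchange_big /= -[L in leqRHS]card_ord -(sum_nat_const 'I_L) [leqRHS](eq_bigl predT) //.
  apply: leq_sum => j _; rewrite -big_mkcond /=.
  rewrite (eq_bigl (mem [set p | q p j \in Bd])) ?sum1_card; last by move=> p; rewrite !inE.
  apply: (card_fibers (f := fun p => q p j)) => [p|z zB]; first by rewrite inE.
  apply: leq_trans (@card_perm_fiber N s (idx j) z _ (Bdinj z zB)); last by move=> i i' /idxinj[].
  apply: subset_leq_card; apply/subsetP => p; rewrite !inE => /andP[_ /eqP <-].
  by apply/forallP => i; rewrite ffunE.
have h2 : (N`! * (L * #|Bd|) < \sum_(p : {perm 'I_N}) #|[set j | q p j \in Bd]| * N ^_ s)%N.
  have cp : #|{perm 'I_N}| = N`! by apply: card_Sn.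
  rewrite -cp -(sum_nat_const {perm 'I_N}) [ltnLHS](eq_bigl predT) //.
  have hp p : (L * #|Bd| < #|[set j | q p j \in Bd]| * N ^_ s)%N by rewrite ltnNge h.
  rewrite (bigD1 1%g) //= [ltnRHS](bigD1 1%g) //= -addSn leq_add //.
  by apply: leq_sum => p _; apply: ltnW.
move: h2; rewrite -big_distrl /= ltnNge; case/negP.
apply: leq_trans (leq_mul h1 (leqnn _)) _.
by rewrite -!mulnA [((N - s)`! * _)%N]mulnC ffact_fact // [leqRHS]mulnC mulnA.
Qed.

Lemma void_parts (T : finType) (A : {set T}) b : (0 < b)%N ->
  exists P : {set {set T}}, [/\ forall X, X \in P -> #|X| = b, trivIset P,
    cover P \subset A & (#|A| < #|cover P| + b)%N].
Proof.
move=> b0; move: {2}#|A| (leqnn #|A|) => n; elim: n A => [|n IH] A An.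
  exists set0; split=> [X|||]; rewrite ?inE //.
  - by apply/trivIsetP => X Y; rewrite inE.
  - by rewrite /cover big_set0 sub0set.
  - by rewrite (leq_ltn_trans An) // ltn_addl.
have [Ab|bA] := ltnP #|A| b.
  exists set0; split=> [X|||]; rewrite ?inE //.
  - by apply/trivIsetP => X Y; rewrite inE.
  - by rewrite /cover big_set0 sub0set.
  - by rewrite ltn_addl.
have [X XA Xb] := subset_card bA.
have cAX : #|A :\: X| = (#|A| - b)%N by rewrite cardsD (setIidPr XA) Xb.
have [|P [Pb Pt Pc Pn]] := IH (A :\: X); first by rewrite cAX; lia.
have XP Y : Y \in P -> [disjoint X & Y].
  move=> YP; rewrite disjoint_sym disjoints_subset.
  have : Y \subset A :\: X by apply: subset_trans Pc; apply: (bigcup_sup Y).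
  by rewrite subsetD => /andP[_]; rewrite disjoints_subset.
have dX : [disjoint X & cover P] by apply/bigcup_disjointP => Y /XP.
have cE : cover (X |: P) = X :|: cover P by rewrite /cover bigcup_setU big_set1.
exists (X |: P); split.
- by move=> Y /setU1P[->|/Pb].
- apply/trivIsetP => Y Z /setU1P[->|YP] /setU1P[->|ZP]; rewrite ?eqxx // => YZ.
  + exact: XP.
  + by rewrite disjoint_sym XP.
  + exact: (trivIsetP Pt).
- by rewrite cE subUset XA (subset_trans Pc (subsetDl _ _)).
- by rewrite cE cardsU (disjoint_setI0 dX) cards0 subn0 Xb; move: Pn; rewrite cAX; lia.
Qed.

Lemma blocked_bigcup k m (disp : Order.disp_t) (V : finOrderType disp)
    (F : kgraph k 'I_m) (G : kgraph k V) b (J : finType) (B : J -> {set V}) :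
  (forall j, blocked F G b (B j)) -> (forall i j, i != j -> [disjoint B i & B j]) ->
  blocked F G b (\bigcup_j B j).
Proof.
move=> hB dB; have := enum_uniq J; rewrite -big_enum /=.
elim: (enum J) => [|j l IH] /=; first by rewrite big_nil => _; apply: blocked0.
move=> /andP[jl /IH bl]; rewrite big_cons; apply: blocked_union => //.
elim: l jl {IH bl} => [|i l IH] jl; first by rewrite big_nil disjoint_sym disjoints_subset sub0set.
move: jl; rewrite inE negb_or => /andP[ji jl]; rewrite big_cons.
by rewrite disjoint_sym disjoints_subset subUset -!disjoints_subset ![[disjoint _ & B j]]disjoint_sym dB // IH.
Qed.

Section AlmostPerfect.
Variables (R : realType) (k m d : nat) (F : kgraph k 'I_m).
Variables (c g : R).

(** Quantified over all block sizes because one improvement step, in order to produce blocks of a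
    given size, starts from far larger ones in which boxes can be found. *)
Definition AlmostPerfect (lam : R) := forall b, (0 < b)%N -> exists n0,
  forall disp (V : finOrderType disp) (G : kgraph k V), (n0 <= #|V|)%N ->
    tdense G d (c + g) ->
    exists2 A : {set V}, blocked F G b A & (1 - lam) * #|V|%:R <= #|A|%:R.

(** A group of parts with more than b^s / 2 bad transversals uses up that many bad samples, and
    distinct groups use distinct ones, so such groups are rare; [disjoint_groups] transfers this to
    one disjoint family. The factor 4 is 2 for the half and 2 for comparing (N + 1)^s with the
    falling factorial [N ^_ s]. *)
Lemma good_groups (V : finType) s N b L (e : 'I_N -> 'I_b -> V) (Bad : {set {ffun 'I_s -> V}})
    (f : R) : (0 < s)%N -> (0 < b)%N -> 0 <= f -> (L * s <= N)%N ->
  (forall p j p' j', e p j = e p' j' -> p = p' /\ j = j') ->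
  #|Bad|%:R <= f * #|V|%:R ^+ s -> (#|V| <= N.+1 * b)%N ->
  (2 * (s * s.+1) <= N.+1)%N ->
  exists (q : 'I_L -> {ffun 'I_s -> 'I_N}) (J : {set 'I_L}),
    [/\ forall j i j' i', q j i = q j' i' -> j = j' /\ i = i',
        #|J|%:R <= 4 * f * L%:R &
        forall j, j \notin J ->
          (2 * #|[set h : {ffun 'I_s -> 'I_b} | [ffun i => e (q j i) (h i)] \in Bad]| <= b ^ s)%N].
Proof.
move=> s0 b0 f0 LsN einj cBad VN sN.
pose x (z : {ffun 'I_s -> 'I_N}) (h : {ffun 'I_s -> 'I_b}) := [ffun i => e (z i) (h i)].
pose BadC z := [set h | x z h \in Bad].
pose Bd := [set z : {ffun 'I_s -> 'I_N} | injectiveb z && (b ^ s < 2 * #|BadC z|)%N].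
have Bdinj z : z \in Bd -> injective z by rewrite inE => /andP[/injectiveP].
have [q qinj hq] := disjoint_groups LsN Bdinj.
exists q, [set j | q j \in Bd]; split=> //; last first.
  move=> j; rewrite !inE negb_and -leqNgt => /orP[|//].
  by move/injectivePn => [i [i' /eqP ii' /qinj[_ /ii']]].
have nB : (#|Bd| * b ^ s <= 2 * #|Bad|)%N.
  apply: (@leq_trans (2 * \sum_(z in Bd) #|BadC z|)).
    rewrite big_distrr /= -sum_nat_const; apply: leq_sum => z.
    by rewrite inE => /andP[_ /ltnW].
  rewrite leq_mul2l /= -card_dep_pairs.
  rewrite -(card_in_imset (f := fun zh => x zh.1 zh.2)).
    apply: subset_leq_card; apply/subsetP => y /imsetP[[z h]]; rewrite !inE /=.
    by move=> /andP[_ hB] ->.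
  move=> [z h] [z' h'] _ _ /= /ffunP E; congr (_, _); apply/ffunP => i.
    by have := E i; rewrite !ffunE => /einj[].
  by have := E i; rewrite !ffunE => /einj[].
have Ns : (N.+1%:R : R) ^+ s <= 2 * (N ^_ s)%:R.
  have N0 : 0 < N.+1%:R :> R by rewrite ltr0n.
  have sN1 : (s < N.+1)%N.
    by apply: leq_trans sN; rewrite mulnA leq_pmull // muln_gt0 s0.
  apply: (@le_trans _ _ (2 * (N - s)%:R ^+ s)); last first.
    by rewrite ler_wpM2l // -natrX ler_nat exp_le_ffact.
  have -> : (N - s)%:R = N.+1%:R * (1 - s.+1%:R / N.+1%:R) :> R.
    by rewrite mulrBr mulr1 mulrCA divff ?mulr1 ?gt_eqF // -natrB // subSS.
  rewrite exprMn mulrCA ler_peMr ?exprn_ge0 //.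
  have : 1 - s%:R * (s.+1%:R / N.+1%:R) <= (1 - s.+1%:R / N.+1%:R) ^+ s :> R.
    by rewrite bernoulli_sub // divr_ge0 //= ler_pdivrMr // mul1r ler_nat.
  have : s%:R * (s.+1%:R / N.+1%:R) <= 1 / 2 :> R.
    rewrite mulrA ler_pdivrMr // -natrM.
    have : (2 * (s * s.+1))%N%:R <= N.+1%:R :> R by rewrite ler_nat.
    by rewrite natrM; lra.
  by move: (s%:R * _) ((1 - _) ^+ s) => y z; lra.
have Nf0 : 0 < (N ^_ s)%:R :> R.
  have : 0 < (N.+1%:R : R) ^+ s by rewrite exprn_gt0 // ltr0n.
  move=> /lt_le_trans/(_ Ns); lra.
rewrite -(ler_pM2r Nf0).
apply: (@le_trans _ _ (L%:R * #|Bd|%:R)); first by rewrite -!natrM ler_nat.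
suff : #|Bd|%:R <= 4 * f * (N ^_ s)%:R :> R.
  by move=> h; rewrite [_ * L%:R]mulrC -mulrA ler_wpM2l.
have bs0 : 0 < (b ^ s)%:R :> R by rewrite ltr0n expn_gt0 b0.
rewrite -(ler_pM2r bs0) -natrM.
apply: (@le_trans _ _ (2 * #|Bad|)%:R); first by rewrite ler_nat.
rewrite natrM.
have h1 : #|V|%:R ^+ s <= (N.+1%:R : R) ^+ s * (b ^ s)%:R.
  by rewrite -natrX -natrX -natrM ler_nat -expnMn; case: (s) s0 => // s' _; rewrite leq_exp2r.
have h2 := ler_wpM2l f0 h1.
have h3 : f * (N.+1%:R ^+ s * (b ^ s)%:R) <= f * (2 * (N ^_ s)%:R * (b ^ s)%:R).
  by rewrite ler_wpM2l // ler_wpM2r // ltW.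
move: cBad h2 h3; move: (#|V|%:R ^+ s) (N.+1%:R ^+ s) ((b ^ s)%:R : R) ((N ^_ s)%:R : R).
by move=> v n b' n'; lra.
Qed.

(** The 7 collects three losses: 2f from rounding the fractional matchings, 4f from bad groups, and
    f from vertices outside all groups, as (1 - 2f)(1 - 4f)(1 - f) is at least 1 - 7f. *)
Lemma ap_numeric (eps lam eta f V A B L J s u b N : R) :
  0 < eps <= 1 -> f = eps / 7 -> 0 < eta <= 1 -> 0 <= V -> 0 <= L -> 0 <= s -> 0 <= b ->
  N - s <= L * s -> b * (s + 1) <= f * V -> V <= (N + 1) * b -> eta * b = u ->
  J <= 4 * f * L -> (1 - 2 * f) * s * u * (L - J) <= B -> (1 - lam) * V <= A ->
  (1 - ((1 - eta) * lam + eta * eps)) * V <= (1 - eta) * A + B.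
Proof.
move=> /andP[eps0 eps1] fE /andP[eta0 eta1] V0 L0 s0 b0 Lr nbf VN <- cJ cB cA.
have f0 : 0 <= f by rewrite fE; lra.
have f1 : f <= 1 / 7 by rewrite fE; lra.
have t1 : (1 - eta) * ((1 - lam) * V) <= (1 - eta) * A.
  by rewrite ler_wpM2l // subr_ge0.
suff t2 : eta * (1 - eps) * V <= B by move: t1 t2; lra.
apply: le_trans cB.
have f2 : 0 <= 1 - 2 * f by lra.
have f4 : 0 <= 1 - 4 * f by lra.
have w0 : 0 <= (1 - 2 * f) * s * (eta * b) by rewrite !mulr_ge0 // ltW.
have t3 : (1 - 4 * f) * L <= L - J by move: cJ; lra.
apply: le_trans (ler_wpM2l w0 t3).
have t4 : (1 - f) * V <= b * (L * s).
  apply: (@le_trans _ _ (b * (N - s))); last by rewrite ler_wpM2l.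
  by move: nbf VN; lra.
have f24 : 0 <= eta * ((1 - 2 * f) * (1 - 4 * f)) by rewrite !mulr_ge0 // ltW.
have t5 := ler_wpM2l f24 t4.
have key : 1 - eps <= (1 - 2 * f) * (1 - 4 * f) * (1 - f).
  have -> : eps = 7 * f by rewrite fE; field.
  have ff : 0 <= f ^+ 2 by rewrite sqr_ge0.
  have fff : f ^+ 3 <= f ^+ 2 by rewrite exprS ler_piMl //; lra.
  have -> : (1 - 2 * f) * (1 - 4 * f) * (1 - f) = 1 - 7 * f + 14 * f ^+ 2 - 8 * f ^+ 3.
    by ring.
  by move: ff fff; lra.
have eV : 0 <= eta * V by rewrite mulr_ge0 // ltW.
by have := ler_wpM2l eV key; move: t5; lra.
Qed.

(* Every part of an old block keeps exactly a fraction 1 - eta of its vertices,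
   so old blocks stay balanced whichever groups turn out to be bad; the removed
   vertices are re-tiled almost perfectly inside the good groups. *)
Lemma ap_step (eps : R) : (0 < m)%N -> (1 <= d <= k - 1)%N -> 0 <= c -> 0 < g ->
  SpaAt d F c -> 0 < eps <= 1 ->
  exists2 eta : R, 0 < eta <= 1 &
    forall lam, AlmostPerfect lam -> AlmostPerfect ((1 - eta) * lam + eta * eps).
Proof.
move=> m0 hd c0 g0 hSpa /andP[eps0 eps1].
pose f := eps / 7; have f0 : 0 < f by rewrite divr_gt0.
have f2 : 0 <= 1 - 2 * f by rewrite /f; lra.
have [s [n0 [s0 hs]]] := @sample_spa R k m d F hd c g c0 g0 f f hSpa f0 f0.
have [D D0 hD] := @pack_group R k m F s f m0 s0 f0.
have sr0 : 0 < s%:R :> R by rewrite ltr0n.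
(* The largest fraction that [pack_group] permits to be removed from each part. *)
pose eta : R := (4 * s%:R)^-1.
have eta0 : 0 < eta by rewrite invr_gt0 mulr_gt0.
have eta1 : eta <= 1.
  by rewrite invf_le1 ?mulr_gt0 // -(natrM _ 4) ler1n muln_gt0.
exists eta; first by rewrite eta0.
move=> lam hlam b1 b10; have [b0 hb0] := hD b1 b10.
(* With this b the removed amount [u] is exactly eta b, and both [u] and b - [u] are multiples of
   [b1], so the trimmed parts split into blocks of size [b1]. The factor [l] lifts b above [b0]. *)
pose l := maxn b0 1; pose b := (4 * s * (l * (D * b1)))%N.
pose u := (l * (D * b1))%N.
have u0 : (0 < u)%N by rewrite !muln_gt0 D0 b10 leq_max orbT.
have b_gt0 : (0 < b)%N by rewrite /b muln_gt0 u0 muln_gt0 s0.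
have b0b : (b0 <= b)%N.
  apply: (@leq_trans l); first exact: leq_maxl.
  apply: (@leq_trans u); first by rewrite /u leq_pmulr // muln_gt0 D0.
  by rewrite /b leq_pmull // muln_gt0 s0.
have ub : (u <= b)%N by rewrite /b leq_pmull // muln_gt0 s0.
have buE : (b - u = b1 * ((4 * s).-1 * l * D))%N.
  by rewrite /b -/u -{2}[u]mul1n -mulnBl subn1 /u; ring.
have [n1 hn1] := hlam b b_gt0.
have [n2 hn2] := natr_unbounded ((b * s.+1)%:R / f).
exists (maxn (maxn n0 n1) (maxn n2 (b * (2 * (s * s.+1)))))%N.
move=> disp V G; rewrite !geq_max => /andP[/andP[n0V n1V] /andP[n2V n3V]] tG.
have [Good hGood cGood] := hs disp V G n0V tG.
have [A bA cA] := hn1 disp V G n1V tG.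
have [PA [PAb PAt PAc hPA]] := blocked_parts b_gt0 bA.
have [PV [PVb PVt PVc PVn]] := void_parts (~: A) b_gt0.
pose P := PA :|: PV.
have PAV X Y : X \in PA -> Y \in PV -> [disjoint X & Y].
  move=> XA YV; rewrite disjoint_sym disjoints_subset.
  apply: subset_trans (subset_trans _ PVc) _; first exact: (bigcup_sup Y).
  by rewrite setCS -PAc; apply: (bigcup_sup X).
have Pb X : X \in P -> #|X| = b by move=> /setUP[/PAb|/PVb].
have Pd X Y : X \in P -> Y \in P -> X != Y -> [disjoint X & Y].
  move=> /setUP[XA|XV] /setUP[YA|YV] XY.
  - exact: (trivIsetP PAt).
  - exact: PAV.
  - by rewrite disjoint_sym PAV.
  - exact: (trivIsetP PVt).
have cP : (#|P| * b = #|cover P|)%N.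
  rewrite -sum_nat_const card_bigcup_disjoint //.
  by apply: eq_bigr => X /Pb ->.
have cPA : (#|PA| * b = #|A|)%N.
  rewrite -PAc -sum_nat_const card_bigcup_disjoint; last first.
    by move=> X Y; apply: (trivIsetP PAt).
  by apply: eq_bigr => X /PAb ->.
set N := #|P| in cP.
have VN : (#|V| <= N.+1 * b)%N.
  rewrite mulSn cP addnC -(cardsC A) /cover bigcup_setU -/(cover PA) -/(cover PV) PAc.
  rewrite cardsU (_ : A :&: cover PV = set0) ?cards0 ?subn0; last first.
    by apply: disjoint_setI0; rewrite disjoint_sym disjoints_subset.
  by rewrite -addnA leq_add2l ltnW.
have sN : (2 * (s * s.+1) <= N.+1)%N.
  by rewrite -(leq_pmul2r b_gt0) (leq_trans _ VN) // mulnC.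
pose part (p : 'I_N) := enum_val p.
have partP p : part p \in P by apply: enum_valP.
have [e he] : exists e : 'I_N -> {ffun 'I_b -> V}, forall p,
    injective (e p) /\ [set e p j | j in 'I_b] = part p.
  apply: (@fin_all_exists _ (fun=> {ffun 'I_b -> V})
    (fun p e => injective e /\ [set e j | j in 'I_b] = part p)) => p.
  by have [w w1 w2] := enum_ffun (Pb _ (partP p)); exists w.
have epart p j : e p j \in part p by rewrite -(he p).2 imset_f.
have einj p j p' j' : e p j = e p' j' -> p = p' /\ j = j'.
  move=> E; have pp : p = p'.
    apply: enum_val_inj; apply/eqP; apply/negPn/negP => np.
    by have := disjointFr (Pd _ _ (partP p) (partP p') np) (epart p j); rewrite E epart.
  by split=> //; move: E; rewrite -pp => /(he p).1.
pose L := (N %/ s)%N.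
have LsN : (L * s <= N)%N by apply: leq_trunc_div.
have [q [J [qinj cJ hJ]]] :=
  good_groups s0 b_gt0 (ltW f0) LsN einj cGood VN sN.
have [UB hUB] : exists UB : 'I_L -> ({ffun 'I_s -> {set 'I_b}} * {set V})%type, forall j,
    [/\ forall i, (#|(UB j).1 i| <= u)%N,
        (UB j).2 \subset \bigcup_i (e (q j i) @: (UB j).1 i),
        blocked F G b1 (UB j).2 &
        (1 - 2 * f) * s%:R * u%:R * (j \notin J)%:R <= #|(UB j).2|%:R].
  apply: (@fin_all_exists _ (fun=> ({ffun 'I_s -> {set 'I_b}} * {set V})%type)
   (fun j UB => [/\ forall i, (#|UB.1 i| <= u)%N,
        UB.2 \subset \bigcup_i (e (q j i) @: UB.1 i),
        blocked F G b1 UB.2 &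
        (1 - 2 * f) * s%:R * u%:R * (j \notin J)%:R <= #|UB.2|%:R])) => j.
  have [jJ|jJ] := boolP (j \in J).
    exists ([ffun=> set0], set0); split=> /=; rewrite ?sub0set ?mulr0 //.
      by move=> i; rewrite ffunE cards0.
    exact: blocked0.
  have [||U [B [h1 h2 h3 h4]]] := hb0 b l b0b (leqnn _) disp V G (fun i => e (q j i))
      [set h : {ffun 'I_s -> 'I_b} | [ffun i => e (q j i) (h i)] \in ~: Good] _ _ (hJ j jJ).
  - by move=> i v i' v' /einj[/qinj[_ ->] ->].
  - move=> h; rewrite !inE negbK => /hGood[_].
    congr (spaT _ _); apply/setP => psi; rewrite !inE; congr (ord_hom _ _ _).
    by apply/ffunP => i; rewrite !ffunE.
  exists ([ffun i => U i], B); split=> //=.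
  - by move=> i; rewrite ffunE h1.
  - by apply: subset_trans h2 _; apply/bigcupsP => i _; apply: (bigcup_max i); rewrite ?ffunE.
  - by rewrite mulr1.
pose BB := \bigcup_j (UB j).2.
have subBB v j : v \in (UB j).2 -> exists2 i, v \in part (q j i) & v \in e (q j i) @: (UB j).1 i.
  case: (hUB j) => _ /subsetP h _ _ /h /bigcupP[i _ vi]; exists i => //.
  by case/imsetP: vi => w _ ->; apply: epart.
have partinj v p p' : v \in part p -> v \in part p' -> p = p'.
  rewrite -{1}(he p).2 -{1}(he p').2 => /imsetP[j _ ->] /imsetP[j' _ /einj[]] //.
have cXB X : X \in P -> (#|X :&: BB| <= u)%N.
  move=> XP; have [p <-] : exists p, part p = X.
    by exists (enum_rank_in XP X); rewrite /part enum_rankK_in.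
  have [/existsP[j /existsP[i /eqP pe]]|np] := boolP [exists j, exists i, q j i == p].
    apply: (@leq_trans #|e p @: (UB j).1 i|); last first.
      by apply: leq_trans (leq_imset_card _ _) _; case: (hUB j).
    apply: subset_leq_card; apply/subsetP => v; rewrite inE => /andP[vp /bigcupP[j' _]].
    move=> /subBB[i' vi' ve]; have E : q j' i' = q j i by rewrite pe; apply: partinj vi' vp.
    by have [Ej Ei] := qinj _ _ _ _ E; move: ve; rewrite Ej Ei pe.
  rewrite (_ : _ :&: _ = set0) ?cards0 //; apply/setP => v; rewrite !inE.
  apply/negP => /andP[vp /bigcupP[j _ /subBB[i vi _]]]; case/negP: np.
  by apply/existsP; exists j; apply/existsP; exists i; rewrite (partinj _ _ _ vi vp).
have [fX hfX] : exists fX : {set V} -> {set V}, forall X,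
    X \in P -> fX X \subset X :\: BB /\ #|fX X| = (b - u)%N.
  apply: (@fin_all_exists _ (fun=> {set V})
    (fun X Y => X \in P -> Y \subset X :\: BB /\ #|Y| = (b - u)%N)) => X.
  have [XP|XP] := boolP (X \in P); last by exists set0.
  have [|Y Y1 Y2] := @subset_card _ (X :\: BB) (b - u); last by exists Y.
  by rewrite cardsD (Pb _ XP) leq_sub2l // cXB.
have PAP X : X \in PA -> X \in P by rewrite inE => ->.
have fXX X : X \in P -> fX X \subset X.
  by move=> XP; apply: subset_trans (hfX X XP).1 (subsetDl _ _).
pose AA := \bigcup_(X in PA) fX X.
have bAA : blocked F G b1 AA.
  apply: (hPA b1 ((4 * s).-1 * l * D)%N) => X /PAP XP; first exact: fXX.
  by rewrite (hfX X XP).2.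
have dUB j j' : j != j' -> [disjoint (UB j).2 & (UB j').2].
  move=> jj'; rewrite disjoints_subset; apply/subsetP => v /subBB[i vi _].
  rewrite inE; apply/negP => /subBB[i' vi' _].
  by have [E _] := qinj _ _ _ _ (partinj _ _ _ vi vi'); rewrite E eqxx in jj'.
have bBB : blocked F G b1 BB.
  by apply: blocked_bigcup => // j; case: (hUB j).
have dAB : [disjoint AA & BB].
  rewrite disjoint_sym; apply/bigcup_disjointP => X /PAP XP.
  rewrite disjoint_sym disjoints_subset; case: (hfX X XP) => h _.
  by apply: subset_trans h _; rewrite setDE subsetIr.
exists (AA :|: BB); first exact: blocked_union.
rewrite cardsU (disjoint_setI0 dAB) cards0 subn0 natrD.
have cAA : #|AA| = (#|PA| * (b - u))%N.
  rewrite card_bigcup_disjoint; last first.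
    move=> X Y XA YA XY; apply: disjointWl (fXX _ (PAP _ XA)) _.
    by apply: disjointWr (fXX _ (PAP _ YA)) (trivIsetP PAt _ _ XA YA XY).
  by rewrite -sum_nat_const; apply: eq_bigr => X /PAP XP; case: (hfX X XP).
have etau : eta * b%:R = u%:R.
  by rewrite /eta /b -/u !natrM mulrA mulVf ?mul1r // mulf_neq0 // ?pnatr_eq0 // gt_eqF.
have cAAr : #|AA|%:R = (1 - eta) * #|A|%:R :> R.
  have nb : (b - u)%:R = b%:R - eta * b%:R :> R by rewrite natrB // etau.
  by rewrite cAA -cPA natrM [in RHS]natrM nb; ring.
have cBB : (1 - 2 * f) * s%:R * u%:R * (L%:R - #|J|%:R) <= #|BB|%:R.
  rewrite card_bigcup_disjoint; last by move=> ? ? _ _; apply: dUB.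
  rewrite natr_sum.
  apply: (@le_trans _ _ (\sum_j ((1 - 2 * f) * s%:R * u%:R * (j \notin J)%:R))); last first.
    by apply: ler_sum => j _; case: (hUB j).
  rewrite -mulr_sumr -natr_sum ler_wpM2l ?mulr_ge0 // -big_mkcond sum1_card lerBlDr -natrD.
  rewrite ler_nat -[leqLHS]card_ord -(cardsC J) addnC leq_add2r.
  by apply: eq_leq; apply: eq_card => j; rewrite !inE.
have Lr : N%:R - s%:R <= L%:R * s%:R :> R.
  by rewrite lerBlDr -natrM -natrD ler_nat {1}(divn_eq N s) leq_add2l ltnW // ltn_pmod.
have nbf : b%:R * (s%:R + 1) <= f * #|V|%:R.
  by rewrite natr1 -natrM mulrC -ler_pdivrMr // (le_trans hn2) // ler_nat.
have VNr : #|V|%:R <= (N%:R + 1) * b%:R :> R by rewrite natr1 -natrM ler_nat.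
rewrite cAAr.
by apply: (ap_numeric (f := f)) Lr nbf VNr etau cJ cBB cA; rewrite ?eps0 ?eta0.
Qed.

(** The step with eps / 2 contracts the uncovered fraction towards eps / 2 by the constant factor 1
    - eta. The iteration starts from the empty set, for which nothing is claimed. *)
Lemma almost_perfect (eps : R) : (0 < m)%N -> (1 <= d <= k - 1)%N -> 0 <= c -> 0 < g ->
  SpaAt d F c -> 0 < eps <= 1 -> AlmostPerfect eps.
Proof.
move=> m0 hd c0 g0 hSpa /andP[eps0 eps1].
have [|eta /andP[eta0 eta1] step] := ap_step m0 hd c0 g0 hSpa (eps := eps / 2).
  by rewrite divr_gt0 //=; lra.
have mono l1 l2 : l1 <= l2 -> AlmostPerfect l1 -> AlmostPerfect l2.
  move=> l12 h b b0; have [n0 hn0] := h b b0; exists n0 => disp V G nV tG.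
  have [A bA cA] := hn0 disp V G nV tG; exists A => //; apply: le_trans cA.
  by rewrite ler_wpM2r // lerD2l lerN2.
have iter i : AlmostPerfect ((1 - eta) ^+ i + eps / 2).
  elim: i => [|i IH].
    move=> b b0; exists 0%N => disp V G _ _; exists set0; first exact: blocked0.
    rewrite cards0 expr0; have : 0 <= #|V|%:R :> R by [].
    by have := mulr_ge0 (ltW eps0) (ler0n R #|V|); lra.
  apply: mono (step _ IH); rewrite exprS; lra.
have [||L hL] := @poly_geom_small R (1 - eta) 0 (eps / 2).
- by rewrite subr_ge0 eta1 /=; lra.
- by rewrite divr_gt0.
apply: mono (iter L); have := hL L (leqnn _); rewrite expr0 mul1r; lra.
Qed.

End AlmostPerfect.

(** * Absorbers *)

Section Absorbers.

Lemma disjoint_subsets (J T : finType) (n : J -> nat) (Y : {set T}) :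
  (\sum_j n j <= #|Y|)%N -> exists Z : J -> {set T},
    [/\ forall j, Z j \subset Y, forall j, #|Z j| = n j &
        forall i j, i != j -> [disjoint Z i & Z j]].
Proof.
rewrite -big_enum /= => hn.
suff h : forall l : seq J, uniq l -> (\sum_(j <- l) n j <= #|Y|)%N -> exists Z : J -> {set T},
    [/\ forall j, Z j \subset Y, forall j, #|Z j| = if j \in l then n j else 0%N &
        forall i j, i != j -> [disjoint Z i & Z j]].
  have [Z [h1 h2 h3]] := h _ (enum_uniq J) hn; exists Z; split=> // j.
  by rewrite h2 mem_enum.
elim=> [|j l IH] /=.
  exists (fun=> set0); split=> *; rewrite ?sub0set ?cards0 //.
  by rewrite disjoints_subset sub0set.
move=> /andP[jl ul]; rewrite big_cons => hY.
have [|Z [h1 h2 h3]] := IH ul; first by rewrite (leq_trans _ hY) // leq_addl.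
have Zj : Z j = set0 by apply/eqP; rewrite -cards_eq0 h2 (negPf jl).
have cU : #|\bigcup_i Z i| = (\sum_(j <- l) n j)%N.
  rewrite card_bigcup_disjoint; last by move=> ? ? _ _; apply: h3.
  rewrite (eq_bigr _ (fun i _ => h2 i)) -big_mkcond /= -big_uniq //.
have UY : \bigcup_i Z i \subset Y by apply/bigcupsP => i _.
have [|W WY Wn] := @subset_card _ (Y :\: \bigcup_i Z i) (n j).
  by rewrite cardsD (setIidPr UY) cU; lia.
have WZ i : [disjoint W & Z i].
  rewrite disjoints_subset (subset_trans WY) // setDE.
  by rewrite (subset_trans (subsetIr _ _)) // setCS (bigcup_sup i).
exists (fun i => if i == j then W else Z i); split=> [i|i|i i' ii'].
- by case: eqP => _ //; apply: subset_trans WY (subsetDl _ _).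
- rewrite inE; case: eqVneq => [->|_]; rewrite ?Wn //= h2 //.
- have [Ei|Ni] := eqVneq i j; have [Ei'|Ni'] := eqVneq i' j.
  + by move: ii'; rewrite Ei Ei' eqxx.
  + exact: WZ.
  + by rewrite disjoint_sym.
  + exact: h3.
Qed.

Variables (k m : nat) (F : kgraph k 'I_m).

Definition addpart (disp : Order.disp_t) (V : finOrderType disp) (I : finType)
    (X : I -> {set V}) (q : V) (o : option I) : {set V} :=
  if o is Some v then X v else [set q].

(** For each j a copy of F following [psi j] passes through [Q j] once and takes the set [Z v j]
    from part v. What these copies leave in the parts is balanced for the weights [b], so
    [box_blocked] tiles it. *)
Lemma absorb_box (disp : Order.disp_t) (V : finOrderType disp) (G : kgraph k V)
    (I : finType) (X Y : I -> {set V}) (Q : 'I_m -> V) H Hj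
    (psi : 'I_m -> {ffun 'I_m -> option I}) (b : {ffun 'I_m -> I} -> nat) :
  injective Q -> box F G X H -> (forall j, box F G (addpart X (Q j)) (Hj j)) ->
  (forall j, psi j \in Hj j) -> (forall j, hmult None (psi j) = 1%N) ->
  (forall v, Y v \subset X v) ->
  (forall v, #|Y v| = \sum_(p in H) b p * hmult v p + \sum_j hmult (Some v) (psi j))%N ->
  tileable F G (\bigcup_v Y v :|: [set Q j | j in 'I_m]).
Proof.
move=> Qinj bX bXj psiH psi1 YX Yc; have [X0 Xd XH] := bX.
have QX j v : Q j \notin X v.
  have [_ /(_ None (Some v) isT) h _] := bXj j.
  have /= {}h : [disjoint [set Q j] & X v] := h.
  by rewrite (disjointFr h) // inE.
have [Z hZ] : exists Z : I -> 'I_m -> {set V}, forall v,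
    [/\ forall j, Z v j \subset Y v, forall j, #|Z v j| = hmult (Some v) (psi j) &
        forall i j, i != j -> [disjoint Z v i & Z v j]].
  apply: (@fin_all_exists _ (fun=> 'I_m -> {set V}) (fun v Z =>
    [/\ forall j, Z j \subset Y v, forall j, #|Z j| = hmult (Some v) (psi j) &
        forall i j, i != j -> [disjoint Z i & Z j]])) => v.
  by apply: disjoint_subsets; rewrite Yc leq_addl.
have ZY v j : Z v j \subset Y v by case: (hZ v).
have Zc v j : #|Z v j| = hmult (Some v) (psi j) by case: (hZ v).
have Zd v i j : i != j -> [disjoint Z v i & Z v j] by case: (hZ v) => _ _; apply.
pose T j := \bigcup_o addpart (fun v => Z v j) (Q j) o.
have TE j x : (x \in T j) = (x == Q j) || [exists v, x \in Z v j].
  apply/bigcupP/orP => [[[v|] _ /= h]|[/eqP ->|/existsP[v h]]].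
  - by right; apply/existsP; exists v.
  - by left; rewrite inE in h.
  - by exists None => //=; rewrite inE.
  - by exists (Some v).
pose Yr v := Y v :\: \bigcup_j Z v j.
have bT j : blocked F G 1 (T j).
  apply: (box_blocked (a := fun p => (p == psi j) : nat) _ (bXj j)) => // [[v|]|o] /=.
  - by apply: subset_trans (ZY v j) (YX v).
  - by [].
  rewrite mul1n (bigD1 (psi j)) //= eqxx mul1n big1 ?addn0.
    by case: o => [v|] /=; rewrite ?Zc // psi1 cards1.
  by move=> p /andP[_ /negPf ->].
have bY : blocked F G 1 (\bigcup_v Yr v).
  apply: (box_blocked (a := b) _ bX) => // v.
    exact: subset_trans (subsetDl _ _) (YX v).
  rewrite mul1n cardsD (_ : Y v :&: _ = \bigcup_j Z v j); last first.
    by apply/setIidPr/bigcupsP => j _.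
  rewrite card_bigcup_disjoint; last by move=> ? ? _ _; apply: Zd.
  by rewrite Yc (eq_bigr _ (fun j _ => Zc v j)) addnK.
have ZX v j x : x \in Z v j -> x \in X v.
  by move=> h; apply: (subsetP (YX v)); apply: (subsetP (ZY v j)).
have XX v v' x : x \in X v -> x \in X v' -> v = v'.
  move=> h h'; apply/eqP/negPn/negP => nv.
  by have := disjointFr (Xd _ _ nv) h; rewrite h'.
have bTT : blocked F G 1 (\bigcup_j T j).
  apply: blocked_bigcup => // i j ij; rewrite disjoints_subset; apply/subsetP => x.
  rewrite inE !TE => /orP[/eqP ->|/existsP[v xv]]; apply/negP => /orP[|/existsP[v' xv']].
  - by move=> /eqP/Qinj E; rewrite E eqxx in ij.
  - by have := QX i v'; rewrite (ZX _ _ _ xv').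
  - by move=> /eqP E; have := QX j v; rewrite -E (ZX _ _ _ xv).
  - have E := XX _ _ _ (ZX _ _ _ xv) (ZX _ _ _ xv').
    by rewrite -E in xv'; have := disjointFr (Zd v _ _ ij) xv; rewrite xv'.
have -> : \bigcup_v Y v :|: [set Q j | j in 'I_m] = \bigcup_v Yr v :|: \bigcup_j T j.
  apply/setP => x; rewrite !in_setU; apply/orP/orP => -[/bigcupP[v _ xv]|h].
  - have [h|h] := boolP (x \in \bigcup_j Z v j); last first.
      by left; apply/bigcupP; exists v => //; rewrite inE h.
    right; case/bigcupP: h => j _ xj; apply/bigcupP; exists j => //; rewrite TE.
    by apply/orP; right; apply/existsP; exists v.
  - by right; case/imsetP: h => j _ ->; apply/bigcupP; exists j; rewrite // TE eqxx.
  - by left; apply/bigcupP; exists v => //; move: xv; rewrite inE => /andP[].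
  - case/bigcupP: h => j _; rewrite TE => /orP[/eqP ->|/existsP[v xv]].
      by right; rewrite imset_f.
    by left; apply/bigcupP; exists v => //; apply: (subsetP (ZY v j)).
apply: blocked1_tileable; apply: blocked_union => //.
apply/bigcup_disjointP => j _; rewrite disjoint_sym; apply/bigcup_disjointP => v _.
rewrite disjoints_subset; apply/subsetP => x; rewrite TE !inE negb_and negbK.
move=> /orP[/eqP ->|/existsP[v' xv]].
  by apply/orP; right; apply: contra (QX j v); apply: (subsetP (YX v)).
have [E|nv] := eqVneq v v'.
  by apply/orP; left; rewrite E; apply/bigcupP; exists j.
apply/orP; right; apply: contra nv => xY; apply/eqP; apply: XX (ZX _ _ _ xv).
exact: (subsetP (YX v)).
Qed.

(* The size a of an absorber is made independent of the type by padding with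
   copies of a fixed homomorphism. *)
Lemma absorber_weights s : (0 < m)%N -> (0 < s)%N -> exists a, [/\ (0 < a)%N, (m %| a)%N &
  forall (H : {set {ffun 'I_m -> 'I_s}}) (psi : 'I_m -> {ffun 'I_m -> option 'I_s}),
  (forall t : 'I_s -> int, (m%:Z %| \sum_v t v)%Z -> latT H t) ->
  (forall j, hmult None (psi j) = 1%N) ->
  exists al be : {ffun 'I_m -> 'I_s} -> nat,
    (forall v, \sum_(p in H) al p * hmult v p =
       \sum_(p in H) be p * hmult v p + \sum_j hmult (Some v) (psi j))%N /\
    (\sum_v \sum_(p in H) al p * hmult v p = a)%N].
Proof.
move=> m0 s0.
(* The possible types together with the possible demands t, where t v is the number of vertices of
   part v used by the m copies through Q. Finiteness yields one shift that makes every integer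
   solution nonnegative. *)
pose K : finType := ({set {ffun 'I_m -> 'I_s}} * {ffun 'I_s -> 'I_(m * m).+1})%type.
have [N hN] : exists N : K -> nat, forall p : K,
    latT p.1 (fun v => (p.2 v)%:Z) -> exists w : {ffun 'I_m -> 'I_s} -> int,
      (forall v, \sum_(q in p.1) w q * (hmult v q)%:Z = (p.2 v)%:Z) /\
      forall q, 0 <= (N p)%:Z + w q.
  apply: (@fin_all_exists _ (fun=> nat) (fun (p : K) N =>
    latT p.1 (fun v => (p.2 v)%:Z) -> exists w : {ffun 'I_m -> 'I_s} -> int,
      (forall v, \sum_(q in p.1) w q * (hmult v q)%:Z = (p.2 v)%:Z) /\
      forall q, 0 <= N%:Z + w q)) => p.
  have [[w hw]|nl] := mathcomp.classical.boolp.pselect (latT p.1 (fun v => (p.2 v)%:Z));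
    last by exists 0%N.
  exists (\sum_q `|w q|)%N => _; exists w; split=> // q.
  rewrite (bigD1 q) //=; move: (\sum_(i | i != q) _)%N => S; lia.
pose N0 := (\max_p N p)%N; pose k1 := #|{: {ffun 'I_m -> 'I_s}}|.
exists (m * (N0 * k1 + m))%N; split; first by rewrite muln_gt0 m0 ltn_addl.
  exact: dvdn_mulr.
move=> H psi hlat psi1.
pose t v := (\sum_j hmult (Some v) (psi j))%N.
have tm v : (t v < (m * m).+1)%N.
  rewrite ltnS /t -[X in (_ <= X * _)%N]card_ord -(sum_nat_const 'I_m) [leqRHS](eq_bigl predT) //.
  by apply: leq_sum => j _; rewrite -[leqRHS]card_ord max_card.
have st : (\sum_v t v = m * (m - 1))%N.
  rewrite /t exchange_big /= -[X in _ = (X * _)%N]card_ord -(sum_nat_const 'I_m).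
  rewrite [RHS](eq_bigl predT) //; apply: eq_bigr => j _.
  have := sum_hmult (psi j); rewrite (bigD1 None) //= psi1.
  rewrite (reindex_onto Some (odflt (Ordinal s0))) /=; last by case.
  rewrite (eq_bigl predT) => [h|v]; last by rewrite eqxx.
  by have /= := congr1 (subn^~ 1%N) h; rewrite addKn.
have [psi0 psi0H] : exists p, p \in H.
  have [|w hw] := hlat (fun v => if v == Ordinal s0 then m%:Z else 0).
    by rewrite -big_mkcond /= big_pred1_eq dvdzz.
  apply/set0Pn/negP => /eqP H0; have := hw (Ordinal s0).
  by rewrite H0 big_set0 eqxx; lia.
have [|w [hw1 hw2]] := hN (H, [ffun v => Ordinal (tm v)]).
  apply: latT_ext (hlat (fun v => (t v)%:Z) _) => [v /=|]; first by rewrite ffunE.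
  rewrite -(big_morph Posz PoszD (erefl _)) st; apply/dvdzP; exists (m - 1)%N%:Z.
  by rewrite mulnC PoszM.
have N0p p : (N p <= N0)%N by apply: (leq_bigmax p).
have hw0 q : 0 <= N0%:Z + w q.
  have := hw2 q; have := N0p (H, [ffun v => Ordinal (tm v)]); lia.
(* The padding raises the total weight of [be] to N0 k1 + 1 for every H. Each homomorphism uses m
   vertices and the copies through Q use m (m - 1) more, so the size is m (N0 k1 + m). *)
pose l := (N0 * (k1 - #|H|) + 1)%N.
pose be q := (N0 + (q == psi0) * l)%N.
pose al q := (absz (N0%:Z + w q)%R + (q == psi0) * l)%N.
have alE v : (\sum_(p in H) al p * hmult v p =
    \sum_(p in H) be p * hmult v p + \sum_j hmult (Some v) (psi j))%N.
  apply/eqP; rewrite -eqz_nat PoszD !(big_morph Posz PoszD (erefl _)); apply/eqP.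
  have /= := hw1 v; rewrite ffunE /= => h.
  have -> : \sum_j (hmult (Some v) (psi j))%:Z = (t v)%:Z.
    by rewrite /t (big_morph Posz PoszD (erefl _)).
  rewrite -h -big_split /=; apply: eq_bigr => q _.
  by rewrite !PoszM /al /be !PoszD gez0_abs //; ring.
exists al, be; split=> //.
under eq_bigr do rewrite alE; rewrite big_split /= -/t.
have -> : (\sum_i \sum_j hmult (Some i) (psi j) = m * (m - 1))%N by apply: st.
rewrite exchange_big /=; under eq_bigr do rewrite -big_distrr /= sum_hmult.
rewrite -big_distrl /= /be big_split /= sum_nat_const.
have -> : (\sum_(q in H) (q == psi0) * l = l)%N.
  rewrite (bigD1 psi0) //= eqxx mul1n big1 ?addn0 // => q /andP[_ /negPf ->].
  by rewrite mul0n.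
have Hk : (#|H| <= k1)%N by apply: max_card.
rewrite mulnC -mulnDr /l; congr (_ * _)%N.
rewrite -[k1 in RHS](subnKC Hk) mulnDr [(#|H| * N0)%N]mulnC.
by move: (N0 * _)%N (N0 * _)%N => x y; lia.
Qed.

End Absorbers.

Section ManyAbsorbers.
Variables (R : realType) (k m d : nat) (F : kgraph k 'I_m).

Definition absorber (disp : Order.disp_t) (V : finOrderType disp) (G : kgraph k V) a
    (Q : 'I_m -> V) (y : {ffun 'I_a -> V}) :=
  [/\ injective y, forall i j, y i != Q j, tileable F G [set y i | i in 'I_a] &
      tileable F G ([set y i | i in 'I_a] :|: [set Q j | j in 'I_m])].

Lemma tau_ext (disp : Order.disp_t) (V : finOrderType disp) (G : kgraph k V)
    (I : finType) (x x' : I -> V) : x =1 x' -> tau F G x = tau F G x'.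
Proof.
move=> E; apply/setP => psi; rewrite !inE; congr (ord_hom _ _ _).
by apply/ffunP => i; rewrite !ffunE E.
Qed.

(** Samples are coloured by their own type and their types with each [Q j] added, and boxes are
    found in a popular colour. The absorber in a box consists of the first [n v] entries of row v,
    where [n] depends on the colour only; reading it off is a restriction to a fixed set of a
    coordinates, so a positive density of boxes gives a positive density of absorbers. *)
Lemma many_absorbers (c g : R) : (0 < m)%N -> (1 <= d <= k - 1)%N -> 0 <= c -> 0 < g ->
  DivAt d F c -> CovAt d F c ->
  exists a (c0 : R) n0, [/\ (0 < a)%N, (m %| a)%N, 0 < c0 &
    forall disp (V : finOrderType disp) (G : kgraph k V), (n0 <= #|V|)%N ->
      tdense G d (c + g) -> forall Q : 'I_m -> V, injective Q ->
      exists2 Abs : {set {ffun 'I_a -> V}}, (forall y, y \in Abs -> absorber G Q y) &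
        c0 * #|V|%:R ^+ a <= #|Abs|%:R].
Proof.
move=> m0 hd c0 g0 hDiv hCov.
have [s [n0 [s0 hs]]] := @sample_abs R k m d F hd c g c0 g0 m0 hDiv hCov.
have [a [a0 ma hw]] := absorber_weights m0 s0.
pose K : finType := ({set {ffun 'I_m -> 'I_s}} *
  {ffun 'I_m -> {set {ffun 'I_m -> option 'I_s}}})%type.
have K0 : 0 < (#|K|)%:R :> R by rewrite ltr0n; apply/card_gt0P; exists (set0, [ffun=> set0]).
have p0 : 0 < 1 / 2 / #|K|%:R :> R by rewrite !divr_gt0.
have [cB cB0 hB] := @boxes_dense R a s _ a0 p0.
have [n1 hn1] := natr_unbounded (((s * a) ^ 2)%:R / (cB / 2)).
exists a, (cB / 2), (maxn n0 n1.+1); split=> //; first by rewrite divr_gt0.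
move=> disp V G; rewrite geq_max => /andP[n0V n1V] tG Q Qinj.
have V0 : 0 < #|V|%:R :> R by rewrite ltr0n (leq_trans _ n1V).
have [Good hGood cGood] := hs disp V G n0V tG Q.
pose col (x : {ffun 'I_s -> V}) : K :=
  (tau F G x, [ffun j => tau F G (fun o => oapp x (Q j) o)]).
have [[H Hj] hH] := pigeonhole col Good (set0, [ffun=> set0]).
pose A := [set x in Good | col x == (H, Hj)]; rewrite -/A in hH.
have cA : 1 / 2 / #|K|%:R * #|V|%:R ^+ s <= #|A|%:R :> R.
  by rewrite mulrAC ler_pdivrMr // (le_trans cGood) // -natrM mulnC ler_nat.
have {hB} cBox := hB V A cA.
pose I : finType := ('I_s * 'I_a)%type.
pose flat (X : {ffun 'I_s -> {ffun 'I_a -> V}}) : {ffun I -> V} := [ffun p => X p.1 p.2].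
have flatinj : injective flat.
  move=> X X' /ffunP h; apply/ffunP => v; apply/ffunP => i.
  by have := h (v, i); rewrite !ffunE.
pose NI := [set X : {ffun 'I_s -> {ffun 'I_a -> V}} | ~~ injectiveb (flat X)].
pose GB := boxes a A :\: NI.
have cI : #|I| = (s * a)%N by rewrite card_prod !card_ord.
have sa0 : (0 < s * a)%N by rewrite muln_gt0 s0.
have cNI : #|NI|%:R <= cB / 2 * #|V|%:R ^+ (s * a).
  apply: (@le_trans _ _ (((s * a) ^ 2)%:R * #|V|%:R ^+ (s * a).-1)).
    rewrite -natrX -natrM ler_nat -(card_imset _ flatinj) -cI.
    apply: leq_trans (card_noninj I V); apply: subset_leq_card.
    by apply/subsetP => z /imsetP[X]; rewrite !inE => h ->.
  rewrite -[in leRHS](prednK sa0) exprS mulrA ler_wpM2r ?exprn_ge0 //.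
  by rewrite mulrC -ler_pdivrMr ?divr_gt0 // (le_trans hn1) // ler_nat ltnW.
have cGB : cB / 2 * #|V|%:R ^+ (s * a) <= #|GB|%:R.
  have : #|boxes a A|%:R <= #|GB|%:R + #|NI|%:R :> R.
    rewrite -natrD ler_nat -(cardsID NI (boxes a A)) addnC leq_add2l.
    by apply: subset_leq_card; apply: subsetIr.
  by move: cBox cNI; move: (#|V|%:R ^+ (s * a)) => v; lra.
have VP : 0 < cB / 2 * #|V|%:R ^+ (s * a) by rewrite mulr_gt0 ?divr_gt0 // exprn_gt0.
have transA X : X \in GB -> forall h : {ffun 'I_s -> 'I_a}, [ffun v => X v (h v)] \in A.
  by rewrite inE => /andP[_]; rewrite inE => /forallP.
have AP x : x \in A -> [/\ x \in Good, tau F G x = H &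
    forall j, tau F G (fun o => oapp x (Q j) o) = Hj j].
  rewrite inE => /andP[xG /eqP[EH Ej]]; split=> // j.
  by rewrite -Ej ffunE.
have [X0 X0B] : exists X, X \in GB.
  by apply/set0Pn; rewrite -card_gt0 -(ltr0n R) (lt_le_trans VP).
have [x0 x0A] : exists x, x \in A.
  by exists [ffun v => X0 v ([ffun=> Ordinal a0] v)]; apply: transA.
have [x0G x0H x0j] := AP _ x0A.
have [_ hlat hcov] := hGood _ x0G; rewrite x0H in hlat.
have [psi hpsi] : exists psi : 'I_m -> {ffun 'I_m -> option 'I_s}, forall j,
    psi j \in Hj j /\ hmult None (psi j) = 1%N.
  apply: (@fin_all_exists _ (fun=> {ffun 'I_m -> option 'I_s})
    (fun j p => p \in Hj j /\ hmult None p = 1%N)) => j.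
  by have [_ []] := hcov j; rewrite x0j => p p1 p2; exists p.
have [al [be [hal sal]]] := hw H psi hlat (fun j => (hpsi j).2).
pose n v := (\sum_(p in H) al p * hmult v p)%N.
pose E := [set p : I | (p.2 < n p.1)%N].
have na v : (n v <= a)%N by rewrite -[leqRHS]sal /n (bigD1 v) //= leq_addr.
have cE : #|E| = a.
  rewrite -[RHS]sal -sum1_card (partition_big fst predT) //=.
  apply: eq_bigr => v _; have nv : (0 + n v <= a)%N by rewrite add0n na.
  rewrite -/(n v) -[RHS](card_ord_interval nv).
  have vinj : injective (fun i : 'I_a => (v, i)) by move=> ? ? [].
  rewrite -[RHS](card_imset _ vinj).
  transitivity #|[set p in E | p.1 == v]|.
    by rewrite -sum1_card; apply: eq_bigl => p; rewrite !inE.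
  apply: eq_card => -[v' i]; rewrite !inE /=; apply/andP/imsetP => [[h /eqP vv]|[i' h [-> ->]]].
    by rewrite -vv; exists i; rewrite ?inE ?add0n.
  by move: h; rewrite ?inE ?add0n.
have [e einj eE] := enum_ffun cE.
pose yX X : {ffun 'I_a -> V} := restr e (flat X).
exists (yX @: GB); last first.
  have : (#|GB| <= #|yX @: GB| * #|V| ^ (s * a - a))%N.
    apply: (card_fibers (f := yX)) => [X XB|y _]; first exact: imset_f.
    have := @card_fiber _ _ V e y einj; rewrite cI card_ord; apply: leq_trans.
    rewrite -(card_imset _ flatinj); apply: subset_leq_card.
    apply/subsetP => z /imsetP[X]; rewrite !inE => /andP[_ /eqP <-] ->.
    by apply/forallP => i; rewrite !ffunE.
  have asa : (a <= s * a)%N by rewrite leq_pmull.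
  rewrite -(ler_nat R) natrM natrX => /(le_trans cGB).
  by rewrite -[X in #|V|%:R ^+ X](subnKC asa) exprD mulrA ler_pM2r // exprn_gt0.
move=> y /imsetP[X XB ->].
have Xinj v i v' i' : X v i = X v' i' -> v = v' /\ i = i'.
  move=> h; move: XB; rewrite !inE negbK => /andP[/injectiveP Xi _].
  by have [] : (v, i) = (v', i') by apply: Xi; rewrite !ffunE.
have XQ v i j : X v i != Q j.
  have := transA X XB [ffun=> i] => /AP[/hGood[_ _ /(_ j)[/(_ v)]]].
  by rewrite !ffunE.
pose Xs v := [set X v i | i in 'I_a].
have trans x : (forall v, x v \in Xs v) -> exists2 x' : {ffun 'I_s -> V}, x' \in A & x =1 x'.
  move=> hx; have [h hh] : exists h : 'I_s -> 'I_a, forall v, x v = X v (h v).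
    apply: (@fin_all_exists _ (fun=> 'I_a) (fun v i => x v = X v i)) => v.
    by have /imsetP[i _ ->] := hx v; exists i.
  exists [ffun v => X v ([ffun v => h v] v)]; first exact: transA.
  by move=> v; rewrite !ffunE hh.
have Xs0 v : Xs v != set0 by apply/set0Pn; exists (X v (Ordinal a0)); apply: imset_f.
have Xsd v v' : v != v' -> [disjoint Xs v & Xs v'].
  move=> vv'; rewrite disjoints_subset; apply/subsetP => w /imsetP[i _ ->].
  by rewrite inE; apply/negP => /imsetP[i' _ /Xinj[h _]]; rewrite h eqxx in vv'.
have bX : box F G Xs H.
  split=> // x /trans[x' /AP[_ E' _] xx']; by rewrite (tau_ext G xx') E'.
have XsQ v j : [disjoint Xs v & [set Q j]].
  rewrite disjoint_sym disjoints1; apply/negP => /imsetP[i _ /esym/eqP].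
  by rewrite (negPf (XQ _ _ _)).
have bXj j : box F G (addpart Xs (Q j)) (Hj j).
  split=> [[v|]|[v|] [v'|] // vv'|x hx] //=.
  - by apply/set0Pn; exists (Q j); rewrite inE.
  - exact: Xsd.
  - by rewrite disjoint_sym.
  have [|x' /AP[_ _ E'] xx'] := trans (fun v => x (Some v)).
    by move=> v; apply: (hx (Some v)).
  rewrite -E' (@tau_ext _ _ G _ x (fun o => oapp x' (Q j) o)) // => -[v|] /=.
    exact: xx'.
  by have := hx None; rewrite inE => /eqP.
pose Y v := [set X v i | i in [set i : 'I_a | (0 <= i < 0 + n v)%N]].
have YX v : Y v \subset Xs v by apply: imsetS; apply/subsetP.
have Yc v : #|Y v| = n v.
  by rewrite card_imset ?card_ord_interval ?add0n // => i i' /Xinj[].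
have YE : [set yX X i | i in 'I_a] = \bigcup_v Y v.
  apply/setP => w; apply/imsetP/bigcupP => [[i _ ->]|[v _ /imsetP[i]]].
    have : e i \in E by rewrite -eE imset_f.
    rewrite inE => ei; exists (e i).1 => //; rewrite !ffunE; apply: imset_f.
    by rewrite inE add0n.
  rewrite inE add0n => iv ->; have : (v, i) \in E by rewrite inE.
  by rewrite -eE => /imsetP[i' _ Ei]; exists i'; rewrite // !ffunE -Ei.
split.
- move=> i i'; rewrite !ffunE => /Xinj[E1 E2]; apply: einj.
  by move: E1 E2; case: (e i) (e i') => [? ?] [? ?] /= -> ->.
- by move=> i j; rewrite !ffunE XQ.
- rewrite YE; apply: blocked1_tileable; apply: (box_blocked (a := al) _ bX) => // v.
  by rewrite mul1n Yc.
- rewrite YE; apply: (absorb_box (b := be) Qinj bX bXj (fun j => (hpsi j).1)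
    (fun j => (hpsi j).2) YX) => v.
  by rewrite Yc /n hal.
Qed.

End ManyAbsorbers.

(** * The absorbing family and the upper bound *)

Section Greedy.
Variables (R : realType) (V X : finType) (a : nat).
Variables (Xi : {set X}) (Abs : X -> {set {ffun 'I_a -> V}}) (c : R).
Hypotheses (c0 : 0 < c) (c1 : c <= 1) (a0 : (0 < a)%N) (Xi0 : Xi != set0).
Hypothesis cAbs : forall q, q \in Xi -> c * #|V|%:R ^+ a <= #|Abs q|%:R.

Definition im (y : {ffun 'I_a -> V}) : {set V} := [set y i | i in 'I_a].

Lemma exists_le_average (Y : finType) (A : {set Y}) (f : Y -> R) (b : R) :
  A != set0 -> \sum_(y in A) f y <= b * #|A|%:R -> exists2 y, y \in A & f y <= b.
Proof.
move=> /set0Pn[y0 y0A] h; have [/exists_inP//|] := boolP [exists y in A, f y <= b].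
rewrite negb_exists_in => /forall_inP hf; have : b * #|A|%:R < \sum_(y in A) f y.
  rewrite mulr_natr -sumr_const (bigD1 y0) //= [ltRHS](bigD1 y0) //= ltr_leD //.
    by rewrite ltNge hf.
  by apply: ler_sum => y /andP[yA _]; rewrite ltW // ltNge hf.
by rewrite ltNge h.
Qed.

(* Derandomised random selection: the potential sum_q 2^-(number of chosen
   elements of Abs q) shrinks by a constant factor at each step. *)
Lemma greedy_family T : (a * (a * T))%N%:R <= c / 2 * #|V|%:R ->
  exists Fam : {set {ffun 'I_a -> V}},
    [/\ #|Fam| = T, forall y y', y \in Fam -> y' \in Fam -> y != y' -> [disjoint im y & im y'],
        forall y, y \in Fam -> exists2 q, q \in Xi & y \in Abs q &
        \sum_(q in Xi) (1 / 2) ^+ #|Fam :&: Abs q| <= (1 - c / 4) ^+ T * #|Xi|%:R].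
Proof.
elim: T => [|T IH] hT.
  exists set0; split=> [|y y'|y|]; rewrite ?cards0 ?inE //.
  rewrite expr0 [leRHS]mul1r -[#|Xi|]sum1_card natr_sum; apply: ler_sum => q _.
  by rewrite set0I cards0 expr0.
have [|Fam [cF dF hF sF]] := IH.
  by apply: le_trans hT; rewrite ler_nat !leq_mul2l leqnSn !orbT.
have V0 : 0 < #|V|%:R :> R.
  rewrite -(pmulr_rgt0 _ (x := c / 2)) ?divr_gt0 //; apply: lt_le_trans hT.
  by rewrite ltr0n !muln_gt0 a0.
pose U := \bigcup_(y in Fam) im y.
have cU : (#|U| <= a * T)%N.
  apply: leq_trans (card_bigcup_le _ _) _.
  rewrite mulnC -cF -sum_nat_const; apply: leq_sum => y _.
  by rewrite (leq_trans (leq_imset_card _ _)) // card_ord.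
pose hit := [set y : {ffun 'I_a -> V} | [exists i, y i \in U]].
have chit : #|hit|%:R <= c / 2 * #|V|%:R ^+ a.
  have := @card_ffun_exists 'I_a V (fun=> U) _ (fun=> cU).
  rewrite card_ord -(ler_nat R) natrM natrM natrX => /le_trans -> //.
  rewrite -[in leRHS](prednK a0) exprS !mulrA ler_wpM2r ?exprn_ge0 //.
  by apply: le_trans hT; rewrite -natrM ler_nat !leq_mul2l leqnSn !orbT.
pose ok := [set y | (y \notin hit) && [exists q in Xi, y \in Abs q]].
have cok q : q \in Xi -> c / 2 * #|V|%:R ^+ a <= #|ok :&: Abs q|%:R.
  move=> qX; have : #|Abs q|%:R <= #|ok :&: Abs q|%:R + #|hit|%:R :> R.
    rewrite -natrD ler_nat.
    apply: (@leq_trans #|(ok :&: Abs q) :|: hit|); last exact: (leq_card_setU _ _).1.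
    apply: subset_leq_card; apply/subsetP => y yq; rewrite !in_setU in_setI [y \in ok]inE yq.
    case: (y \in hit) => //=; rewrite orbF andbT; apply/exists_inP; by exists q.
  by move: chit (cAbs qX); lra.
have okV : #|ok|%:R <= #|V|%:R ^+ a :> R.
  by rewrite -natrX ler_nat (leq_trans (max_card _)) // card_ffun card_ord.
have ok0 : ok != set0.
  case/set0Pn: Xi0 => q qX; rewrite -card_gt0 -(ltr0n R).
  apply: (@lt_le_trans _ _ #|ok :&: Abs q|%:R); last first.
    by rewrite ler_nat; apply: subset_leq_card; apply: subsetIl.
  by apply: lt_le_trans (cok q qX); rewrite mulr_gt0 ?divr_gt0 // exprn_gt0.
pose pot y q : R := (1 / 2) ^+ #|(y |: Fam) :&: Abs q|.
have h2 j : 0 <= (1 / 2) ^+ j :> R by rewrite exprn_ge0 // divr_ge0.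
(* A y in [Abs q] halves the term of q. For each q such y form at least a proportion c/2 of [ok], so
   on average the term shrinks by the factor 1 - c/4. *)
have [|y yok hy] := @exists_le_average _ ok (fun y => \sum_(q in Xi) pot y q)
    ((1 - c / 4) ^+ T.+1 * #|Xi|%:R) ok0.
  rewrite exchange_big /=.
  apply: (@le_trans _ _ (\sum_(q in Xi) (1 / 2) ^+ #|Fam :&: Abs q| * ((1 - c / 4) * #|ok|%:R))).
    apply: ler_sum => q qX.
    apply: (@le_trans _ _ (\sum_(y in ok) (1 / 2) ^+ #|Fam :&: Abs q| *
        (1 - 1 / 2 * (y \in Abs q)%:R))).
      apply: ler_sum => y yok; rewrite /pot setIUl.
      have [yq|yq] := boolP (y \in Abs q); last first.
        by rewrite (_ : [set y] :&: _ = set0) ?set0U ?mulr0 ?subr0 ?mulr1 //;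
          apply/setP => z; rewrite !inE; case: eqP => // ->; apply/negbTE.
      rewrite (_ : [set y] :&: _ = [set y]); last by apply/setIidPl; rewrite sub1set.
      rewrite cardsU1 (_ : y \notin _) /=.
        by rewrite exprS mulrC mulr1 ler_wpM2l //; lra.
      rewrite inE negb_and; apply/orP; left; apply/negP => yF.
      move: yok; rewrite inE => /andP[/negP yh _]; apply: yh; rewrite inE.
      apply/existsP; exists (Ordinal a0); apply/bigcupP; exists y => //.
      exact: imset_f.
    rewrite -mulr_sumr ler_wpM2l // sumrB sumr_const -mulr_sumr -natr_sum -big_mkcondr /=.
    rewrite sum1dep_card.
    have -> : #|[set y | (y \in ok) && (y \in Abs q)]| = #|ok :&: Abs q|.
      by apply: eq_card => y; rewrite !inE.
    have : c / 4 * #|ok|%:R <= c / 4 * #|V|%:R ^+ a.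
      by rewrite ler_wpM2l // divr_ge0 // ltW.
    by have := cok q qX; lra.
  have w0 : 0 <= (1 - c / 4) * #|ok|%:R by rewrite mulr_ge0 //; move: c1; lra.
  rewrite -mulr_suml; apply: le_trans (ler_wpM2r w0 sF) _.
  by rewrite exprS le_eqVlt; apply/orP; left; apply/eqP; ring.
exists (y |: Fam).
move: (yok); rewrite inE => /andP[yh /exists_inP[q qX yq]].
have yU : [disjoint im y & U].
  rewrite disjoints_subset; apply/subsetP => v /imsetP[i _ ->]; rewrite inE.
  by apply: contra yh => yi; rewrite inE; apply/existsP; exists i.
have yF y' : y' \in Fam -> [disjoint im y & im y'].
  by move=> y'F; apply: disjointWr yU; apply: (bigcup_sup y').
have yFam : y \notin Fam.
  apply/negP => /yF; rewrite -setI_eq0 setIid => /eqP h.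
  by have : y (Ordinal a0) \in im y; [apply: imset_f | rewrite h inE].
split=> //.
- by rewrite cardsU1 yFam cF.
- move=> z z' /setU1P[->|zF] /setU1P[->|z'F]; rewrite ?eqxx // => zz'.
  + exact: yF.
  + by rewrite disjoint_sym yF.
  + exact: dF.
- by move=> z /setU1P[->|/hF//]; exists q.
Qed.

End Greedy.

Section AbsorbAll.
Variables (k m : nat) (F : kgraph k 'I_m) (a : nat).
Variables (disp : Order.disp_t) (V : finOrderType disp) (G : kgraph k V).

Lemma tileable_dvd (A : {set V}) : tileable F G A -> (m %| #|A|)%N.
Proof.
elim=> [|phi B /andP[/injectiveP pinj _] dB _ IH]; first by rewrite cards0 dvdn0.
by rewrite cardsU (disjoint_setI0 dB) cards0 subn0 card_imset // card_ord dvdn_addr.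
Qed.

(** Absorbing one m-subset of U removes one member of the family and so lowers every count of
    available absorbers by at most one. The members left at the end are tileable by themselves. *)
Lemma absorb_all (Abs : {ffun 'I_m -> V} -> {set {ffun 'I_a -> V}})
    (Fam : {set {ffun 'I_a -> V}}) l (U : {set V}) :
  (forall (Q : {ffun 'I_m -> V}) y, injective Q -> y \in Abs Q -> absorber F G Q y) ->
  (forall y y', y \in Fam -> y' \in Fam -> y != y' -> [disjoint im y & im y']) ->
  (forall y, y \in Fam -> tileable F G (im y)) ->
  (forall Q : {ffun 'I_m -> V}, injective Q -> l <= #|Fam :&: Abs Q|)%N ->
  #|U| = (m * l)%N -> [disjoint U & \bigcup_(y in Fam) im y] ->
  tileable F G (U :|: \bigcup_(y in Fam) im y).
Proof.
move=> hAbs; elim: l Fam U => [|l IH] Fam U dF tF hl cU dU.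
  have -> : U = set0 by apply/eqP; rewrite -cards_eq0 cU muln0.
  rewrite set0U => {hl cU dU U}; move: {2}#|Fam| (erefl #|Fam|) => n.
  elim: n Fam dF tF => [|n IHn] Fam dF tF cF.
    have -> : Fam = set0 by apply/eqP; rewrite -cards_eq0 cF.
    by rewrite big_set0; apply: tileable0.
  have [y yF] : exists y, y \in Fam by apply/set0Pn; rewrite -card_gt0 cF.
  rewrite (big_setD1 y) //=; apply: tileable_union; first exact: tF.
    apply: IHn; [|by move=> z; rewrite inE => /andP[_ /tF]|].
      by move=> z z' ; rewrite !inE => /andP[_ zF] /andP[_ z'F]; apply: dF.
    by move: cF; rewrite (cardsD1 y) yF => -[].
  apply/bigcup_disjointP => z; rewrite !inE => /andP[zy zF].
  by apply: dF; rewrite // eq_sym.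
have [|S SU cS] := @subset_card _ U m; first by rewrite cU mulnS leq_addr.
have [Q Qinj QS] := enum_ffun cS.
have [y] : exists y, y \in Fam :&: Abs Q.
  by apply/set0Pn; rewrite -card_gt0 (leq_trans _ (hl Q Qinj)).
rewrite inE => /andP[yF yA].
have [yinj yQ ty tyQ] := hAbs Q y Qinj yA.
have -> : U :|: \bigcup_(y in Fam) im y =
    (im y :|: S) :|: ((U :\: S) :|: \bigcup_(z in Fam :\ y) im z).
  by rewrite (big_setD1 y) //= -{1}(setID U S) (setIidPr SU) setUACA [S :|: _]setUC.
have dyR : [disjoint im y & \bigcup_(z in Fam :\ y) im z].
  apply/bigcup_disjointP => z; rewrite !inE => /andP[zy zF].
  by apply: dF; rewrite // eq_sym.
have sub : \bigcup_(z in Fam :\ y) im z \subset \bigcup_(z in Fam) im z.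
  apply/bigcupsP => z; rewrite inE => /andP[_ zF]; exact: (bigcup_sup z).
apply: tileable_union; first by rewrite -QS.
  apply: IH.
  - by move=> z z' ; rewrite !inE => /andP[_ zF] /andP[_ z'F]; apply: dF.
  - by move=> z; rewrite inE => /andP[_ /tF].
  - move=> Q' Q'inj; have := hl Q' Q'inj.
    rewrite (cardsD1 y) -setIDAC; case: (_ \in _) => /= [|h]; first by rewrite add1n ltnS.
    by rewrite ltnW.
  - by rewrite cardsD (setIidPr SU) cU cS mulnS addKn.
  - by apply: disjointWl (subsetDl _ _) (disjointWr sub dU).
rewrite disjoints_subset subUset -!disjoints_subset; apply/andP; split.
  rewrite disjoint_sym disjoints_subset subUset -!disjoints_subset; apply/andP; split.
    apply: disjointWl (subsetDl _ _) (disjointWr _ dU); exact: (bigcup_sup y).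
  by rewrite disjoint_sym.
rewrite disjoint_sym disjoints_subset subUset -!disjoints_subset; apply/andP; split.
  by rewrite disjoints_subset setDE subsetIr.
by rewrite disjoint_sym; apply: disjointWl SU (disjointWr sub dU).
Qed.

End AbsorbAll.

Section UpperBound.
Variables (R : realType) (k m d : nat) (F : kgraph k 'I_m).

Lemma tileable_image (disp disp' : Order.disp_t) (V : finOrderType disp)
    (W : finOrderType disp') (G : kgraph k V) (GW : kgraph k W) (g : W -> V) :
  injective g -> (forall e, e \in HOrd F GW -> tmap g e \in tau F G id) ->
  forall A, tileable F GW A -> tileable F G (g @: A).
Proof.
move=> ginj hE A; elim=> [|phi B /andP[/injectiveP pinj hphi] dB _ IH].
  by rewrite imset0; apply: tileable0.
rewrite imsetU; pose phi' : {ffun 'I_m -> V} := [ffun i => g (phi i)].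
have E : g @: [set phi i | i in 'I_m] = [set phi' i | i in 'I_m].
  by rewrite -imset_comp; apply: eq_imset => i; rewrite ffunE.
rewrite E; apply: tileableU => //; last first.
  by rewrite -E -setI_eq0 -imsetI ?(disjoint_setI0 dB) ?imset0 // => ? ? _ _; apply: ginj.
apply/andP; split.
  by apply/injectiveP => i j; rewrite !ffunE => /ginj/pinj.
have := hE [tuple phi i | i < m]; rewrite inE.
rewrite (_ : [ffun i => _] = phi'); last first.
  by apply/ffunP => i; rewrite !ffunE tnth_mktuple.
apply; apply/imsetP; exists phi => //; by rewrite inE.
Qed.

(** At most (k - d) #|U| #|V|^(k-d-1) extensions of a given d-set meet U. *)
Lemma induced_delete (c g : R) (disp : Order.disp_t) (V : finOrderType disp)
    (G : kgraph k V) (U : {set V}) :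
  (d < k)%N -> 0 <= c -> 0 < g -> ((k - d) * #|U|)%N%:R <= g * #|V|%:R ->
  tdense G d (c + g) ->
  exists disp' (W : finOrderType disp') (GW : kgraph k W) (g' : W -> V),
    [/\ injective g', #|W| = #|~: U|, g' @: setT = ~: U, tdense GW d c &
        forall e, e \in HOrd F GW -> tmap g' e \in tau F G id].
Proof.
move=> dk c0 g0 hU tG; have r0 : (0 < k - d)%N by rewrite subn_gt0.
apply: induced_sample => // D _ Dd; rewrite imset_id.
have h1 : #|ext (k - d) G D|%:R <= #|[set z : {ffun 'I_(k - d) -> V} |
    [forall i, z i \in ~: U] && (restr z [ffun i => i] \in ext (k - d) G D)]|%:R
    + #|[set z : {ffun 'I_(k - d) -> V} | [exists i, z i \in U]]|%:R :> R.
  rewrite -natrD ler_nat; apply: leq_trans (leq_card_setU _ _).1.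
  apply: subset_leq_card; apply/subsetP => z zE; rewrite in_setU !in_set.
  have [|nU] := boolP [exists i, z i \in U]; first by rewrite orbT.
  rewrite orbF; apply/andP; split.
    by apply/forallP => i; rewrite inE; move/existsPn: nU => /(_ i).
  rewrite (_ : restr _ _ = z); first by rewrite inE in zE.
  by apply/ffunP => i; rewrite !ffunE.
have h2 : #|[set z : {ffun 'I_(k - d) -> V} | [exists i, z i \in U]]|%:R <=
    g * #|V|%:R ^+ (k - d).
  have := @card_ffun_exists 'I_(k - d) V (fun=> U) _ (fun=> leqnn _).
  rewrite card_ord -(ler_nat R) mulnA natrM natrX => /le_trans -> //.
  by rewrite -[X in _ <= _ * _ ^+ X](prednK r0) exprS mulrA ler_wpM2r ?exprn_ge0.
have h3 : c * #|~: U|%:R ^+ (k - d) <= c * #|V|%:R ^+ (k - d).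
  by rewrite ler_wpM2l // lerXn2r ?nnegrE // ler_nat max_card.
by have := tG D Dd; move: h1 h2 h3; lra.
Qed.

Theorem tiling_upper (c g : R) : (0 < m)%N -> (1 <= d <= k - 1)%N -> 0 <= c -> 0 < g ->
  SpaAt d F c -> DivAt d F c -> CovAt d F c ->
  exists n0, forall disp (V : finOrderType disp) (G : kgraph k V),
    (n0 <= #|V|)%N -> (m %| #|V|)%N -> dense G d (c + g) -> has_perfect_tiling F G.
Proof.
(* Passing to ordered extensions leaves the surplus g/2 = 2h: one h pays for deleting the absorbing
   family, the other is used by the almost perfect tiling. *)
move=> m0 hd c0 g0 hSpa hDiv hCov; pose h := g / 4.
have h0 : 0 < h by rewrite divr_gt0.
have dk : (d < k)%N by case/andP: hd; lia.
have [n1 hn1] := dense_tdense (ltnW dk) c0 g0.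
have [a [c1 [n2 [a0 ma c10 hn2]]]] :=
  many_absorbers m0 hd c0 (divr_gt0 g0 (ltr0Sn _ 1) : 0 < g / 2) hDiv hCov.
pose c2 := Num.min c1 1.
have c20 : 0 < c2 by rewrite lt_min c10 ltr01.
have c21 : c2 <= 1 by rewrite ge_min lexx orbT.
have c2c1 : c2 <= c1 by rewrite ge_min lexx.
have c24 : 0 <= 1 - c2 / 4 by lra.
(* After T = M j selections the potential is at most (1/4)^j n^m, whereas a Q with fewer than j
   absorbers in the family contributes more than (1/2)^j. As n < J (j + 1), the choice of [j0] makes
   the former smaller. *)
have [|M hM] := @poly_geom_small R (1 - c2 / 4) 0 (1 / 4) _ (divr_gt0 ltr01 (ltr0Sn _ _)).
  by move: c20 c21; lra.
have {hM} := hM M (leqnn _); rewrite expr0 mul1r => hM.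
(* The family has M j members with j about n / J. [J1] leaves room for the greedy selection, [J2]
   bounds the degree loss by h, and 2 a M <= J keeps at least half of the vertices outside the
   family. *)
have [J1 hJ1] := natr_unbounded ((a * (a * M))%:R / (c2 / 2)).
have [J2 hJ2] := natr_unbounded (((k - d) * (a * M))%:R / h).
pose J := (J1 + J2 + 2 * (a * M)).+1.
have [J1J J2J aMJ] : [/\ J1 <= J, J2 <= J & 2 * (a * M) <= J]%N.
  by rewrite /J; split; apply: leqW; [rewrite -addnA leq_addr | rewrite addnAC leq_addl |
    rewrite leq_addl].
have J0 : 0 < J%:R :> R by rewrite ltr0n.
have half : 0 <= (1 / 2 : R) <= 1 by apply/andP; split; lra.
(* The leftover is then at most n / (2J), hence at most j because n < J (j + 1) and j >= 1. *)
pose lam : R := (2 * J%:R)^-1.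
have lam0 : 0 < lam by rewrite invr_gt0 mulr_gt0.
have lam1 : lam <= 1.
  by rewrite invf_le1 ?mulr_gt0 // -(natrM _ 2) ler1n.
have hAP := @almost_perfect R k m d F c h lam m0 hd c0 h0 hSpa; rewrite lam0 in hAP.
have [n3 hn3] := hAP lam1 1%N isT.
have Jm0 : 0 < (2 * J%:R ^+ m)^-1 :> R by rewrite invr_gt0 mulr_gt0 // exprn_gt0.
have [|j0 hj0] := @poly_geom_small R (1 / 2) m _ _ Jm0.
  by apply/andP; split; lra.
exists (maxn n1 (maxn n2 (maxn (2 * n3) (maxn (J * j0.+1) m)))).
move=> disp V G; rewrite !geq_max => /and5P[n1V n2V n3V j0V mV] mdV dG.
have tG := hn1 V G n1V dG.
set n := #|V| in n1V n2V n3V j0V mV mdV.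
pose j := (n %/ J)%N.
have jn : (J * j <= n)%N by rewrite mulnC leq_trunc_div.
have nj : (n < J * j.+1)%N by rewrite mulnC ltn_ceil.
have jj0 : (j0 < j)%N by rewrite leq_divRL // mulnC.
have jnr : J%:R * j%:R <= n%:R :> R by rewrite -natrM ler_nat.
pose T := (M * j)%N.
have bound (x : R) N J' : 0 < x -> N%:R / x <= J'%:R -> (J' <= J)%N -> (N * j)%N%:R <= x * n%:R.
  move=> x0 hN J'J; rewrite natrM; apply: (@le_trans _ _ (x * (J%:R * j%:R))).
    rewrite mulrA ler_wpM2r // mulrC -ler_pdivrMr // (le_trans hN) // ler_nat //.
  by rewrite ler_wpM2l // ltW.
have aT1 : (a * (a * T))%N%:R <= c2 / 2 * n%:R.
  have := bound (c2 / 2) _ J1 _ hJ1; rewrite /T !mulnA; apply => //.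
  by rewrite divr_gt0.
have aT2 : ((k - d) * (a * T))%N%:R <= h * n%:R.
  by have := bound h _ J2 h0 hJ2; rewrite /T !mulnA; apply.
have aT3 : (2 * (a * T) <= n)%N.
  by apply: leq_trans jn; rewrite /T !mulnA leq_mul2r -mulnA aMJ orbT.
pose Xi : {set {ffun 'I_m -> V}} := [set Q : {ffun 'I_m -> V} | injectiveb Q].
have hX (Q : {ffun 'I_m -> V}) : exists Abs : {set {ffun 'I_a -> V}}, Q \in Xi ->
    (forall y, y \in Abs -> absorber F G Q y) /\ c2 * n%:R ^+ a <= #|Abs|%:R.
  have [QX|_] := boolP (Q \in Xi); last by exists set0.
  move: QX; rewrite inE => /injectiveP Qinj.
  have [Abs h1 h2] := hn2 disp V G n2V tG Q Qinj; exists Abs => _; split=> //.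
  by apply: le_trans h2; rewrite ler_wpM2r // exprn_ge0.
have [Abs hAbs] := fin_all_exists hX.
have Xi0 : Xi != set0.
  by rewrite -card_gt0 cardsE; have := card_inj_ffuns 'I_m V; rewrite cardsE card_ord => ->; rewrite ffact_gt0.
have [|Fam [cF dF hF sF]] :=
  @greedy_family R V _ a Xi Abs c2 c20 c21 a0 Xi0 _ T aT1.
  by move=> Q QX; case: (hAbs Q QX).
have absF y : y \in Fam -> exists Q : 'I_m -> V, absorber F G Q y.
  by move=> /hF[Q QX yQ]; exists Q; case: (hAbs Q QX) => h1 _; apply: h1.
pose U := \bigcup_(y in Fam) im y.
have cU : #|U| = (a * T)%N.
  rewrite /U card_bigcup_disjoint // mulnC -cF -sum_nat_const; apply: eq_bigr => y.
  by move=> /absF[Q [yinj _ _ _]]; rewrite /im card_imset // card_ord.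
have [||||disp' [W [GW [g' [ginj cW gS tW hE]]]]] := @induced_delete (c + h) h disp V G U dk.
- by rewrite addr_ge0 // ltW.
- exact: h0.
- by rewrite cU.
- by rewrite (_ : c + h + h = c + g / 2) // /h; field.
have cUU := cardsC U; rewrite -/n cU -cW in cUU.
have [|A bA cA] := hn3 disp' W GW _ tW.
  by move: n3V aT3 cUU; move: (a * T)%N (#|W|) => x y; clear; lia.
have tA := tileable_image ginj hE (blocked1_tileable bA).
pose U' := ~: (U :|: g' @: A).
have gAU : [disjoint g' @: A & U].
  rewrite disjoints_subset -gS; exact/imsetS/subsetT.
have cgA : #|g' @: A| = #|A| by rewrite card_imset.
have cU' : (#|U'| + (#|A| + a * T) = n)%N.
  rewrite addnC /n -(cardsC (U :|: g' @: A)) cardsU (_ : U :&: _ = set0).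
    by rewrite cards0 subn0 cU cgA [(a * T + _)%N]addnC.
  by rewrite setIC; apply: disjoint_setI0.
have mU' : (m %| #|U'|)%N.
  have mA : (m %| #|A| + a * T)%N.
    by rewrite dvdn_add ?dvdn_mulr // -cgA; apply: tileable_dvd tA.
  by rewrite -(dvdn_addl _ mA) cU'.
have /dvdnP[l cl] := mU'; rewrite mulnC in cl.
have lj : (l <= j)%N.
  apply: (@leq_trans #|U'|); first by rewrite cl leq_pmull.
  rewrite -(ler_nat R).
  have h1 : #|U'|%:R = #|W|%:R - #|A|%:R :> R.
    apply/eqP; rewrite eq_sym subr_eq -natrD eqr_nat; apply/eqP.
    by move: cU'; rewrite -cUU; move: (a * T)%N (#|U'|) (#|A|) (#|W|); clear; lia.
  have h2 : #|W|%:R <= n%:R :> R by rewrite ler_nat -cUU leq_addl.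
  have h3 : lam * n%:R <= j%:R.
    rewrite /lam mulrC ler_pdivrMr ?mulr_gt0 //.
    apply: (@le_trans _ _ (J * j.+1)%:R); first by rewrite ler_nat ltnW.
    rewrite -(natrM _ 2) -natrM ler_nat [leqRHS]mulnA [leqRHS]mulnC leq_mul2l.
    by apply/orP; right; move: jj0; clear; lia.
  have h4 : lam * #|W|%:R <= lam * n%:R by rewrite ler_wpM2l // ltW.
  apply: le_trans (le_trans h4 h3).
  by rewrite h1 lerBlDr addrC -lerBlDr -[X in X - _]mul1r -mulrBl.
have count (Q : {ffun 'I_m -> V}) : injective Q -> (l <= #|Fam :&: Abs Q|)%N.
  move=> Qinj; have QX : Q \in Xi by rewrite inE; apply/injectiveP.
  rewrite leqNgt; apply/negP => lt.
  have : (1 / 2) ^+ j <= (1 - c2 / 4) ^+ T * n%:R ^+ m :> R.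
    apply: (@le_trans _ _ ((1 / 2) ^+ #|Fam :&: Abs Q|)).
      by case/andP: half => ? ?; rewrite ler_wiXn2l // (leq_trans _ lj) // ltnW.
    apply: (@le_trans _ _ (\sum_(Q in Xi) (1 / 2) ^+ #|Fam :&: Abs Q|)).
      by rewrite (bigD1 Q) //= lerDl sumr_ge0 // => ? _; rewrite exprn_ge0 // divr_ge0.
    apply: (le_trans sF); rewrite ler_wpM2l ?exprn_ge0 //.
    by rewrite -natrX ler_nat (leq_trans (max_card _)) // card_ffun card_ord.
  apply/negP; rewrite -ltNge.
  apply: (@le_lt_trans _ _ ((1 / 4) ^+ j * (J%:R ^+ m * j.+1%:R ^+ m))).
    apply: ler_pM; rewrite ?exprn_ge0 //.
      by rewrite /T exprM lerXn2r ?nnegrE ?exprn_ge0 ?divr_ge0.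
    by rewrite -exprMn lerXn2r ?nnegrE ?mulr_ge0 // -natrM ler_nat ltnW.
  have := hj0 j (ltnW jj0).
  have -> : (1 / 4 : R) ^+ j = (1 / 2) ^+ j * (1 / 2) ^+ j.
    by rewrite -exprMn; congr (_ ^+ j); field.
  have p0 : 0 < (1 / 2) ^+ j :> R by rewrite exprn_gt0 // divr_gt0.
  have q0 : 0 < J%:R ^+ m :> R by rewrite exprn_gt0.
  rewrite -[X in _ -> _ < X]mulr1 -mulrA ltr_pM2l // => h1.
  move: h1; rewrite -[X in _ <= X]mul1r ler_pdivlMr ?mulr_gt0 //.
  by move: (J%:R ^+ m) (j.+1%:R ^+ m) ((1 / 2) ^+ j) => x y z; lra.
apply: tileable_tiling => //.
have -> : [set: V] = (U' :|: U) :|: g' @: A.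
  by rewrite -setUA /U' setUC setUCr.
apply: tileable_union => //; last first.
  rewrite disjoints_subset subUset /U' setCU subsetIr /=.
  by rewrite -disjoints_subset disjoint_sym.
apply: (absorb_all (Abs := Abs) (l := l)) => //.
- move=> Q y Qinj; have QX : Q \in Xi by rewrite inE; apply/injectiveP.
  by case: (hAbs Q QX) => h1 _; apply: h1.
- by move=> y /absF[Q []].
- by rewrite disjoints_subset /U' setCU subsetIl.
Qed.

End UpperBound.

(** * Thresholds *)

Section MinDegree.
Variables (R : realType) (k d : nat) (V : finType) (G : kgraph k V).

Lemma min_degree_dense (c : R) :
  c * 'C(#|V| - d, k - d)%:R <= (min_degree d G)%:R -> dense G d c.
Proof.
move=> h D Dd; apply: le_trans h _; rewrite ler_nat; apply/bigmax_leqP => l /forallP/(_ D).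
by rewrite Dd eqxx.
Qed.

Lemma dense_min_degree (c : R) : (d <= #|V|)%N -> dense G d c ->
  c * 'C(#|V| - d, k - d)%:R <= (min_degree d G)%:R.
Proof.
move=> dV hc; have [|D0 _ cD0] := @subset_card _ [set: V] d; first by rewrite cardsT.
have D0d : #|D0| == d by apply/eqP.
case: (@arg_minnP _ D0 (fun D : {set V} => #|D| == d) (degree G) D0d) => D /eqP Dd hD.
apply: le_trans (hc D Dd) _; rewrite ler_nat.
have lt : (degree G D < #|edges G|.+1)%N.
  by rewrite ltnS; apply: subset_leq_card; apply/subsetP => e; rewrite inE => /andP[].
apply: (@leq_bigmax_cond _ _ (fun l : 'I_#|edges G|.+1 => l : nat) (Ordinal lt)).
by apply/forallP => S; apply/implyP => /hD.
Qed.

Lemma degree_le (D : {set V}) : #|D| = d -> (degree G D <= 'C(#|V| - d, k - d))%N.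
Proof.
move=> Dd; have <- : #|~: D| = (#|V| - d)%N by rewrite -Dd -(cardsC D) addKn.
have inj : {in [set e in edges G | D \subset e] &, injective (fun e : {set V} => e :\: D)}.
  move=> e e'; rewrite !inE => /andP[_ De] /andP[_ De'] h.
  by rewrite -(setID e D) -(setID e' D) (setIidPr De) (setIidPr De') h.
rewrite -cards_draws /degree -(card_in_imset inj).
apply: subset_leq_card; apply/subsetP => X /imsetP[e]; rewrite !inE => /andP[eG De] ->.
by rewrite setDE subsetIr -setDE cardsD (setIidPr De) (edges_uniform eG) Dd eqxx.
Qed.

End MinDegree.

Section Thresholds.
Variables (R : realType) (k d : nat).
Hypothesis hd : (1 <= d <= k - 1)%N.

Definition threshold_set (q : nat)
    (P : R -> forall disp (V : finOrderType disp), kgraph k V -> Prop) :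
    set R :=
  fun delta : R => 0 <= delta <= 1 /\
    forall mu : R, 0 < mu ->
    exists n0 : nat, forall n : nat, (n0 <= n)%N -> (q %| n)%N ->
    forall disp (V : finOrderType disp) (G : kgraph k V), #|V| = n ->
      (delta + mu) * 'C(n - d, k - d)%:R <= (min_degree d G)%:R ->
      P mu disp V G.

Notation property := (R -> forall disp (V : finOrderType disp), kgraph k V -> Prop).

(** At delta = 1 no graph of order at least k meets the degree condition, since a d-set lies in at
    most C(n - d, k - d) edges. *)
Lemma threshold_set1 q (P : property) : threshold_set q P 1.
Proof.
split; first by rewrite ler01 lexx.
move=> mu mu0; exists k => n kn _ disp V G Vn h.
have dk : (d <= k)%N by case/andP: hd; lia.
have [|D _ Dd] := @subset_card _ [set: V] d; first by rewrite cardsT Vn (leq_trans dk).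
rewrite -Vn in h; have := min_degree_dense h Dd.
have := degree_le G Dd; rewrite -(ler_nat R) => h1 h2; have := le_trans h2 h1.
have : 0 < 'C(#|V| - d, k - d)%:R :> R by rewrite ltr0n bin_gt0 leq_sub2r // Vn.
by move=> c0; rewrite -[X in _ <= X]mul1r ler_pM2r //; lra.
Qed.

Lemma threshold_set_lb q (P : property) : has_lbound (threshold_set q P).
Proof. by exists 0 => x [/andP[]]. Qed.

Lemma threshold_set_inf q (P : property) : has_inf (threshold_set q P).
Proof. by split; [exists 1; apply: threshold_set1 | apply: threshold_set_lb]. Qed.

Lemma threshold_bounds q (P : property) : 0 <= threshold d q P <= 1.
Proof.
rewrite -[threshold _ _ _]/(inf (threshold_set q P)); apply/andP; split;
  last exact: ge_inf (threshold_set_lb q P) _ (threshold_set1 q P).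
by apply: lb_le_inf; [exists 1; apply: threshold_set1 | move=> x [/andP[]]].
Qed.

Lemma threshold_subset q (P : property) q' (P' : property) :
  (forall x, threshold_set q P x -> threshold_set q' P' x) -> threshold d q' P' <= threshold d q P.
Proof.
move=> sub; apply: lb_le_inf; first by exists 1; apply: threshold_set1.
by move=> x /sub; apply: ge_inf; apply: threshold_set_lb.
Qed.

(** The infimum may not be attained; eps is the price of moving to an element of the set close to
    it. *)
Lemma threshold_apply q (P : property) (x eps : R) : 0 < eps -> threshold d q P <= x ->
  forall mu, 0 < mu -> exists n0 : nat,
    forall disp (V : finOrderType disp) (G : kgraph k V), (n0 <= #|V|)%N -> (q %| #|V|)%N ->
      dense G d (x + eps + mu) -> P mu disp V G.
Proof.
move=> eps0 hx mu mu0.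
have [del [_ hdel] lt] := inf_adherent eps0 (threshold_set_inf q P).
have [n0 hn0] := hdel mu mu0; exists (maxn n0 d) => disp V G.
rewrite geq_max => /andP[n0V dV] qV dG; apply: (hn0 #|V|) => //.
apply: le_trans (dense_min_degree dV dG); rewrite ler_wpM2r // lerD2r.
by apply: ltW; apply: lt_le_trans lt _; rewrite lerD2r.
Qed.

End Thresholds.

(** * Consequences of perfect tilings *)

Section LowerBound.
Variables (R : realType) (k m d : nat) (F : kgraph k 'I_m).
Hypotheses (m_gt0 : (0 < m)%N) (hd : (1 <= d <= k - 1)%N).

Lemma tiling_edges (disp disp' : Order.disp_t) (V : finOrderType disp)
    (W : finOrderType disp') (G : kgraph k V) (GW : kgraph k W) (g : W -> V) :
  injective g -> (forall e, e \in HOrd F GW -> tmap g e \in tau F G id) ->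
  has_perfect_tiling F GW -> exists E : {set m.-tuple V},
    [/\ E \subset HOrd F G, forall v e, e \in E -> (mult v e <= 1)%N &
        forall v, (\sum_(e in E) mult v e = (v \in g @: setT))%N].
Proof.
move=> ginj hE [T [T1 T2]].
pose f (phi : {ffun 'I_m -> W}) : m.-tuple V := [tuple g (phi i) | i < m].
have multf phi v : phi \in T -> mult v (f phi) = (v \in g @: codom phi) :> nat.
  move=> /T1[pinj _]; rewrite /mult; have [/imsetP[w /codomP[i ->] ->]|nv] := boolP (v \in _).
    rewrite -[RHS](cards1 i); apply: eq_card => j; rewrite !inE tnth_mktuple.
    by rewrite (inj_eq ginj) (inj_eq pinj).
  apply: eq_card0 => i; rewrite !inE tnth_mktuple; apply: contraNF nv => /eqP <-.
  by rewrite imset_f // codom_f.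
exists (f @: T); split.
- apply/subsetP => e /imsetP[phi pT ->]; apply/imsetP.
  exists [ffun i => g (phi i)]; last by apply: eq_mktuple => i; rewrite ffunE.
  have /hE : [tuple phi i | i < m] \in HOrd F GW.
    by apply: imset_f; rewrite inE; case: (T1 phi pT).
  rewrite !inE; congr (ord_hom _ _ _); apply/ffunP => i.
  by rewrite !ffunE tnth_mktuple.
- by move=> v e /imsetP[phi pT ->]; rewrite multf //; case: (_ \in _).
move=> v; rewrite big_imset /=; last first.
  move=> phi phi' _ _ h; apply/ffunP => i; apply: ginj.
  by have := congr1 (fun e => tnth e i) h; rewrite !tnth_mktuple.
rewrite (eq_bigr (fun phi : {ffun 'I_m -> W} => (v \in g @: codom phi) : nat));
  last by move=> phi pT; apply: multf.
have [/imsetP[w _ ->]|nv] := boolP (v \in g @: setT).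
  rewrite -[RHS](T2 w) -sum1_card [RHS]big_mkcond [LHS]big_mkcond; apply: eq_bigr => phi _.
  by rewrite inE mem_imset //; case: (phi \in T) => //=; case: (w \in _).
rewrite big1 // => phi _; case: imsetP => // -[w _ h].
by case/negP: nv; rewrite h imset_f.
Qed.

Lemma tiling_after_deletion (del mu : R) : 0 < mu ->
  threshold_set d m (fun _ _ _ G => has_perfect_tiling F G) del ->
  exists n0, forall disp (V : finOrderType disp) (G : kgraph k V) v, (n0 <= #|V|)%N ->
    dense G d (del + mu) -> exists E : {set m.-tuple V},
    [/\ E \subset HOrd F G, forall v e, e \in E -> (mult v e <= 1)%N,
        forall u, (\sum_(e in E) mult u e <= 1)%N, (\sum_(e in E) mult v e = 1)%N &
        (#|V| <= m * #|E| + m)%N].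
Proof.
move=> mu0 [/andP[del0 del1] hdel].
(* Of the surplus mu, one quarter is lost in passing to [tdense], one quarter by the deletion, and
   the remaining half is the surplus with which the tiling threshold is applied. *)
have mu20 : 0 < mu / 2 by rewrite divr_gt0.
have mu40 : 0 < mu / 4 by rewrite divr_gt0.
have dk : (d < k)%N by case/andP: hd; lia.
have c0 : 0 <= del + mu / 2 by rewrite addr_ge0 // ltW.
have [n0 hn0] := hdel _ mu20.
have [n1 hn1] := @dense_tdense R k d _ _ (ltnW dk) c0 mu20.
have [n2 hn2] := natr_unbounded (((k - d) * m)%:R / (mu / 4)).
exists (maxn (n0 + d + m)%N (maxn n1 n2)) => disp V G v.
rewrite !geq_max => /and3P[n0V n1V n2V] dG.
have tG := hn1 V G n1V (_ : dense G d (del + mu / 2 + mu / 2)).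
have {}tG : tdense G d (del + mu / 2 + mu / 4).
  have -> : del + mu / 2 + mu / 4 = del + mu / 2 + mu / 2 / 2 by field.
  by apply: tG; rewrite -addrA -splitr.
have [s sE sm] : exists2 s, s = (#|V| %% m)%N & (s < m)%N.
  by exists (#|V| %% m)%N; rewrite ?ltn_pmod.
have mV : (m <= #|V|)%N by rewrite (leq_trans _ n0V) // leq_addl.
have sV : (s <= #|V|)%N by rewrite (leq_trans (ltnW sm)).
have hVs : (n0 + d <= #|V| - s)%N.
  by rewrite leq_subRL // addnC (leq_trans _ n0V) // leq_add2l ltnW.
have [|U Uv cU] := @subset_card _ [set~ v] s.
  by rewrite cardsC1 -ltnS prednK ?(leq_trans sm) // (leq_trans m_gt0).
have [|disp' [W [GW [g' [ginj cW gS tW hE]]]]] :=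
    @induced_delete R k m d F (del + mu / 2) (mu / 4) disp V G U dk c0 mu40 _ tG.
  apply: (@le_trans _ _ ((k - d) * m)%:R).
    by rewrite ler_nat leq_mul2l cU ltnW ?orbT.
  by rewrite [leRHS]mulrC -ler_pdivrMr // (le_trans hn2) // ler_nat.
have cVU : (#|V| - s = #|W|)%N by rewrite cW -(cardsC U) cU addKn.
have hT : has_perfect_tiling F GW.
  apply: (hn0 #|W|) => //.
  - by rewrite -cVU (leq_trans _ hVs) // leq_addr.
  - by rewrite -cVU sE {1}(divn_eq #|V| m) addnK dvdn_mull.
  apply: dense_min_degree; first by rewrite -cVU (leq_trans _ hVs) // leq_addl.
  exact: tdense_dense (ltnW dk) c0 tW.
have [E [E1 E2 E3]] := tiling_edges ginj hE hT; exists E; split=> //.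
- by move=> u; rewrite E3; case: (_ \in _).
- by rewrite E3 gS inE (_ : v \notin U) //; apply/negP => /(subsetP Uv); rewrite !inE eqxx.
have cE : (m * #|E| = #|W|)%N.
  transitivity (\sum_v \sum_(e in E) mult v e)%N.
    rewrite exchange_big /= mulnC -sum_nat_const; apply: eq_bigr => e _.
    rewrite -[LHS]card_ord -sum1_card (partition_big (tnth e) predT) //=.
    by apply: eq_bigr => u _; rewrite /mult -sum1_card; apply: eq_bigl => i; rewrite inE.
  under eq_bigr do rewrite E3; rewrite -big_mkcond sum1_card gS cW.
  by apply: eq_card.
by rewrite cE -cVU -leq_subLR subKn // ltnW.
Qed.

End LowerBound.

Section Comparison.
Variables (R : realType) (k m d : nat) (F : kgraph k 'I_m).
Hypotheses (m_gt0 : (0 < m)%N) (hd : (1 <= d <= k - 1)%N).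

Lemma dense_le (V : finType) (G : kgraph k V) (c c' : R) : c <= c' ->
  dense G d c' -> dense G d c.
Proof. by move=> cc h D Dd; apply: le_trans (h D Dd); rewrite ler_wpM2r. Qed.

Lemma Spa_le (V : finType) (H : mdigraph m V) (rho rho' : R) : rho <= rho' ->
  Spa rho H -> Spa rho' H.
Proof.
move=> rr [w [hw hs]]; exists w; split=> //; apply: le_trans hs.
by rewrite ler_wpM2r ?invr_ge0 // ler_wpM2r // lerD2l lerN2.
Qed.

Lemma OSpa_le_OTil : delta_OSpa R d F <= delta_OTil R d F.
Proof.
apply: threshold_subset => // del hdel; split; first by case: hdel.
move=> mu mu0; have [n0 hn0] := tiling_after_deletion m_gt0 hd mu0 hdel.
(* A tiling that misses at most m vertices is mu-perfect as soon as m <= mu n. *)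
have [n1 hn1] := natr_unbounded (m%:R / mu).
exists (maxn n0 n1.+1) => n; rewrite geq_max => /andP[n0n n1n] _ disp V G Vn h.
rewrite -Vn in n0n n1n h; have dG := min_degree_dense h.
have [v _] : exists v : V, v \in V by apply/card_gt0P; apply: leq_trans n1n.
have [E [E1 E2 E3 _ cE]] := hn0 disp V G v n0n dG.
have m0 : 0 < m%:R :> R by rewrite ltr0n.
have sumE (f : m.-tuple V -> R) : \sum_(e in HOrd F G) (e \in E)%:R * f e = \sum_(e in E) f e.
  rewrite [LHS]big_mkcond [RHS]big_mkcond; apply: eq_bigr => e _.
  have [eE|eE] := boolP (e \in E); first by rewrite (subsetP E1) // mul1r.
  by rewrite mul0r if_same.
exists (fun e => (e \in E)%:R); split; first split.
- by move=> e _; case: (e \in E); rewrite ?lexx ?ler01.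
- by move=> u; rewrite sumE -natr_sum (ler_nat R _ 1).
have := sumE (fun=> 1); under eq_bigr do rewrite mulr1; move=> ->.
rewrite sumr_const ler_pdivrMr // -natrM mulnC.
apply: (@le_trans _ _ (#|V|%:R - m%:R)).
  rewrite mulrBl mul1r lerD2l lerN2 mulrC -ler_pdivrMr // (le_trans hn1) //.
  by rewrite ler_nat ltnW.
by rewrite lerBlDr -natrD ler_nat.
Qed.

Lemma ODiv_le_OTil : delta_ODiv R d F <= delta_OTil R d F.
Proof.
apply: threshold_subset => // del [del01 hdel]; split=> // mu mu0.
have [n0 hn0] := hdel mu mu0; exists n0 => n n0n mn disp V G Vn h.
have hid e : e \in HOrd F G -> tmap id e \in tau F G id.
  move=> /imsetP[phi]; rewrite !inE => hphi ->; congr (ord_hom _ _ _): hphi.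
  by apply/ffunP => i; rewrite !ffunE tnth_mktuple.
have [E [E1 _ E3]] := tiling_edges (@inj_id V) hid (hn0 n n0n mn disp V G Vn h).
exists (fun e => (e \in E)%:Z) => v.
transitivity (\sum_(e in E) (mult v e)%:Z).
  rewrite [LHS]big_mkcond [RHS]big_mkcond; apply: eq_bigr => e _.
  have [eE|eE] := boolP (e \in E); first by rewrite (subsetP E1) // mul1r.
  by rewrite mul0r if_same.
by rewrite -(big_morph Posz PoszD (erefl _)) E3 imset_id inE.
Qed.

Lemma OCov_le_OTil : delta_OCov R d F <= delta_OTil R d F.
Proof.
apply: threshold_subset => // del hdel; split; first by case: hdel.
move=> mu mu0; have [n0 hn0] := tiling_after_deletion m_gt0 hd mu0 hdel.
exists n0 => n n0n _ disp V G Vn h v; rewrite -Vn in n0n h.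
have [E [E1 E2 _ E3 _]] := hn0 disp V G v n0n (min_degree_dense h).
have [/exists_inP[e eE /eqP e1]|] := boolP [exists e in E, mult v e == 1%N].
  by exists e => //; apply: (subsetP E1).
rewrite negb_exists_in => /forall_inP he; move: E3; rewrite big1 // => e eE.
by have := E2 v e eE; have := he e eE; case: (mult v e) => [|[]].
Qed.

Lemma OTil_le_max :
  delta_OTil R d F <= Num.max (delta_OSpa R d F) (Num.max (delta_ODiv R d F) (delta_OCov R d F)).
Proof.
set x := Num.max _ _.
have [xS xD xC] : [/\ delta_OSpa R d F <= x, delta_ODiv R d F <= x & delta_OCov R d F <= x].
  by rewrite /x !le_max !lexx !orbT.
have x0 : 0 <= x by apply: le_trans xS; case/andP: (threshold_bounds (R := R) hd 1 (fun mu _ _ G => Spa mu (HOrd F G))).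
have x1 : x <= 1.
  rewrite /x !ge_max; apply/and3P.
  by split; [case/andP: (threshold_bounds (R := R) hd 1 (fun mu _ _ G => Spa mu (HOrd F G)))
   | case/andP: (threshold_bounds (R := R) hd m (fun _ _ _ G => Div (HOrd F G)))
   | case/andP: (threshold_bounds (R := R) hd 1 (fun _ _ _ G => Cov (HOrd F G)))].
apply: ge_inf; first exact: (threshold_set_lb d m (fun _ _ _ G => has_perfect_tiling F G)).
split; first by rewrite x0.
(* One quarter of mu approximates the infima, one quarter is the surplus required by the three
   thresholds, and the remaining half goes to [tiling_upper]. *)
move=> mu mu0; have mu4 : 0 < mu / 4 by rewrite divr_gt0.
have mu2 : 0 < mu / 2 by rewrite divr_gt0.
have hc : x + mu / 4 + mu / 4 = x + mu / 2 by field.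
have spa : SpaAt d F (x + mu / 2).
  (* In the Spa threshold a single parameter governs both the degree surplus and the defect of the
     matching; the minimum serves both. *)
  move=> rho rho0; have r0 : 0 < Num.min rho (mu / 4) by rewrite lt_min rho0.
  have [n0 hn0] := threshold_apply hd mu4 xS r0; exists n0 => disp V G n0V dG.
  apply: Spa_le (hn0 disp V G n0V (dvd1n _) (dense_le _ dG)); first by rewrite ge_min lexx.
  by rewrite -hc lerD2l ge_min lexx orbT.
have div : DivAt d F (x + mu / 2).
  by have [n0 hn0] := threshold_apply hd mu4 xD mu4; rewrite hc in hn0; exists n0.
have cov : CovAt d F (x + mu / 2).
  have [n0 hn0] := threshold_apply hd mu4 xC mu4; rewrite hc in hn0; exists n0 => disp V G n0V.
  exact: hn0 disp V G n0V (dvd1n _).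
have [|n0 hn0] := tiling_upper m_gt0 hd _ mu2 spa div cov; first by rewrite addr_ge0 // ltW.
exists n0 => n n0n mn disp V G Vn h; rewrite -Vn in n0n mn h.
by apply: hn0 => //; apply: min_degree_dense; rewrite -addrA -splitr.
Qed.

End Comparison.

Theorem corollary4p13 (R : realType) (k d m : nat) (F : kgraph k 'I_m)
    (m_gt0 : (0 < m)%N) (hd : (1 <= d <= k - 1)%N) :
  delta_OTil R d F =
  Num.max (delta_OSpa R d F) (Num.max (delta_ODiv R d F) (delta_OCov R d F)).
Proof.
apply/le_anti; rewrite OTil_le_max // !ge_max.
by rewrite OSpa_le_OTil // ODiv_le_OTil // OCov_le_OTil.
Qed.
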